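(* Let $G$ be a periodic group of infinite rank whose commutator subgroup $G'$ is nilpotent, and suppose that every subnormal subgroup of $G$ of infinite rank is commensurable with some normal subgroup of $G$. Then every subnormal subgroup of $G$ is commensurable with some normal subgroup of $G$.
   Context: Two subgroups $H,K$ of a group are commensurable if $H\cap K$ has finite index in both $H$ and $K$. A group has finite rank $r$ if every finitely generated subgroup can be generated by at most $r$ elements and $r$ is the least such positive integer; it has infinite rank if no such $r$ exists. *)

(* Defs.v *)
From Stdlib Require Import List Arith.
Import ListNotations.

Record Group := {
  carrier :> Type;
  gmul : carrier -> carrier -> carrier;
  gone : carrier;
  ginv : carrier -> carrier;
  gmul_assoc : forall x y z, gmul x (gmul y z) = gmul (gmul x y) z;
  gmul_1l : forall x, gmul gone x = x;
  gmul_Vl : forall x, gmul (ginv x) x = gone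
}.

Arguments gmul {g} x y.
Arguments gone {g}.
Arguments ginv {g} x.

Section GroupDefs.
Variable G : Group.

Definition gset := G -> Prop.
Definition fullset : gset := fun _ => True.
Definition subset (A B : gset) : Prop := forall x, A x -> B x.
Definition inter (A B : gset) : gset := fun x => A x /\ B x.

Fixpoint gpow (x : G) (n : nat) : G :=
  match n with O => gone | S m => gmul x (gpow x m) end.

Definition subgroup (H : gset) : Prop :=
  H gone /\ (forall x y, H x -> H y -> H (gmul x y)) /\ (forall x, H x -> H (ginv x)).

Definition normal_in (H K : gset) : Prop :=
  subgroup H /\ subgroup K /\ subset H K /\
  (forall k h, K k -> H h -> H (gmul (ginv k) (gmul h k))).

Definition normal (H : gset) : Prop := normal_in H fullset.

Definition subnormal (H : gset) : Prop :=
  exists (n : nat) (f : nat -> gset),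
    f 0 = H /\ f n = fullset /\ (forall i, i < n -> normal_in (f i) (f (S i))).

Definition generated (S : gset) : gset :=
  fun x => forall K, subgroup K -> subset S K -> K x.

Definition commutator (x y : G) : G :=
  gmul (ginv x) (gmul (ginv y) (gmul x y)).

Definition comm_subgroup (A B : gset) : gset :=
  generated (fun z => exists a b, A a /\ B b /\ z = commutator a b).

Definition derived : gset := comm_subgroup fullset fullset.

Fixpoint lcs (H : gset) (i : nat) : gset :=
  match i with
  | O => H
  | S j => comm_subgroup (lcs H j) H
  end.

Definition nilpotent (H : gset) : Prop :=
  exists c, forall x, lcs H c x -> x = gone.

(* K (a subgroup contained in H) has finite index in H:
   H is covered by finitely many left cosets x K with x in H *)
Definition finite_index_in (K H : gset) : Prop :=
  exists l : list G, (forall x, In x l -> H x) /\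
    forall h, H h -> exists x, In x l /\ K (gmul (ginv x) h).

Definition commensurable (H K : gset) : Prop :=
  finite_index_in (inter H K) H /\ finite_index_in (inter H K) K.

Definition generated_by (K : gset) (l : list G) : Prop :=
  forall x, K x <-> generated (fun y => In y l) x.

Definition fin_gen (K : gset) : Prop := exists l, generated_by K l.

Definition rank_le (H : gset) (r : nat) : Prop :=
  forall K, subgroup K -> subset K H -> fin_gen K ->
    exists l, length l <= r /\ generated_by K l.

Definition finite_rank (H : gset) : Prop := exists r, rank_le H r.
Definition infinite_rank (H : gset) : Prop := ~ finite_rank H.

Definition periodic : Prop := forall x : G, exists n, 0 < n /\ gpow x n = gone.

End GroupDefs.

Arguments fullset {G}.

(* Main.v *)
(** Let [R = G'] and let [X] be subnormal of finite rank. Commensurability with a normal subgroup passes to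
    intersections, and [X A /\ X B = X] when [A] and [B] are normal torsion subgroups of coprime exponents.

    Suppose [G] has a normal nilpotent subgroup [N] of infinite rank. If all primary components of [N] have finite
    rank, split [N] into two coprime factors [A], [B] of infinite rank and intersect [X A] with [X B]. Otherwise [N]
    may be taken to be a p-group; it contains an infinite elementary abelian subgroup, and the subgroup [M] generated
    by its elements of order [p] is infinite of bounded exponent. Subnormality makes [X] act on [M] as a stability
    group up to finite index, so, having finite rank, [X] has a subgroup [X0] of finite index centralising [M], and
    [X0] is commensurable with [X0 A1 /\ X0 A2] for independent infinite elementary abelian [A1], [A2] in [M].

    In the remaining case [R] has finite rank. Let [B] be the set of primes [p] for which [X R_p'] is not normal. If
    [B] were infinite then, since elementary abelian q-groups acting on [R_p] have rank bounded independently of [p]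
    and [q], there would be an infinite subset [tau] of [B] such that the [tau']-elements centralising [R_tau] form a
    normal subgroup [A] of infinite rank. Then [X A] is commensurable with a normal subgroup [N], which has the same
    p-elements as [X A] for all large [p], and this forces [X R_p'] to be normal for large [p] in [tau]. So [B] is
    finite. Now [X R_B] is normal, while [X R_B'] is commensurable with a normal subgroup because [G / R_B'] has a
    nilpotent normal subgroup of finite index; and [X] is the intersection of the two. *)

Require Import Defs.
From Corelib Require Import ssreflect.
From Stdlib Require Import List Arith Lia Classical ClassicalEpsilon
  FunctionalExtensionality PropExtensionality ProofIrrelevance.
Import ListNotations.

(* The hypothesis says nothing about a subgroup [X] of finite rank, so [X] has to be recovered from
   larger subgroups [X A] to which it applies; the work lies in finding enough such [A]. When [R]
   has finite rank, all the infinite rank sits in the abelian group [G / R]. Being torsion, this has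
   for each [n] an elementary abelian [q]-section of order above [q ^ n], but [q] may vary with [n],
   and the section may act on [R]. If [R] has rank [r] and class [c], then for [p <> q] at most
   [r * c] dimensions are lost in making the section act trivially on the [p]-parts of all lower
   central factors. As the loss does not grow with [p], one section can be made to act trivially for
   infinitely many [p] at once. The limit of the method is that finite index controls only large
   primes: a subgroup of index below [p] contains all [p]-elements, but nothing is said about small
   [p]. Hence finitely many exceptional primes remain. There one uses that an abelian torsion group
   of finite rank with finitely many primes has a divisible subgroup of finite index, on which an
   action trivial on a small finite layer is trivial. *)
Declare Scope grp_scope.
Open Scope grp_scope.
Notation "x ** y" := (gmul x y) (at level 40, left associativity) : grp_scope.
Notation "x ^-1" := (ginv x) (at level 3, left associativity, format "x ^-1") : grp_scope.
Notation "x ^+ n" := (gpow _ x n) (at level 29, left associativity) : grp_scope.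
Notation "[~ x , y ]" := (commutator _ x y) (at level 0, format "[~ x ,  y ]") : grp_scope.

(** * Group calculus *)

Section Basics.
Variable G : Group.
Implicit Types x y z : G.

Lemma mulA x y z : x ** y ** z = x ** (y ** z).
Proof. by rewrite gmul_assoc. Qed.
Lemma mulKV x y : x^-1 ** (x ** y) = y.
Proof. by rewrite gmul_assoc gmul_Vl gmul_1l. Qed.
Lemma mul_cancel x y z : x ** y = x ** z -> y = z.
Proof. by move=> H; rewrite -(mulKV x y) H mulKV. Qed.
Lemma mul1r x : x ** gone = x.
Proof. by apply: (mul_cancel (x^-1)); rewrite mulKV gmul_Vl. Qed.
Lemma mulVr x : x ** x^-1 = gone.
Proof. by apply: (mul_cancel (x^-1)); rewrite mulKV mul1r. Qed.
Lemma mulVK x y : x ** (x^-1 ** y) = y.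
Proof. by rewrite gmul_assoc mulVr gmul_1l. Qed.
Lemma inv_eq x y : x ** y = gone -> y = x^-1.
Proof. by move=> H; apply: (mul_cancel x); rewrite H mulVr. Qed.
Lemma invK x : x^-1^-1 = x.
Proof. by symmetry; apply: inv_eq; rewrite gmul_Vl. Qed.
Lemma invM x y : (x ** y)^-1 = y^-1 ** x^-1.
Proof. by symmetry; apply: inv_eq; rewrite mulA mulVK mulVr. Qed.
Lemma inv1 : (gone : G)^-1 = gone.
Proof. by symmetry; apply: inv_eq; rewrite gmul_1l. Qed.
End Basics.

Hint Rewrite mulA mulKV mul1r mulVr mulVK invK invM inv1 gmul_1l gmul_Vl : grp.
(* The rules in [grp] normalise words to reduced right-associated form, so [grp] decides identities of the free group. *)
Ltac gsimp := unfold commutator; autorewrite with grp.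
Ltac grp := gsimp; reflexivity.

Section Powers.
Variable G : Group.
Implicit Types x y z : G.
Definition commute x y := x ** y = y ** x.

Lemma mul_cancel_r x y z : y ** x = z ** x -> y = z.
Proof.
move=> H. have E : y ** x ** x^-1 = z ** x ** x^-1 by rewrite H.
move: E. by autorewrite with grp.
Qed.
Lemma eq_of_div x y : x^-1 ** y = gone -> x = y.
Proof. move=> H. by rewrite -(mul1r _ x) -H mulVK. Qed.
Lemma commute_comm x y : commute x y <-> [~ x, y] = gone.
Proof.
split; rewrite /commute => H.
  by rewrite /commutator H; grp.
have E : y ** x ** [~ x, y] = y ** x by rewrite H mul1r.
move: E; gsimp => E. exact: E.
Qed.
Lemma conj_comm x y : y^-1 ** (x ** y) = x ** [~ x, y].
Proof. grp. Qed.
Lemma commute_sym x y : commute x y -> commute y x.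
Proof. by []. Qed.
Lemma commute_mul x y z : commute x y -> commute x z -> commute x (y ** z).
Proof. rewrite /commute => H1 H2. by rewrite -mulA H1 !mulA H2. Qed.
Lemma commute_inv x y : commute x y -> commute x y^-1.
Proof.
rewrite /commute => H. apply: (mul_cancel _ y); rewrite -mulA -H. by autorewrite with grp.
Qed.
Lemma commute_1 x : commute x gone.
Proof. by rewrite /commute; grp. Qed.
Lemma commute_pow x y n : commute x y -> commute x (y ^+ n).
Proof. move=> H; elim: n => [|n IH] /=; [exact: commute_1 | exact: commute_mul]. Qed.
Lemma gpowS x n : x ^+ S n = x ** x ^+ n. Proof. by []. Qed.
Lemma gpow1 x : x ^+ 1 = x. Proof. by rewrite /= mul1r. Qed.
Lemma gpow_add x m n : x ^+ (m + n) = x ^+ m ** x ^+ n.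
Proof. elim: m => [|m IH] /=; first by rewrite gmul_1l. by rewrite IH mulA. Qed.
Lemma gpowSr x n : x ^+ S n = x ^+ n ** x.
Proof. by rewrite -Nat.add_1_r gpow_add gpow1. Qed.
Lemma gpow_one n : (gone : G) ^+ n = gone.
Proof. elim: n => [|n IH] //=. by rewrite IH gmul_1l. Qed.
Lemma gpow_mulA x m n : x ^+ (m * n) = (x ^+ m) ^+ n.
Proof.
elim: n => [|n IH]; first by rewrite Nat.mul_0_r.
by rewrite Nat.mul_succ_r Nat.add_comm gpow_add IH.
Qed.
Lemma gpow_mulAC x m n : (x ^+ m) ^+ n = (x ^+ n) ^+ m.
Proof. by rewrite -!gpow_mulA Nat.mul_comm. Qed.
Lemma gpow_mulM x y n : commute x y -> (x ** y) ^+ n = x ^+ n ** y ^+ n.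
Proof.
move=> H; elim: n => [|n IH] /=; first by rewrite gmul_1l.
have E := commute_pow y x n (commute_sym _ _ H).
by rewrite IH !mulA -(mulA _ y) E !mulA.
Qed.
Lemma gpow_inv x n : (x^-1) ^+ n = (x ^+ n)^-1.
Proof. elim: n => [|n IH]; first by rewrite /= inv1. by rewrite gpowSr IH gpowS invM. Qed.
Lemma gpow_conj x g n : (g^-1 ** (x ** g)) ^+ n = g^-1 ** (x ^+ n ** g).
Proof. elim: n => [|n IH]; first by rewrite /=; grp. rewrite !gpowS IH. grp. Qed.
Lemma gpow_multiple x n k : x ^+ n = gone -> x ^+ (n * k) = gone.
Proof. by move=> H; rewrite gpow_mulA H gpow_one. Qed.
Lemma gpow_divide x n m : Nat.divide n m -> x ^+ n = gone -> x ^+ m = gone.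
Proof. by move=> [k ->] H; rewrite Nat.mul_comm gpow_multiple. Qed.

Lemma comm_powr x y n : commute [~ x, y] y -> [~ x, y ^+ n] = [~ x, y] ^+ n.
Proof.
move=> H; elim: n => [|n IH]; first by rewrite /=; grp.
have E : [~ x, y ** y ^+ n] = [~ x, y ^+ n] ** ((y ^+ n)^-1 ** ([~ x, y] ** y ^+ n)) by grp.
rewrite gpowS E IH (commute_pow _ _ n H) mulKV. by rewrite -gpowSr.
Qed.
Lemma comm_inv x y : [~ x, y]^-1 = [~ y, x].
Proof. grp. Qed.
Lemma comm_powl x y n : commute [~ x, y] x -> [~ x ^+ n, y] = [~ x, y] ^+ n.
Proof.
move=> H. rewrite -(invK _ [~ x ^+ n, y]) comm_inv comm_powr.
  rewrite -(comm_inv x y); apply: commute_sym; apply: commute_inv; exact: commute_sym H.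
by rewrite -(comm_inv x y) gpow_inv invK.
Qed.
Lemma comm_1 x : [~ x, gone] = gone. Proof. grp. Qed.
Lemma comm1 x : [~ gone, x] = gone. Proof. grp. Qed.

Lemma coprime_root x n m : Nat.gcd n m = 1 -> n <> 0 -> x ^+ m = gone ->
  exists k, x = (x ^+ n) ^+ k.
Proof.
move=> g n0 H. have [a [b E]] := Nat.gcd_bezout_pos n m ltac:(lia).
exists a. rewrite -gpow_mulA Nat.mul_comm E g (Nat.mul_comm b) gpow_add gpow_multiple // mul1r. 
by rewrite gpow1.
Qed.
Lemma coprime_trivial x n m : Nat.gcd n m = 1 -> x ^+ n = gone -> x ^+ m = gone -> x = gone.
Proof.
move=> g Hn Hm. case: (Nat.eq_dec n 0) => [n0|n0].
  move: g; rewrite n0 Nat.gcd_0_l => m1. by rewrite -(gpow1 x) -m1.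
have [k ->] := coprime_root x n m g n0 Hm. by rewrite Hn gpow_one.
Qed.
End Powers.
Arguments commute {G}.

(** * Subgroups and indices *)

Section Subgroups.
Variable G : Group.
Implicit Types (x y z g : G) (A B C H K L S U N M : gset G).

Lemma gset_eq A B : (forall x, A x <-> B x) -> A = B.
Proof.
move=> H; apply: functional_extensionality => x; apply: propositional_extensionality; exact: H.
Qed.

Definition trivial_set : gset G := fun x => x = gone.

Lemma sub_1 H : subgroup G H -> H gone. Proof. by case. Qed.
Lemma sub_mul H x y : subgroup G H -> H x -> H y -> H (x ** y).
Proof. by case=> _ [h _]; apply: h. Qed.
Lemma sub_inv H x : subgroup G H -> H x -> H x^-1.
Proof. by case=> _ [_ h]; apply: h. Qed.
Lemma sub_pow H x n : subgroup G H -> H x -> H (x ^+ n).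
Proof. move=> sH Hx; elim: n => [|n IH] /=; [exact: sub_1 | exact: sub_mul]. Qed.
Lemma sub_div H x y : subgroup G H -> H x -> H y -> H (x^-1 ** y).
Proof. move=> sH Hx Hy; apply: sub_mul => //; exact: sub_inv. Qed.
Lemma sub_invE H x : subgroup G H -> H x^-1 -> H x.
Proof. by move=> sH Hx; rewrite -(invK _ x); apply: sub_inv. Qed.
Lemma sub_mulr H x y : subgroup G H -> H x -> H (x ** y) -> H y.
Proof. by move=> sH Hx Hy; rewrite -(mulKV _ x y); apply: sub_div. Qed.
Lemma sub_mull H x y : subgroup G H -> H y -> H (x ** y) -> H x.
Proof.
move=> sH Hx Hy. have -> : x = (x ** y) ** y^-1 by grp.
apply: sub_mul => //; exact: sub_inv.
Qed.
Lemma sub_comm H x y : subgroup G H -> H x -> H y -> H [~ x, y].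
Proof. move=> sH Hx Hy; rewrite /commutator. apply: sub_div => //. apply: sub_div => //. exact: sub_mul. Qed.
Lemma sub_full : subgroup G fullset. Proof. by []. Qed.
Lemma sub_triv : subgroup G trivial_set.
Proof.
split; first by []. split=> [x y -> ->|x ->]; rewrite /trivial_set; grp.
Qed.
Lemma sub_inter H K : subgroup G H -> subgroup G K -> subgroup G (inter G H K).
Proof.
move=> sH sK; split; first by split; apply: sub_1.
split=> [x y [h1 k1] [h2 k2]|x [h k]]; split; by [apply: sub_mul | apply: sub_inv].
Qed.

Lemma sub_forall (I : Type) (P : I -> Prop) (F : I -> gset G) : (forall i, subgroup G (F i)) ->
  subgroup G (fun x => forall i, P i -> F i x).
Proof.
move=> sF; split; first by move=> i _; apply: sub_1.
split=> [x y hx hy i Pi|x hx i Pi]; [apply: sub_mul; [exact: sF|exact: hx|exact: hy] | apply: sub_inv; [exact: sF|exact: hx]].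
Qed.
Lemma commute_sub x : subgroup G (fun y => commute x y).
Proof. split; [exact: commute_1 | split; [move=> y z; exact: commute_mul | move=> y; exact: commute_inv]]. Qed.

Lemma gen_sub A : subgroup G (generated G A).
Proof.
split; first by move=> K sK _; apply: sub_1.
split=> [x y hx hy|x hx] K sK AK; [apply: sub_mul => //; [exact: hx|exact: hy] | apply: sub_inv => //; exact: hx].
Qed.
Lemma gen_incl A x : A x -> generated G A x.
Proof. by move=> Ax K _; apply. Qed.
Lemma gen_min A K : subgroup G K -> subset G A K -> subset G (generated G A) K.
Proof. by move=> sK AK x; apply. Qed.
Lemma gen_mono A B : subset G A B -> subset G (generated G A) (generated G B).
Proof. move=> AB; apply: gen_min; [exact: gen_sub | move=> x /AB; exact: gen_incl]. Qed.

Definition gl (l : list G) : gset G := generated G (fun y => In y l).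
Lemma gl_sub l : subgroup G (gl l). Proof. exact: gen_sub. Qed.
Lemma gl_in l x : In x l -> gl l x. Proof. exact: gen_incl. Qed.
Lemma gl_min l K : subgroup G K -> (forall x, In x l -> K x) -> subset G (gl l) K.
Proof. exact: gen_min. Qed.
Lemma gl_incl l l' : incl l l' -> subset G (gl l) (gl l').
Proof. move=> ll'; apply: gl_min; [exact: gl_sub | move=> x /ll'; exact: gl_in]. Qed.
Lemma gl_appl l l' : subset G (gl l) (gl (l ++ l')).
Proof. by apply: gl_incl => x xl; apply/in_app_iff; left. Qed.
Lemma gl_appr l l' : subset G (gl l') (gl (l ++ l')).
Proof. by apply: gl_incl => x xl; apply/in_app_iff; right. Qed.
Lemma gl_fg l : fin_gen G (gl l).
Proof. by exists l. Qed.
Lemma generated_by_eq K l : generated_by G K l -> K = gl l.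
Proof. by move=> h; apply: gset_eq => x; apply: h. Qed.

Lemma rank_le_mono H K r : subset G K H -> rank_le G H r -> rank_le G K r.
Proof. by move=> KH h L sL LK; apply: h => // x /LK /KH. Qed.
Lemma finite_rank_mono H K : subset G K H -> finite_rank G H -> finite_rank G K.
Proof. move=> KH [r h]; exists r; exact: rank_le_mono h. Qed.
Lemma rank_le_leq H r s : r <= s -> rank_le G H r -> rank_le G H s.
Proof. move=> rs h L sL LH fL. have [l [ll gll]] := h L sL LH fL. exists l; split=> //; lia. Qed.

Definition finset (A : gset G) := exists l : list G, forall x, A x -> In x l.

Lemma list_filter (T : Type) (P : T -> Prop) (l : list T) :
  exists l' : list T, length l' <= length l /\ forall x : T, In x l' <-> In x l /\ P x.
Proof.
elim: l => [|a l [l' [ll' H]]].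
  exists []; split=> //= x; tauto.
case: (classic (P a)) => Pa.
  exists (a :: l'); split; first by move=> /=; lia.
  move=> x /=; rewrite H; split; last tauto. case=> [<-|[]]; tauto.
exists l'; split; first by move=> /=; lia.
move=> x /=; rewrite H; split; first tauto. case=> [[ax|//] Px]. by rewrite -ax in Px.
Qed.

Lemma finset_list A : finset A -> exists l, forall x, A x <-> In x l.
Proof.
case=> l h. have [l' [_ h']] := list_filter _ A l.
exists l' => x; rewrite h'; split; [move=> Ax; split=> //; exact: h | tauto].
Qed.
Lemma finset_mono A B : subset G A B -> finset B -> finset A.
Proof. by move=> AB [l h]; exists l => x /AB /h. Qed.
Lemma finset_fg A : subgroup G A -> finset A -> fin_gen G A.
Proof.
move=> sA /finset_list [l h]; exists l => x; split=> [Ax|].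
  by apply: gl_in; apply/h.
by apply: gl_min => // y /h.
Qed.

(** Indices are only ever bounded from above; no exact index is defined. Lower bounds are certified
    by the lists [sep] below. *)
Definition idx_le (K H : gset G) (n : nat) : Prop :=
  exists l : list G, length l <= n /\ (forall x, In x l -> H x) /\
    forall h, H h -> exists x, In x l /\ K (x^-1 ** h).

Lemma idx_finite K H : finite_index_in G K H <-> exists n, idx_le K H n.
Proof.
split; first by case=> l [h1 h2]; exists (length l); exists l.
by case=> n [l [_ [h1 h2]]]; exists l.
Qed.
Lemma idx_le_leq K H m n : m <= n -> idx_le K H m -> idx_le K H n.
Proof. move=> mn [l [h1 h2]]; exists l; split=> //; lia. Qed.
Lemma idx_le_mono K K' H n : subset G K K' -> idx_le K H n -> idx_le K' H n.
Proof.
move=> KK' [l [h1 [h2 h3]]]; exists l; split=> //; split=> // h /h3 [x [xl kx]].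
by exists x; split=> //; apply: KK'.
Qed.

(** A coset of [K] that meets [P] is the coset of any of its points in [P], so representatives can
    be moved into [P] without lengthening the list. *)
Lemma repick K (P : gset G) (l : list G) : subgroup G K ->
  exists l', length l' <= length l /\ (forall x, In x l' -> P x) /\
    forall h x, In x l -> P h -> K (x^-1 ** h) -> exists y, In y l' /\ K (y^-1 ** h).
Proof.
move=> sK; elim: l => [|a l [l' [ll' [Pl' H]]]]; first by exists [].
case: (classic (exists y, P y /\ K (a^-1 ** y))) => [[y [Py Ky]]|no].
  exists (y :: l'); split; first by move=> /=; lia.
  split; first by move=> x /= [<-|/Pl'].
  move=> h x /= [<-|xl] Ph Kh; last first.
    have [z [zl Kz]] := H h x xl Ph Kh. by exists z; split=> //; right.
  exists y; split; first by left.
  have -> : y^-1 ** h = (a^-1 ** y)^-1 ** (a^-1 ** h) by grp.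
  exact: sub_div.
exists l'; split; first by move=> /=; lia.
split=> // h x /= [<-|xl] Ph Kh; last exact: (H h x).
by exfalso; apply: no; exists h.
Qed.

Lemma idx_of_cover K H (l : list G) : subgroup G K ->
  (forall h, H h -> exists x, In x l /\ K (x^-1 ** h)) -> idx_le K H (length l).
Proof.
move=> sK cov. have [l' [h1 [h2 h3]]] := repick K H l sK.
exists l'; split=> //; split=> // h Hh. have [x [xl Kx]] := cov h Hh. exact: (h3 h x).
Qed.

Lemma idx_le_restrict K H L n : subgroup G K -> subset G L H -> idx_le K H n -> idx_le K L n.
Proof.
move=> sK LH [l [h1 [h2 h3]]]. apply: (idx_le_leq _ _ (length l)) => //.
by apply: idx_of_cover => // h /LH /h3.
Qed.

Lemma idx_le_interr K H L n : subgroup G K -> subgroup G L -> subset G L H -> idx_le K H n ->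
  idx_le (inter G K L) L n.
Proof.
move=> sK sL LH /(idx_le_restrict _ _ _ _ sK LH) [l [h1 [h2 h3]]].
exists l; split=> //; split=> // h Lh. have [x [xl kx]] := h3 h Lh. exists x; split=> //; split=> //.
apply: sub_div => //; exact: h2.
Qed.

Lemma idx_trans K L H a b : subgroup G K -> idx_le K L a -> idx_le L H b -> idx_le K H (a * b).
Proof.
move=> sK [la [a1 [a2 a3]]] [lb [b1 [b2 b3]]].
apply: (idx_le_leq _ _ (length (map (fun p => fst p ** snd p) (list_prod lb la)))).
  rewrite length_map length_prod. nia.
apply: idx_of_cover => // h Hh.
have [x [xl Lx]] := b3 h Hh. have [y [yl Ky]] := a3 _ Lx.
exists (x ** y); split; last by rewrite invM mulA.
apply/in_map_iff; exists (x, y); split=> //. by apply: in_prod.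
Qed.

Lemma idx_inter K1 K2 H a b : subgroup G K1 -> subgroup G K2 -> subset G K2 H ->
  idx_le K1 H a -> idx_le K2 H b -> idx_le (inter G K1 K2) H (a * b).
Proof.
move=> s1 s2 KH i1 i2. apply: (idx_trans _ K2) => //; first exact: sub_inter.
exact: (idx_le_interr _ H).
Qed.

Lemma idx_refl H : subgroup G H -> idx_le H H 1.
Proof.
move=> sH; exists [gone]; split=> //; split; first by move=> x [<-|[]]; apply: sub_1.
move=> h Hh; exists gone; split; first by left. by rewrite inv1 gmul_1l.
Qed.

(** Each fibre of [f] on [H] lies in one coset of [K]. Typical [f] are power, commutator and
    conjugation maps with finitely many values. *)
Lemma idx_of_fun (T : Type) K H (f : G -> T) (l : list T) : subgroup G K ->
  (forall x, H x -> In (f x) l) ->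
  (forall x y, H x -> H y -> f x = f y -> K (x^-1 ** y)) ->
  idx_le K H (length l).
Proof.
move=> sK; elim: l H => [|t l IH] H Hin inj.
  exists []; split=> //; split=> // h /Hin [].
have [l1 [a1 [a2 a3]]] := IH (fun x => H x /\ f x <> t)
   ltac:(move=> x [/Hin /= [e ne|//]]; by exfalso; apply: ne)
   ltac:(move=> x y [Hx _] [Hy _]; by apply: inj).
case: (classic (exists x, H x /\ f x = t)) => [[x [Hx fx]]|no].
  exists (x :: l1); split; first by move=> /=; lia.
  split; first by move=> y /= [<-|/a2 []].
  move=> h Hh; case: (classic (f h = t)) => [fh|nfh].
    exists x; split; [by left | apply: inj => //; by rewrite fx fh].
  have [y [yl Ky]] := a3 h (conj Hh nfh). by exists y; split=> //; right.
exists l1; split; first by move=> /=; lia.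
split; first by move=> y /a2 [].
move=> h Hh; apply: a3; split=> // fh; apply: no; by exists h.
Qed.

Lemma idx_finset K H : subgroup G K -> finset K -> finite_index_in G K H -> finset H.
Proof.
move=> sK [lk hk] [l [h1 h2]].
exists (map (fun p => fst p ** snd p) (list_prod l lk)) => h Hh.
have [x [xl Kx]] := h2 h Hh. apply/in_map_iff; exists (x, x^-1 ** h).
rewrite /= mulVK; split=> //. apply: in_prod => //; exact: hk.
Qed.

Lemma finset_fi_triv A : finite_index_in G trivial_set A -> finset A.
Proof. by apply: idx_finset; [exact: sub_triv | exists [gone] => x ->; left]. Qed.

(** Lists of elements in pairwise distinct left cosets of [K], grown at the head: the certificates
    for lower bounds on an index. *)
Inductive sep (K : gset G) : list G -> Prop :=
| sep_nil : sep K []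
| sep_cons x l : (forall y, In y l -> ~ K (y^-1 ** x)) -> sep K l -> sep K (x :: l).

Lemma sep_length K H l n : subgroup G K -> sep K l -> (forall x, In x l -> H x) ->
  idx_le K H n -> length l <= n.
Proof.
move=> sK sl lH [c [c1 [c2 c3]]].
have [r hr] : exists r : G -> G, forall x, H x -> In (r x) c /\ K ((r x)^-1 ** x).
  exists (fun x => epsilon (inhabits gone) (fun y => In y c /\ K (y^-1 ** x))) => x Hx.
  exact: (epsilon_spec (inhabits gone) (fun y => In y c /\ K (y^-1 ** x)) (c3 x Hx)).
have nd : NoDup (map r l).
  elim: sl lH => [|x l' nx _ IH] lH /=; first by constructor.
  constructor; last by apply: IH => y yl; apply: lH; right.
  move=> /in_map_iff [y [ry yl]]. apply: (nx y yl).
  have [_ k1] := hr x (lH x (or_introl eq_refl)).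
  have [_ k2] := hr y (lH y (or_intror yl)).
  have -> : y^-1 ** x = ((r y)^-1 ** y)^-1 ** ((r x)^-1 ** x) by rewrite ry; grp.
  exact: sub_div.
have inc : incl (map r l) c.
  by move=> z /in_map_iff [y [<- yl]]; apply: (proj1 (hr y (lH y yl))).
have := NoDup_incl_length nd inc. rewrite length_map; lia.
Qed.

(** A separated list that cannot be extended inside [H] is a full set of coset representatives. *)
Lemma sep_exists K H n : subgroup G K -> ~ idx_le K H n ->
  exists l, length l = S n /\ (forall x, In x l -> H x) /\ sep K l.
Proof.
move=> sK nidx.
suff: forall m, m <= S n -> exists l, length l = m /\ (forall x, In x l -> H x) /\ sep K l by apply.
elim=> [|m IH] mn; first by exists []; split=> //; split=> //; constructor.
have [l [ll [lH sl]]] := IH ltac:(lia).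
case: (classic (exists x, H x /\ forall y, In y l -> ~ K (y^-1 ** x))) => [[x [Hx nx]]|no].
  exists (x :: l); split; first by rewrite /= ll. split; first by move=> y /= [<-|/lH].
  by constructor.
exfalso; apply: nidx; exists l; split; first lia. split=> // h Hh.
apply: NNPP => nk; apply: no; exists h; split=> // y yl Ky; apply: nk; by exists y.
Qed.

End Subgroups.

(* Naming the subgroup explicitly keeps unification from unfolding it. *)
Ltac smul := match goal with |- ?H (gmul _ _) => apply: (sub_mul _ H) end.
Ltac sdiv := match goal with |- ?H (gmul _ _) => apply: (sub_div _ H) end.
Ltac sinv := match goal with |- ?H (ginv _) => apply: (sub_inv _ H) end.
Ltac sone := match goal with |- ?H gone => apply: (sub_1 _ H) end.
Ltac spow := match goal with |- ?H (gpow _ _ _) => apply: (sub_pow _ H) end.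
Ltac scomm := match goal with |- ?H (commutator _ _ _) => apply: (sub_comm _ H) end.

(** * Index bounds from rank; commensurability; normal subgroups and centralisers *)

Section Index.
Variable G : Group.
Implicit Types (x y z g : G) (A B C H K L S U N M X : gset G).

(** The product [<x> U] with natural exponents only; it is a group once [x] normalises [U] and has a
    positive power in [U]. *)
Definition adjoin U x : gset G := fun s => exists i, U ((x ^+ i)^-1 ** s).

Lemma conj_pow_in U x u i : (forall v, U v -> U (x^-1 ** (v ** x))) ->
  U u -> U ((x ^+ i)^-1 ** (u ** x ^+ i)).
Proof.
move=> nU Uu; elim: i => [|i IH]; first by rewrite /=; gsimp.
rewrite gpowSr. have -> : (x ^+ i ** x)^-1 ** (u ** (x ^+ i ** x)) = x^-1 ** (((x ^+ i)^-1 ** (u ** x ^+ i)) ** x) by grp.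
exact: nU.
Qed.

Lemma adjoin_subgroup U x m : subgroup G U -> (forall v, U v -> U (x^-1 ** (v ** x))) ->
  0 < m -> U (x ^+ m) -> subgroup G (adjoin U x).
Proof.
move=> sU nU m0 Um.
split; first by exists 0; rewrite /=; gsimp; apply: sub_1.
split=> [s t [i Ui] [j Uj]|s [i Ui]].
  exists (i + j). rewrite gpow_add.
  have -> : (x ^+ i ** x ^+ j)^-1 ** (s ** t) =
    ((x ^+ j)^-1 ** (((x ^+ i)^-1 ** s) ** x ^+ j)) ** ((x ^+ j)^-1 ** t) by grp.
  apply: sub_mul => //. exact: conj_pow_in.
(* Modulo [U] this is the exponent [- i], because [x ^+ (m * i)] lies in [U]. *)
exists (i * (m - 1)).
set k := i * (m - 1).
have E : x ^+ k ** x ^+ i = x ^+ (m * i).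
  by rewrite -gpow_add; congr (x ^+ _); rewrite /k; nia.
have Ux : U (x ^+ (m * i)) by rewrite gpow_mulA; apply: sub_pow.
have -> : (x ^+ k)^-1 ** s^-1 = (x ^+ k)^-1 ** (((x ^+ i)^-1 ** s)^-1 ** x ^+ k) ** (x ^+ k ** x ^+ i)^-1.
  have E2 : x ^+ k ** x ^+ i = x ^+ i ** x ^+ k by rewrite -!gpow_add Nat.add_comm.
  rewrite E2. grp.
rewrite E. apply: sub_mul => //; last exact: sub_inv.
apply: conj_pow_in => //. exact: sub_inv.
Qed.

Lemma adjoin_incl U x u : U u -> adjoin U x u.
Proof. by move=> Uu; exists 0; rewrite /=; gsimp. Qed.
Lemma adjoin_in U x : subgroup G U -> adjoin U x x.
Proof. by move=> sU; exists 1; rewrite /=; gsimp; apply: sub_1. Qed.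
Lemma adjoin_sub U x S : subgroup G S -> subset G U S -> S x -> subset G (adjoin U x) S.
Proof.
move=> sS US Sx s [i /US Si]. rewrite -(mulVK _ (x ^+ i) s). apply: sub_mul => //. exact: sub_pow.
Qed.

Lemma adjoin_idx U x m : subgroup G U -> 0 < m -> U (x ^+ m) -> idx_le G U (adjoin U x) m.
Proof.
move=> sU m0 Um. have <- : length (map (gpow G x) (seq 0 m)) = m by rewrite length_map length_seq.
apply: idx_of_cover => // s [i Ui].
exists (x ^+ (i mod m)); split.
  apply/in_map_iff; exists (i mod m); split=> //. apply/in_seq. have := Nat.mod_upper_bound i m; lia.
have -> : (x ^+ (i mod m))^-1 ** s = (x ^+ m) ^+ (i / m) ** ((x ^+ i)^-1 ** s).
  have {3}-> : i = i mod m + m * (i / m) by have := Nat.div_mod_eq i m; lia.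
  rewrite gpow_add gpow_mulA. grp.
apply: sub_mul => //. exact: sub_pow.
Qed.

Lemma normal_over_comm S C U : subgroup G S -> subset G C U -> subset G U S ->
  (forall x y, S x -> S y -> C [~ x, y]) -> subgroup G U ->
  forall x u, S x -> U u -> U (x^-1 ** (u ** x)).
Proof.
move=> sS CU US SC sU x u Sx Uu. rewrite conj_comm. apply: sub_mul => //. apply: CU; apply: SC => //. exact: US.
Qed.

(** Every group between [C] and [S] is normalised by [S], since [C] contains the commutators; so the
    elements are adjoined one by one, each costing a factor [m]. *)
Lemma adjoin_list S C m (l : list G) : subgroup G S -> subgroup G C -> subset G C S ->
  (forall x y, S x -> S y -> C [~ x, y]) -> (forall x, In x l -> S x) ->
  0 < m -> (forall x, In x l -> C (x ^+ m)) ->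
  exists U, subgroup G U /\ subset G C U /\ subset G U S /\ (forall x, In x l -> U x) /\
    idx_le G C U (m ^ length l).
Proof.
move=> sS sC CS SC lS m0 lm; elim: l lS lm => [|x l IH] lS lm.
  exists C; split=> //; split=> //; split=> //; split=> //. exact: idx_refl.
have [U [sU [CU [US [lU idx]]]]] := IH (fun y yl => lS y (or_intror yl)) (fun y yl => lm y (or_intror yl)).
have Sx := lS x (or_introl eq_refl).
have Um : U (x ^+ m) by apply: CU; apply: lm; left.
exists (adjoin U x); split.
  apply: (adjoin_subgroup _ _ m) => // v Uv. exact: (normal_over_comm S C).
split; first by move=> c /CU; exact: adjoin_incl.
split; first exact: adjoin_sub.
split; first by move=> y /= [<-|/lU Uy]; [exact: adjoin_in | exact: adjoin_incl].
rewrite /= Nat.mul_comm. apply: (idx_trans _ _ U) => //. exact: adjoin_idx.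
Qed.

Lemma common_multiple (T : Type) (P : T -> nat -> Prop) (l : list T) :
  (forall t n m, P t n -> Nat.divide n m -> P t m) ->
  (forall t, In t l -> exists n, 0 < n /\ P t n) ->
  exists n, 0 < n /\ forall t, In t l -> P t n.
Proof.
move=> mono; elim: l => [|a l IH] Hl; first by exists 1; split.
have [n [n0 Pn]] := IH (fun t tl => Hl t (or_intror tl)).
have [k [k0 Pk]] := Hl a (or_introl eq_refl).
exists (n * k); split; first nia.
move=> t [<-|tl]; [apply: (mono _ k) => //; by exists n | apply: (mono _ n); [exact: Pn|exists k; lia]].
Qed.

(** [S / C] is abelian of exponent dividing [m]. More than [m ^ r] separated elements would generate
    a group with [r] generators, which meets at most [m ^ r] cosets of [C]. *)
Lemma idx_of_rank S C m r : subgroup G S -> subgroup G C -> subset G C S ->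
  (forall x y, S x -> S y -> C [~ x, y]) -> 0 < m -> (forall x, S x -> C (x ^+ m)) ->
  rank_le G S r -> idx_le G C S (m ^ r).
Proof.
move=> sS sC CS SC m0 Sm rk. apply: NNPP => ni.
have [l [ll [lS sl]]] := sep_exists _ _ _ _ sC ni.
have [l' [ll' gl']] := rk (gl G l) (gl_sub _ l) (gl_min _ _ _ sS lS) (gl_fg _ l).
have e := generated_by_eq _ _ _ gl'.
have l'S : forall x, In x l' -> S x.
  move=> x xl. have : gl G l x by rewrite e; apply: gl_in. exact: gl_min.
have [U [sU [CU [US [lU idx]]]]] := adjoin_list S C m l' sS sC CS SC l'S m0 (fun x xl => Sm x (l'S x xl)).
have lin : forall x, In x l -> U x.
  move=> x xl. have : gl G l' x by rewrite -e; apply: gl_in. by apply: gl_min.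
have := sep_length _ _ _ _ _ sC sl lin idx. rewrite ll.
have := Nat.pow_le_mono_r m (length l') r ltac:(lia) ll'. lia.
Qed.

Lemma fin_index_of_rank S C m : subgroup G S -> subgroup G C -> subset G C S ->
  (forall x y, S x -> S y -> C [~ x, y]) -> 0 < m -> (forall x, S x -> C (x ^+ m)) ->
  finite_rank G S -> finite_index_in G C S.
Proof.
move=> sS sC CS SC m0 Sm [r rk]. apply/idx_finite; exists (m ^ r). exact: idx_of_rank.
Qed.

Lemma fi_trans K L H : subgroup G K -> finite_index_in G K L -> finite_index_in G L H -> finite_index_in G K H.
Proof. move=> sK /idx_finite [a ia] /idx_finite [b ib]. apply/idx_finite; exists (a * b). exact: (idx_trans _ _ L). Qed.
Lemma fi_refl H : subgroup G H -> finite_index_in G H H.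
Proof. by move=> sH; apply/idx_finite; exists 1; apply: idx_refl. Qed.
Lemma fi_interr K H L : subgroup G K -> subgroup G L -> subset G L H -> finite_index_in G K H ->
  finite_index_in G (inter G K L) L.
Proof. by move=> sK sL LH /idx_finite [a ia]; apply/idx_finite; exists a; apply: (idx_le_interr _ _ H). Qed.
Lemma fi_inter K1 K2 H : subgroup G K1 -> subgroup G K2 -> subset G K2 H ->
  finite_index_in G K1 H -> finite_index_in G K2 H -> finite_index_in G (inter G K1 K2) H.
Proof.
move=> s1 s2 KH /idx_finite [a ia] /idx_finite [b ib]. apply/idx_finite; exists (a * b). exact: idx_inter.
Qed.
Lemma fi_mono K K' H : subset G K K' -> finite_index_in G K H -> finite_index_in G K' H.
Proof. move=> KK' /idx_finite [a ia]; apply/idx_finite; exists a; exact: idx_le_mono ia. Qed.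

Definition cn H := exists N, normal G N /\ commensurable G H N.

Lemma interC A B : inter G A B = inter G B A.
Proof. by apply: gset_eq => x; rewrite /inter; tauto. Qed.
Lemma inter_sub_l A B : subset G (inter G A B) A. Proof. by move=> x []. Qed.
Lemma inter_sub_r A B : subset G (inter G A B) B. Proof. by move=> x []. Qed.
Lemma inter_eq A B : subset G A B -> inter G A B = A.
Proof. by move=> AB; apply: gset_eq => x; split; [by case | by move=> Ax; split=> //; apply: AB]. Qed.

Lemma commens_sym A B : commensurable G A B -> commensurable G B A.
Proof. by case=> h1 h2; split; rewrite interC. Qed.
Lemma commens_refl A : subgroup G A -> commensurable G A A.
Proof. by move=> sA; rewrite /commensurable inter_eq //; split; apply: fi_refl. Qed.
Lemma commens_fi A B : subgroup G A -> subset G A B -> finite_index_in G A B -> commensurable G A B.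
Proof. by move=> sA AB f; rewrite /commensurable inter_eq //; split=> //; apply: fi_refl. Qed.

Lemma fi_inter_trans A B C : subgroup G A -> subgroup G B -> subgroup G C ->
  finite_index_in G (inter G A B) A -> finite_index_in G (inter G B C) B -> finite_index_in G (inter G A C) A.
Proof.
move=> sA sB sC h1 h2. apply: (fi_mono (inter G (inter G B C) (inter G A B))).
  by move=> x [[_ c] [a _]].
apply: (fi_trans _ (inter G A B)) => //; first by apply: sub_inter; apply: sub_inter.
by apply: (fi_interr _ B) => //; [apply: sub_inter | apply: sub_inter | apply: inter_sub_r].
Qed.
Lemma commens_trans A B C : subgroup G A -> subgroup G B -> subgroup G C ->
  commensurable G A B -> commensurable G B C -> commensurable G A C.
Proof.
move=> sA sB sC [h1 h2] [h3 h4]; split; first exact: (fi_inter_trans A B C).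
rewrite interC. by apply: (fi_inter_trans C B A) => //; rewrite interC.
Qed.

Lemma commens_inter A A' B B' : subgroup G A -> subgroup G A' -> subgroup G B -> subgroup G B' ->
  commensurable G A A' -> commensurable G B B' -> commensurable G (inter G A B) (inter G A' B').
Proof.
have half : forall A A' B B', subgroup G A -> subgroup G A' -> subgroup G B -> subgroup G B' ->
  finite_index_in G (inter G A A') A -> finite_index_in G (inter G B B') B ->
  finite_index_in G (inter G (inter G A B) (inter G A' B')) (inter G A B).
  move=> {}A {}A' {}B {}B' sA sA' sB sB' h1 h2.
  have sAB : subgroup G (inter G A B) by apply: sub_inter.
  have s1 : subgroup G (inter G A A') by apply: sub_inter.
  have s2 : subgroup G (inter G B B') by apply: sub_inter.
  have i1 := fi_interr _ _ _ s1 sAB (inter_sub_l _ _) h1.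
  have i2 := fi_interr _ _ _ s2 sAB (inter_sub_r _ _) h2.
  apply: fi_mono (fi_inter _ _ _ _ _ _ i1 i2); try exact: sub_inter; last exact: inter_sub_r.
  by move=> x [[[a a'] _] [[b b'] _]].
move=> sA sA' sB sB' [h1 h2] [h3 h4]; split; first exact: half.
rewrite interC. by apply: half => //; rewrite interC.
Qed.

Lemma normal_sub N : normal G N -> subgroup G N. Proof. by case. Qed.
Lemma normal_conj N x g : normal G N -> N x -> N (g^-1 ** (x ** g)).
Proof. by case=> _ [_ [_ h]] Nx; apply: h. Qed.
Lemma normal_comml N x g : normal G N -> N x -> N [~ x, g].
Proof.
move=> nN Nx. have -> : [~ x, g] = x^-1 ** (g^-1 ** (x ** g)) by grp.
apply: sub_div => //; [exact: normal_sub|exact: normal_conj].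
Qed.
Lemma normal_commr N x g : normal G N -> N x -> N [~ g, x].
Proof.
move=> nN Nx. rewrite -comm_inv. apply: sub_inv; [exact: normal_sub|exact: normal_comml].
Qed.
Lemma normal_of N : subgroup G N -> (forall x g, N x -> N (g^-1 ** (x ** g))) -> normal G N.
Proof. move=> sN h; split=> //; split; first exact: sub_full. split=> // k x _. exact: h. Qed.
Lemma normal_of_comm N : subgroup G N -> (forall x g, N x -> N [~ x, g]) -> normal G N.
Proof. move=> sN h; apply: normal_of => // x g Nx. rewrite conj_comm. apply: sub_mul => //. exact: h. Qed.
Lemma normal_inter M N : normal G M -> normal G N -> normal G (inter G M N).
Proof.
move=> nM nN; apply: normal_of; first by apply: sub_inter; apply: normal_sub.
by move=> x g [? ?]; split; apply: normal_conj.
Qed.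
Lemma normal_full : normal G fullset. Proof. by apply: normal_of; first exact: sub_full. Qed.
Lemma normal_gen A : (forall x g, A x -> generated G A (g^-1 ** (x ** g))) -> normal G (generated G A).
Proof.
move=> h; apply: normal_of; first exact: gen_sub.
move=> x g; move: x. apply: (gen_min _ _ (fun x => generated G A (g^-1 ** (x ** g)))); last first.
  by move=> x Ax; apply: h.
have sA := gen_sub _ A.
split; first by gsimp; apply: (sub_1 _ _ sA).
split=> [x y hx hy|x hx].
  have -> : g^-1 ** (x ** y ** g) = (g^-1 ** (x ** g)) ** (g^-1 ** (y ** g)) by grp.
  exact: (sub_mul _ _ _ _ sA).
have -> : g^-1 ** (x^-1 ** g) = (g^-1 ** (x ** g))^-1 by grp.
exact: (sub_inv _ _ _ sA).
Qed.

Lemma cn_inter H K : subgroup G H -> subgroup G K -> cn H -> cn K -> cn (inter G H K).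
Proof.
move=> sH sK [N [nN hN]] [M [nM hM]]. exists (inter G N M); split; first exact: normal_inter.
by apply: commens_inter => //; apply: normal_sub.
Qed.
Lemma cn_commens H K : subgroup G H -> subgroup G K -> commensurable G H K -> cn K -> cn H.
Proof.
move=> sH sK hk [N [nN hN]]; exists N; split=> //. apply: (commens_trans _ K) => //. exact: normal_sub.
Qed.
Lemma cn_normal N : normal G N -> cn N.
Proof. move=> nN; exists N; split=> //. apply: commens_refl. exact: normal_sub. Qed.

(** Two of the powers of [h] with exponents [0, ..., length l] share a coset. *)
Lemma fi_pow K H (l : list G) h : subgroup G K -> subgroup G H -> H h ->
  (forall x, H x -> exists y, In y l /\ K (y^-1 ** x)) ->
  exists j, 0 < j <= length l /\ K (h ^+ j).
Proof.
move=> sK sH Hh cov.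
apply: NNPP => no.
suff s : sep G K (map (gpow G h) (rev (seq 0 (S (length l))))).
  have := sep_length _ K H _ (length l) sK s.
  rewrite length_map length_rev length_seq => k.
  suff : S (length l) <= length l by lia.
  apply: k; last by apply: idx_of_cover.
  by move=> x /in_map_iff [i [<- _]]; apply: sub_pow.
have : S (length l) <= S (length l) by lia.
elim: {1 3}(S (length l)) => [|n IH] le; first by constructor.
rewrite seq_S rev_app_distr /=. constructor; last by apply: IH; lia.
move=> y /in_map_iff [i [<- hi]] Ki.
have ii := proj1 (in_seq _ _ _) (proj2 (in_rev _ _) hi). apply: no; exists (n - i); split; first lia.
move: Ki. have {1}-> : n = i + (n - i) by lia. by rewrite gpow_add mulKV.
Qed.
Definition cent S : gset G := fun x => forall s, S s -> commute x s.
Lemma cent_sub S : subgroup G (cent S).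
Proof.
have -> : cent S = fun x => forall s, S s -> commute s x.
  by apply: gset_eq => x; split=> h s /h; exact: commute_sym.
apply: (sub_forall G G S) => s. exact: commute_sub.
Qed.
Lemma cent_normal N : normal G N -> normal G (cent N).
Proof.
move=> nN; apply: normal_of; first exact: cent_sub.
move=> x g cx s Ns. have := cx _ (normal_conj _ _ g^-1 nN Ns). rewrite /commute => e.
have -> : g^-1 ** (x ** g) ** s = g^-1 ** ((x ** (g^-1^-1 ** (s ** g^-1))) ** g) by grp.
rewrite e; grp.
Qed.
Lemma cent_anti S U : subset G S U -> subset G (cent U) (cent S).
Proof. by move=> SU x h s /SU /h. Qed.

End Index.

Definition hom (G Q : Group) (f : G -> Q) := forall x y, f (x ** y) = f x ** f y.
Definition surj (G Q : Group) (f : G -> Q) := forall y, exists x, f x = y.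

(** * Quotients and homomorphisms *)

Section Quotient.
Variables (G : Group) (K : gset G) (nK : normal G K).

Let sK : subgroup G K := normal_sub _ _ nK.
(** The predicate depends only on the coset of [g], so by extensionality equal cosets get the same
    representative. The quotient is then the type of fixed points of [rep], with Leibniz
    equality. *)
Definition rep (g : G) : G := epsilon (inhabits gone) (fun x => K (g^-1 ** x)).
Let rep_spec g : K (g^-1 ** rep g).
Proof.
apply: (epsilon_spec (inhabits gone) (fun x => K (g^-1 ** x))); exists g.
rewrite gmul_Vl; exact: sub_1.
Qed.
Let rep_eq g h : K (g^-1 ** h) -> rep g = rep h.
Proof.
move=> kgh. rewrite /rep; congr (epsilon _ _). apply: functional_extensionality => x.
apply: propositional_extensionality; split=> k.
  have -> : h^-1 ** x = (g^-1 ** h)^-1 ** (g^-1 ** x) by grp. exact: sub_div.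
have -> : g^-1 ** x = (g^-1 ** h) ** (h^-1 ** x) by grp. exact: sub_mul.
Qed.
Let repK g : rep (rep g) = rep g.
Proof. symmetry; apply: rep_eq. exact: rep_spec. Qed.

Definition qcarrier := {g : G | rep g = g}.
Definition qproj (g : G) : qcarrier := exist _ (rep g) (repK g).
Let qval (a : qcarrier) : G := proj1_sig a.
Let qval_inj (a b : qcarrier) : qval a = qval b -> a = b.
Proof. case: a => a ha; case: b => b hb /= E. subst b. congr exist. exact: proof_irrelevance. Qed.
Let qproj_eq g h : K (g^-1 ** h) -> qproj g = qproj h.
Proof. by move=> k; apply: qval_inj; apply: rep_eq. Qed.
Let qproj_val a : qproj (qval a) = a.
Proof. apply: qval_inj. exact: (proj2_sig a). Qed.

Let qmul (a b : qcarrier) := qproj (qval a ** qval b).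
Let qinv (a : qcarrier) := qproj (qval a)^-1.
Let qone := qproj gone.

Let qmul_proj g h : qmul (qproj g) (qproj h) = qproj (g ** h).
Proof.
symmetry; apply: qproj_eq. rewrite /qval /=.
have -> : (g ** h)^-1 ** (rep g ** rep h) = (h^-1 ** ((g^-1 ** rep g) ** h)) ** (h^-1 ** rep h) by grp.
apply: sub_mul; [exact: sK | apply: normal_conj; [exact: nK | exact: rep_spec] | exact: rep_spec].
Qed.
Let qinv_proj g : qinv (qproj g) = qproj g^-1.
Proof.
symmetry; apply: qproj_eq; rewrite /qval /=.
have -> : g^-1^-1 ** (rep g)^-1 = g^-1^-1 ** (((g^-1 ** rep g)^-1) ** g^-1) by grp.
apply: normal_conj; first exact: nK. apply: sub_inv; [exact: sK | exact: rep_spec].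
Qed.
Let qassoc a b c : qmul a (qmul b c) = qmul (qmul a b) c.
Proof. by rewrite -(qproj_val a) -(qproj_val b) -(qproj_val c) !qmul_proj gmul_assoc. Qed.
Let q1l a : qmul qone a = a.
Proof. by rewrite -(qproj_val a) qmul_proj gmul_1l. Qed.
Let qVl a : qmul (qinv a) a = qone.
Proof. by rewrite -(qproj_val a) qinv_proj qmul_proj gmul_Vl. Qed.

Definition quotient_group : Group := Build_Group qcarrier qmul qone qinv qassoc q1l qVl.

Lemma quotient_exists : exists (Q : Group) (f : G -> Q),
  hom G Q f /\ surj G Q f /\ forall x, f x = gone <-> K x.
Proof.
exists quotient_group, qproj; split; first by move=> x y; rewrite -qmul_proj.
split; first by move=> y; exists (qval y); apply: qproj_val.
move=> x; split=> [E|k].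
  have /= E2 := f_equal qval E.
  have k1 := rep_spec x. have k2 := rep_spec gone. rewrite E2 in k1.
  have -> : x = ((gone : G)^-1 ** rep gone) ** (x^-1 ** rep gone)^-1 by grp.
  apply: sub_mul; [exact: sK | exact: k2 | apply: sub_inv; [exact: sK | exact: k1]].
apply: qproj_eq. gsimp. apply: sub_inv; [exact: sK | exact: k].
Qed.
End Quotient.

Section Hom.
Variables (G Q : Group) (f : G -> Q).
Hypothesis fM : hom G Q f.
Hypothesis fS : surj G Q f.
Implicit Types (H K N : gset G).

Definition img H : gset Q := fun y => exists x, H x /\ f x = y.
Definition pre (B : gset Q) : gset G := fun x => B (f x).
Definition ker : gset G := fun x => f x = gone.

Lemma hom_1 : f gone = gone.
Proof. by apply: (mul_cancel _ (f gone)); rewrite -fM gmul_1l mul1r. Qed.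
Lemma hom_inv x : f x^-1 = (f x)^-1.
Proof. by apply: inv_eq; rewrite -fM mulVr hom_1. Qed.
Lemma hom_pow x n : f (x ^+ n) = f x ^+ n.
Proof. elim: n => [|n IH]; [exact: hom_1 | by rewrite !gpowS fM IH]. Qed.
Lemma hom_comm x y : f [~ x, y] = [~ f x, f y].
Proof. by rewrite /commutator !fM !hom_inv. Qed.
Lemma hom_conj x g : f (g^-1 ** (x ** g)) = (f g)^-1 ** (f x ** f g).
Proof. by rewrite !fM hom_inv. Qed.
Lemma hom_div x y : f (x^-1 ** y) = (f x)^-1 ** f y.
Proof. by rewrite !fM hom_inv. Qed.
Lemma hom_eq x y : f x = f y <-> ker (x^-1 ** y).
Proof.
rewrite /ker hom_div; split=> [->|]; first exact: gmul_Vl. exact: eq_of_div.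
Qed.
Lemma hom_commute x y : commute (f x) (f y) <-> ker [~ x, y].
Proof. by rewrite commute_comm /ker hom_comm. Qed.

Lemma img_in H x : H x -> img H (f x). Proof. by move=> Hx; exists x. Qed.
Lemma img_mono H K : subset G H K -> subset Q (img H) (img K).
Proof. by move=> HK y [x [/HK Kx <-]]; exists x. Qed.
Lemma img_sub H : subgroup G H -> subgroup Q (img H).
Proof.
move=> sH; split; first by exists gone; split; [exact: sub_1 | exact: hom_1].
split=> [y1 y2 [x1 [h1 <-]] [x2 [h2 <-]]|y [x [h <-]]].
  exists (x1 ** x2); split; [exact: sub_mul | exact: fM].
exists x^-1; split; [exact: sub_inv | exact: hom_inv].
Qed.
Lemma pre_sub B : subgroup Q B -> subgroup G (pre B).
Proof.
move=> sB; split; first by rewrite /pre hom_1; exact: sub_1.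
split=> [x y bx bY|x bx]; rewrite /pre ?fM ?hom_inv; [exact: sub_mul | exact: sub_inv].
Qed.
Lemma img_full : img fullset = fullset.
Proof. apply: gset_eq => y; split=> // _. have [x <-] := fS y. by exists x. Qed.
Lemma img_pre B : img (pre B) = B.
Proof.
apply: gset_eq => y; split=> [[x [bx <-]] //|By]. have [x e] := fS y. exists x; split=> //. by rewrite /pre e.
Qed.
Lemma ker_sub : subgroup G ker.
Proof.
split; first exact: hom_1. split=> [x y|x]; rewrite /ker ?fM ?hom_inv => ->; first by move=> ->; grp. exact: inv1.
Qed.
Lemma pre_normal_in A B : normal_in Q A B -> normal_in G (pre A) (pre B).
Proof.
case=> sA [sB [AB h]]; split; first exact: pre_sub. split; first exact: pre_sub.
split; first by move=> x /AB. by move=> k x Bk Ax; rewrite /pre hom_conj; apply: h.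
Qed.
Lemma img_normal_in H K : normal_in G H K -> normal_in Q (img H) (img K).
Proof.
case=> sH [sK [HK h]]; split; first exact: img_sub. split; first exact: img_sub.
split; first exact: img_mono.
move=> _ _ [k [Kk <-]] [x [Hx <-]]. rewrite -hom_conj. apply: img_in. exact: h.
Qed.
Lemma pre_full : pre fullset = fullset. Proof. by []. Qed.
Lemma pre_normal B : normal Q B -> normal G (pre B).
Proof. exact: pre_normal_in. Qed.
Lemma img_normal H : normal G H -> normal Q (img H).
Proof. by move=> nH; have := img_normal_in _ _ nH; rewrite img_full. Qed.
Lemma pre_subnormal B : subnormal Q B -> subnormal G (pre B).
Proof.
case=> n [s [s0 [sn h]]]; exists n, (fun i => pre (s i)); rewrite s0 sn; split=> //; split=> // i /h.
exact: pre_normal_in.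
Qed.
Lemma img_subnormal H : subnormal G H -> subnormal Q (img H).
Proof.
case=> n [s [s0 [sn h]]]; exists n, (fun i => img (s i)); rewrite s0 sn img_full; split=> //; split=> // i /h.
exact: img_normal_in.
Qed.

Lemma img_gen (A : gset G) : img (generated G A) = generated Q (img A).
Proof.
apply: gset_eq => y; split.
  case=> x [gx <-]. move: gx. apply: (gen_min _ _ (pre (generated Q (img A)))); first by apply: pre_sub; apply: gen_sub.
  by move=> z Az; apply: gen_incl; apply: img_in.
apply: gen_min; first by apply: img_sub; apply: gen_sub.
apply: img_mono => x; exact: gen_incl.
Qed.
Lemma img_gl l : img (gl G l) = gl Q (map f l).
Proof.
rewrite /gl img_gen; congr (generated _ _); apply: gset_eq => y; split.
  by case=> x [xl <-]; apply: in_map.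
by move=> /in_map_iff [x [<- xl]]; exists x.
Qed.
Lemma img_comm_subgroup A B : img (comm_subgroup G A B) = comm_subgroup Q (img A) (img B).
Proof.
rewrite /comm_subgroup img_gen; congr (generated _ _); apply: gset_eq => y; split.
  case=> _ [[a [b [Aa [Bb ->]]]] <-]. exists (f a), (f b); rewrite hom_comm; split; [by exists a | split=> //; by exists b].
case=> _ [_ [[a [Aa <-]] [[b [Bb <-]] ->]]]. exists [~ a, b]; rewrite hom_comm; split=> //. by exists a, b.
Qed.
Lemma img_lcs H i : img (lcs G H i) = lcs Q (img H) i.
Proof. by elim: i => [|i IH] //=; rewrite img_comm_subgroup IH. Qed.
Lemma img_derived : img (derived G) = derived Q.
Proof. by rewrite /derived img_comm_subgroup img_full. Qed.
Lemma img_periodic : periodic G -> periodic Q.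
Proof.
move=> p y; have [x <-] := fS y. have [n [n0 e]] := p x; exists n; split=> //. by rewrite -hom_pow e hom_1.
Qed.

Lemma lift_list H (l : list Q) : (forall y, In y l -> img H y) ->
  exists l', (forall x, In x l' -> H x) /\ map f l' = l.
Proof.
elim: l => [|y l IH] h; first by exists [].
have [l' [h1 h2]] := IH (fun z zl => h z (or_intror zl)). have [x [Hx e]] := h y (or_introl eq_refl).
exists (x :: l'); split; first by move=> z /= [<-|/h1]. by rewrite /= e h2.
Qed.
Lemma img_rank H r : subgroup G H -> rank_le G H r -> rank_le Q (img H) r.
Proof.
move=> sH rk L sL LH [l hl]. have e := generated_by_eq _ _ _ hl.
have [l' [h1 h2]] := lift_list H l ltac:(move=> y yl; apply: LH; rewrite e; exact: gl_in).
have [m [lm hm]] := rk (gl G l') (gl_sub _ _) (gl_min _ _ _ sH h1) (gl_fg _ _).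
have em := generated_by_eq _ _ _ hm.
exists (map f m); split; first by rewrite length_map.
by rewrite e -h2 -img_gl em img_gl.
Qed.
Lemma img_finite_rank H : subgroup G H -> finite_rank G H -> finite_rank Q (img H).
Proof. by move=> sH [r h]; exists r; apply: img_rank. Qed.

Lemma img_idx K H n : idx_le G K H n -> idx_le Q (img K) (img H) n.
Proof.
case=> l [h1 [h2 h3]]; exists (map f l); rewrite length_map; split=> //; split.
  by move=> y /in_map_iff [x [<- /h2]]; apply: img_in.
move=> _ [x [/h3 [z [zl Kz]] <-]]. exists (f z); split; first exact: in_map. rewrite -hom_div. exact: img_in.
Qed.
Lemma pre_idx B H n : subgroup Q B -> idx_le Q B (img H) n -> idx_le G (pre B) H n.
Proof.
move=> sB [l [h1 [h2 h3]]]. have [l' [h4 h5]] := lift_list H l h2.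
exists l'; split; first by rewrite -(length_map f l') h5. split=> // x Hx.
have [y [yl By]] := h3 _ (img_in _ _ Hx). move: yl; rewrite -h5 => /in_map_iff [z [ez zl]].
exists z; split=> //. by rewrite /pre hom_div ez.
Qed.
Lemma img_fi K H : finite_index_in G K H -> finite_index_in Q (img K) (img H).
Proof. by move=> /idx_finite [n h]; apply/idx_finite; exists n; apply: img_idx. Qed.
Lemma img_finset K H : subgroup G H -> (forall x, K x -> ker x) -> finite_index_in G K H -> finset Q (img H).
Proof.
move=> sH kK fi. have triv : subset Q (img K) (trivial_set Q) by move=> y [x [/kK kx <-]]; exact: kx.
apply: finset_fi_triv. apply: fi_mono triv _. exact: img_fi.
Qed.
Lemma img_commens A B : commensurable G A B -> commensurable Q (img A) (img B).
Proof.
have s : subset Q (img (inter G A B)) (inter Q (img A) (img B)).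
  by move=> y [x [[Ax Bx] <-]]; split; apply: img_in.
case=> h1 h2; split; apply: fi_mono s _; exact: img_fi.
Qed.
Lemma pre_fi A B : subgroup Q A -> finite_index_in Q A B -> finite_index_in G (pre A) (pre B).
Proof.
by move=> sA /idx_finite [n h]; apply/idx_finite; exists n; apply: pre_idx => //; rewrite img_pre.
Qed.
Lemma pre_commens A B : subgroup Q A -> subgroup Q B -> commensurable Q A B -> commensurable G (pre A) (pre B).
Proof.
move=> sA sB [h1 h2]. have s := sub_inter _ _ _ sA sB. split; exact: (pre_fi (inter Q A B)).
Qed.
Lemma pre_cn B : subgroup Q B -> cn Q B -> cn G (pre B).
Proof.
move=> sB [N [nN h]]; exists (pre N); split; first exact: pre_normal.
apply: pre_commens => //. exact: normal_sub.
Qed.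
End Hom.

(** * Lower central series and subnormality *)

Section Commutators.
Variable G : Group.
Implicit Types (x y z g : G) (A B C D H K L M N X : gset G).

Lemma comm_min A B K : subgroup G K -> (forall a b, A a -> B b -> K [~ a, b]) ->
  subset G (comm_subgroup G A B) K.
Proof. move=> sK h; apply: gen_min => // _ [a [b [Aa [Bb ->]]]]. exact: h. Qed.
Lemma comm_in A B a b : A a -> B b -> comm_subgroup G A B [~ a, b].
Proof. by move=> Aa Bb; apply: gen_incl; exists a, b. Qed.
Lemma comm_mono A B A' B' : subset G A A' -> subset G B B' ->
  subset G (comm_subgroup G A B) (comm_subgroup G A' B').
Proof. move=> hA hB; apply: gen_mono => _ [a [b [/hA Aa [/hB Bb ->]]]]. by exists a, b. Qed.
Lemma conjR x y g : g^-1 ** ([~ x, y] ** g) = [~ g^-1 ** (x ** g), g^-1 ** (y ** g)].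
Proof. grp. Qed.
Lemma comm_normal A B : normal G A -> normal G B -> normal G (comm_subgroup G A B).
Proof.
move=> nA nB; apply: normal_gen => _ g [a [b [Aa [Bb ->]]]]. rewrite conjR.
by apply: comm_in; apply: normal_conj.
Qed.
Lemma derived_normal : normal G (derived G).
Proof. by apply: comm_normal; apply: normal_full. Qed.
Lemma derived_comm x y : derived G [~ x, y].
Proof. exact: comm_in. Qed.

Lemma lcs_sub H i : subgroup G H -> subgroup G (lcs G H i).
Proof. by case: i => [|i] //= _; apply: gen_sub. Qed.
Lemma lcs_normal H i : normal G H -> normal G (lcs G H i).
Proof. by move=> nH; elim: i => [|i IH] //=; apply: comm_normal. Qed.
Lemma lcs_comm H i a b : lcs G H i a -> H b -> lcs G H (S i) [~ a, b].
Proof. exact: comm_in. Qed.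
Lemma lcs_S H i : subgroup G H -> subset G (lcs G H (S i)) (lcs G H i).
Proof.
move=> sH; elim: i => [|i IH]; apply: comm_min; try exact: lcs_sub.
  by move=> a b Ha Hb; scomm.
by move=> a b /IH La Hb; apply: lcs_comm.
Qed.
Lemma lcs_le H i j : subgroup G H -> i <= j -> subset G (lcs G H j) (lcs G H i).
Proof. move=> sH; elim=> [|m _ IH] // x /(lcs_S _ _ sH). exact: IH. Qed.
Lemma lcs_in H i : subgroup G H -> subset G (lcs G H i) H.
Proof. move=> sH; exact: (lcs_le H 0 i sH (Nat.le_0_l _)). Qed.
Lemma lcs_mono H K i : subset G H K -> subset G (lcs G H i) (lcs G K i).
Proof. by move=> HK; elim: i => [|i IH] //=; apply: comm_mono. Qed.
Lemma nilpotent_mono H K : subset G H K -> nilpotent G K -> nilpotent G H.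
Proof. by move=> HK [c h]; exists c => x /(lcs_mono _ _ _ HK) /h. Qed.

Definition prd X A : gset G := fun g => exists x a, X x /\ A a /\ g = x ** a.
Lemma prd_sub X A : subgroup G X -> subgroup G A ->
  (forall x a, X x -> A a -> A (x^-1 ** (a ** x))) -> subgroup G (prd X A).
Proof.
move=> sX sA n; split; first by exists gone, gone; rewrite gmul_1l; split; [by sone|split=> //; by sone].
split.
  move=> _ _ [x [a [Xx [Aa ->]]]] [y [b [Xy [Ab ->]]]].
  exists (x ** y), ((y^-1 ** (a ** y)) ** b); split; first by smul.
  split; [by smul => //; apply: n | grp].
move=> _ [x [a [Xx [Aa ->]]]]. exists x^-1, (x^-1^-1 ** (a^-1 ** x^-1)); split; first by sinv.
split; [apply: n; by sinv | grp].
Qed.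
Lemma prd_l X A : subgroup G A -> subset G X (prd X A).
Proof. by move=> sA x Xx; exists x, gone; split=> //; split; [by sone | rewrite mul1r]. Qed.
Lemma prd_r X A : subgroup G X -> subset G A (prd X A).
Proof. by move=> sA x Xx; exists gone, x; split; [by sone | split=> //; rewrite gmul_1l]. Qed.
Lemma prd_n_sub X A : subgroup G X -> normal G A -> subgroup G (prd X A).
Proof.
move=> sX nA; apply: prd_sub => //; first exact: normal_sub. move=> x a _ Aa; exact: normal_conj.
Qed.
Lemma prd_min X A K : subgroup G K -> subset G X K -> subset G A K -> subset G (prd X A) K.
Proof. by move=> sK XK AK _ [x [a [/XK Kx [/AK Ka ->]]]]; smul. Qed.
Lemma prd_mono X A Y B : subset G X Y -> subset G A B -> subset G (prd X A) (prd Y B).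
Proof. by move=> XY AB _ [x [a [/XY ? [/AB ? ->]]]]; exists x, a. Qed.

Lemma subnormal_step H K : normal_in G H K -> subnormal G K -> subnormal G H.
Proof.
move=> hk [n [s [s0 [sn h]]]].
exists (S n), (fun i => match i with 0 => H | S j => s j end); split=> //; split=> //.
case=> [|i] le; [by rewrite s0 | apply: h; lia].
Qed.
Lemma subnormal_sub H : subnormal G H -> subgroup G H.
Proof.
case=> [[|n] [s [<- [sn h]]]]; first by rewrite sn; exact: sub_full. by case: (h 0 ltac:(lia)).
Qed.
Lemma prd_subnormal X A : subnormal G X -> normal G A -> subnormal G (prd X A).
Proof.
case=> n [s [s0 [sn h]]] nA; exists n, (fun i => prd (s i) A); rewrite s0 sn; split=> //; split.
  by apply: gset_eq => x; split=> // _; apply: prd_l => //; apply: normal_sub.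
move=> i le. have [s1 [s2 [s12 hn]]] := h i le.
have p1 := prd_n_sub _ _ s1 nA. have p2 := prd_n_sub _ _ s2 nA.
split=> //; split=> //; split; first exact: prd_mono.
move=> _ _ [k [a [kk [Aa ->]]]] [x [b [xx [Ab ->]]]].
have -> : (k ** a)^-1 ** (x ** b ** (k ** a)) =
   (a^-1 ** ((k^-1 ** (x ** k)) ** a)) ** ((k ** a)^-1 ** (b ** (k ** a))) by grp.
smul => //; last by apply: prd_r => //; apply: normal_conj.
have pa := prd_r _ _ s1 a Aa. sdiv => //. smul => //.
apply: prd_l; [exact: normal_sub | exact: hn].
Qed.

(* [X] centralises [M], so refining [M] to [A] through [A (lcs M j)] keeps the products with [X] normal in each other. *)
Lemma prd_central_subnormal X M A : subnormal G X -> normal G M -> nilpotent G M ->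
  subgroup G A -> subset G A M -> (forall x m, X x -> M m -> commute x m) -> subnormal G (prd X A).
Proof.
move=> snX nM [c hc] sA AM cXM. have sX := subnormal_sub _ snX. have sM := normal_sub _ _ nM.
have sB : forall j, subgroup G (prd A (lcs G M j)).
  by move=> j; apply: prd_n_sub => //; apply: lcs_normal.
have BM : forall j, subset G (prd A (lcs G M j)) M.
  move=> j; apply: prd_min => //; exact: lcs_in.
have sXB : forall j, subgroup G (prd X (prd A (lcs G M j))).
  move=> j; apply: prd_sub => // x b Xx Bb.
  have e := cXM x b Xx (BM _ _ Bb). by rewrite -e mulKV.
have H : forall j, subnormal G (prd X (prd A (lcs G M j))).
  elim=> [|j IH] /=.
    have -> : prd A M = M.
      by apply: gset_eq => x; split; [exact: (BM 0) | exact: prd_r].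
    exact: prd_subnormal.
  apply: subnormal_step IH. split; first exact: (sXB (S j)). split; first exact: sXB.
  split; first by apply: prd_mono => //; apply: prd_mono => //; exact: lcs_S.
  move=> _ _ [x [b [Xx [Bb ->]]]] [y [d [Xy [Dd ->]]]].
  have cb : forall z, X z -> commute z b by move=> z Xz; apply: cXM => //; exact: (BM j).
  have -> : (x ** b)^-1 ** (y ** d ** (x ** b)) = (x^-1 ** (y ** x)) ** (b^-1 ** (d ** b)).
    have e1 : d ** x = x ** d by symmetry; apply: cXM => //; exact: (BM (S j)).
    have e2 : b^-1 ** (x^-1 ** (y ** x)) = (x^-1 ** (y ** x)) ** b^-1.
      by apply: commute_sym; apply: commute_inv; apply: cb; sdiv => //; smul.
    have -> : (x ** b)^-1 ** (y ** d ** (x ** b)) = b^-1 ** (x^-1 ** (y ** ((d ** x) ** b))) by grp.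
    rewrite e1. have -> : b^-1 ** (x^-1 ** (y ** (x ** d ** b))) = (b^-1 ** (x^-1 ** (y ** x))) ** (d ** b) by grp.
    rewrite e2. grp.
  exists (x^-1 ** (y ** x)), (b^-1 ** (d ** b)); split; first by sdiv => //; smul.
  split=> //. case: Bb => a [l [Aa [Ll ->]]].
  have -> : (a ** l)^-1 ** (d ** (a ** l)) = l^-1 ** ((a^-1 ** (d ** a)) ** l) by grp.
  have Ba : prd A (lcs G M (S j)) a by apply: prd_l => //; apply: lcs_sub.
  have Be : prd A (lcs G M (S j)) (a^-1 ** (d ** a)).
    by apply: (sub_div _ _ _ _ (sB (S j))) => //; apply: (sub_mul _ _ _ _ (sB (S j))).
  rewrite conj_comm. apply: (sub_mul _ _ _ _ (sB (S j))) => //.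
  rewrite -comm_inv. apply: (sub_inv _ _ _ (sB (S j))). apply: prd_r => //. apply: lcs_comm => //. exact: BM Be.
have := H c. congr (subnormal _ _). apply: gset_eq => g; split.
  move=> [x [_ [Xx [[a [l [Aa [/hc -> ->]]]] ->]]]]. by exists x, a; rewrite mul1r.
move=> [x [a [Xx [Aa ->]]]]. exists x, a; split=> //; split=> //. apply: prd_l => //. exact: lcs_sub.
Qed.
End Commutators.

(** * Local finiteness *)

Section LocallyFinite.
Variable G : Group.
Implicit Types (x y z g : G) (A B C H K L M N X : gset G).

(** Schreier's lemma: [K] is generated by those of its elements that belong to the transversal [t]
    or have the form [v^-1 s u], with [u], [v] in [t] and [s] a generator or its inverse. *)
Lemma schreier (l : list G) K : subgroup G K -> subset G K (gl G l) -> finite_index_in G K (gl G l) ->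
  fin_gen G K.
Proof.
move=> sK KL [t0 [tL cov]].
set l2 := l ++ map ginv l. set t := gone :: t0.
set all := t ++ map (fun p => (fst p)^-1 ** (fst (snd p) ** snd (snd p))) (list_prod t (list_prod l2 t)).
have [w [_ hw]] := list_filter _ K all.
exists w => x; split; last first.
  by apply: gl_min => // y /hw [].
(* [T] is the union of the cosets [u <w>]. It is stable under left multiplication by generators, so
   it is all of [<l>]; [gone] was put into [t] to have a starting point. *)
move=> Kx. pose T g := exists u, In u t /\ gl G w (u^-1 ** g).
have step : forall s g, In s l2 -> T g -> T (s ** g).
  move=> s g sl [u [ut Wu]].
  have Lsu : gl G l (s ** u).
    have sgl := gl_sub _ l.
    smul => //.
      move: sl; rewrite /l2 => /(in_app_or l) [sl|/in_map_iff [s' [<- sl]]]; [exact: gl_in | sinv => //; exact: gl_in].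
    by move: ut => [<-|/tL //]; sone.
  have [v [vt Kv]] := cov _ Lsu.
  exists v; split; first by right.
  have -> : v^-1 ** (s ** g) = (v^-1 ** (s ** u)) ** (u^-1 ** g) by grp.
  smul => //; first exact: gl_sub.
  apply: gl_in; apply/hw; split=> //. apply/in_or_app; right.
  apply/in_map_iff; exists (v, (s, u)); split=> //.
  apply: in_prod; first by right. exact: in_prod.
pose P a := forall g, T g -> T (a ** g) /\ T (a^-1 ** g).
have sP : subgroup G P.
  split; first by move=> g Tg; rewrite inv1 gmul_1l.
  split=> [a b Pa Pb g Tg|a Pa g Tg].
    rewrite invM !mulA; split; [apply: (proj1 (Pa _ _)); exact: (proj1 (Pb _ Tg)) | apply: (proj2 (Pb _ _)); exact: (proj2 (Pa _ Tg))].
  rewrite invK; split; [exact: (proj2 (Pa _ Tg)) | exact: (proj1 (Pa _ Tg))].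
have LP : subset G (gl G l) P.
  apply: gl_min => // s sl g Tg; split; apply: step => //; apply/in_or_app; first by left.
  by right; apply: in_map.
have T1 : T gone.
  exists gone; split; first by left. rewrite inv1 gmul_1l; sone; exact: gl_sub.
have := proj1 (LP x (KL x Kx) gone T1); rewrite mul1r => [[u [ut Wu]]].
have Ku : K u.
  apply: (sub_invE _ _ _ sK). apply: (sub_mull _ _ _ x sK Kx). move: Wu; apply: gl_min => // y /hw [] //.
rewrite -(mulVK _ u x). smul => //; first exact: gl_sub.
apply: gl_in; apply/hw; split=> //. apply/in_or_app; by left.
Qed.

(** A finitely generated periodic abelian group is finite, read modulo [C]. *)
Lemma fg_mod_abelian (l : list G) C : periodic G -> subgroup G C ->
  (forall x y, gl G l x -> gl G l y -> C [~ x, y]) ->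
  finite_index_in G (inter G (gl G l) C) (gl G l).
Proof.
move=> per sC hC. have sL := gl_sub _ l.
have [m [m0 hm]] := common_multiple G (fun x n => x ^+ n = gone) l
   ltac:(move=> x n k h nk; exact: gpow_divide nk h) (fun x _ => per x).
have sI := sub_inter _ _ _ sL sC.
have [|||||U [sU [CU [US [lU idx]]]]] := adjoin_list G (gl G l) (inter G (gl G l) C) m l sL sI.
- exact: inter_sub_l.
- by move=> x y Lx Ly; split; [by scomm | exact: hC].
- by move=> x; exact: gl_in.
- exact: m0.
- by move=> x /hm ->; sone.
- apply/idx_finite; exists (m ^ length l). apply: idx_le_restrict idx => //. exact: gl_min.
Qed.

Definition locally_finite := forall L, subgroup G L -> fin_gen G L -> finset G L.

(** Descend the series: [L /\ D (S i)] has finite index in [L /\ D i], hence in [L], and is finitely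
    generated again by Schreier's lemma. *)
Lemma locally_finite_of_series (D : nat -> gset G) c : periodic G ->
  (forall i, subgroup G (D i)) -> D 0 = fullset ->
  (forall i x y, D i x -> D i y -> D (S i) [~ x, y]) -> (forall x, D c x -> x = gone) -> locally_finite.
Proof.
move=> per sD D0 hD Dc L sL fL.
have H : forall i, exists l, inter G L (D i) = gl G l /\ finite_index_in G (inter G L (D i)) L.
  elim=> [|i [l [el fi]]].
    have -> : inter G L (D 0) = L by rewrite D0; apply: inter_eq.
    case: fL => l /generated_by_eq hl. exists l; split=> //. exact: fi_refl.
  have f1 := fg_mod_abelian l (inter G L (D (S i))) per (sub_inter _ _ _ sL (sD _)).
  rewrite -el in f1.
  have e : inter G (inter G L (D i)) (inter G L (D (S i))) = inter G (inter G L (D i)) (D (S i)).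
    apply: gset_eq => x; rewrite /inter; tauto.
  have {}f1 : finite_index_in G (inter G (inter G L (D i)) (D (S i))) (inter G L (D i)).
    rewrite -e. apply: f1 => x y [Lx Dx] [Ly Dy]; split; [by scomm | exact: hD].
  have sI : subgroup G (inter G (inter G L (D i)) (D (S i))) by apply: sub_inter => //; apply: sub_inter.
  have [l' /generated_by_eq hl'] : fin_gen G (inter G (inter G L (D i)) (D (S i))).
    apply: (schreier l) => //; rewrite -el //. exact: inter_sub_l.
  have f2 := fi_trans _ _ _ _ sI f1 fi.
  have s3 := sub_inter _ _ _ sL (sD (S i)).
  have [l3 /generated_by_eq h3] : fin_gen G (inter G L (D (S i))).
    case: fL => l0 /generated_by_eq hl0. apply: (schreier l0) => //; rewrite -hl0; first exact: inter_sub_l.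
    by apply: fi_mono f2 => x [[? ?] ?].
  exists l3; split=> //. by apply: fi_mono f2 => x [[? ?] ?].
have [l [_ fi]] := H c. apply: (idx_finset _ _ _ _ _ fi); first exact: sub_inter.
by exists [gone] => x [_ /Dc ->]; left.
Qed.

Lemma locally_finite_of_nilpotent_derived : periodic G -> nilpotent G (derived G) -> locally_finite.
Proof.
move=> per [c hc].
apply: (locally_finite_of_series (fun i => match i with 0 => fullset | S j => lcs G (derived G) j end) (S c)) => //.
  case=> [|i]; [exact: sub_full | apply: lcs_sub; apply: normal_sub; exact: derived_normal].
case=> [|i] x y h1 h2; first exact: derived_comm.
apply: lcs_comm => //. apply: lcs_in h2. apply: normal_sub; exact: derived_normal.
Qed.
End LocallyFinite.

Lemma img_locally_finite (G Q : Group) (f : G -> Q) : hom G Q f -> surj G Q f ->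
  locally_finite G -> locally_finite Q.
Proof.
move=> fM fS lf L sL [l /generated_by_eq hl].
have [l' [_ e]] := lift_list G Q f fullset l ltac:(by rewrite img_full).
have [w hw] := lf _ (gl_sub _ l') (gl_fg _ l').
exists (map f w) => y; rewrite hl -e -img_gl // => [[x [/hw xw <-]]]. exact: in_map.
Qed.

(** Local finiteness makes the kernel part of a finitely generated [L] finite, hence finitely
    generated, so that the rank bound on the kernel applies to it. *)
Lemma rank_le_extension (G Q : Group) (f : G -> Q) (N : gset G) r1 r2 :
  hom G Q f -> surj G Q f -> locally_finite G -> subgroup G N ->
  rank_le G (inter G (ker G Q f) N) r1 -> rank_le Q (img G Q f N) r2 -> rank_le G N (r1 + r2).
Proof.
move=> fM fS lf sN k1 k2 L sL LN fL.
have sker := ker_sub G Q f fM.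
have fin := lf L sL fL.
have sI := sub_inter _ _ _ sker sL.
have [l1 [ll1 /generated_by_eq h1]] : exists l, length l <= r1 /\ generated_by G (inter G (ker G Q f) L) l.
  apply: k1 => //; first by move=> x [? /LN].
  apply: finset_fg => //. exact: finset_mono (inter_sub_r _ _ _) fin.
have [l2 [ll2 /generated_by_eq h2]] : exists l, length l <= r2 /\ generated_by Q (img G Q f L) l.
  apply: k2; [exact: img_sub | exact: img_mono |].
  case: fL => l /generated_by_eq ->. rewrite img_gl //. exact: gl_fg.
have [l2' [h3 h4]] := lift_list G Q f L l2 ltac:(move=> y yl; rewrite h2; exact: gl_in).
exists (l1 ++ l2'); split; first by rewrite length_app -(length_map f l2') h4; lia.
have s12 := gl_sub _ (l1 ++ l2').
move=> x; split; last first.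
  apply: gl_min => // y /in_app_iff [yl|/h3 //].
  have : gl G l1 y by apply: gl_in. by rewrite -h1 => [[]].
move=> Lx. have : img G Q f (gl G l2') (f x) by rewrite img_gl // h4 -h2; apply: img_in.
move=> [y [gy /(hom_eq _ _ _ fM) ky]].
have Ly : L y by move: gy; apply: gl_min.
have : gl G l1 (y^-1 ** x) by rewrite -h1; split=> //; by sdiv.
have m1 : subset G (gl G l1) (gl G (l1 ++ l2')) by exact: gl_appl.
have m2 : subset G (gl G l2') (gl G (l1 ++ l2')) by exact: gl_appr.
move=> /m1 a. rewrite -(mulVK _ y x). apply: (sub_mul _ _ _ _ s12) => //. exact: m2.
Qed.

(** * Torsion in nilpotent groups *)

Definition nprime (p : nat) := 1 < p /\ forall d, Nat.divide d p -> d = 1 \/ d = p.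

Lemma prime_divisor n : 1 < n -> exists p, nprime p /\ Nat.divide p n.
Proof.
elim/lt_wf_ind: n => n IH n1.
case: (classic (nprime n)) => [pn|np]; first by exists n; split=> //; exists 1; lia.
have [d [dn [d1 d2]]] : exists d, Nat.divide d n /\ d <> 1 /\ d <> n.
  apply: NNPP => no; apply: np; split=> // d dn. apply: NNPP => no2; apply: no; exists d; tauto.
have le := Nat.divide_pos_le d n ltac:(lia) dn.
have d0 : d <> 0 by move=> e; move: dn; rewrite e => [[k]]; lia.
have [p [pp pd]] := IH d ltac:(lia) ltac:(lia). exists p; split=> //. exact: Nat.divide_trans dn.
Qed.

Lemma prime_gcd p a : nprime p -> Nat.divide p a \/ Nat.gcd p a = 1.
Proof.
case=> p1 h. have [g1 g2] := Nat.gcd_divide p a. case: (h _ g1) => e; [by right | left; by rewrite -{1}e].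
Qed.
Lemma euclid p a b : nprime p -> Nat.divide p (a * b) -> Nat.divide p a \/ Nat.divide p b.
Proof.
move=> pp d. case: (prime_gcd p a pp) => [|g]; [by left | right; exact: Nat.gauss d g].
Qed.
Lemma prime_gcd_lt p j : nprime p -> 0 < j < p -> Nat.gcd p j = 1.
Proof.
move=> pp h. case: (prime_gcd p j pp) => // d. have := Nat.divide_pos_le p j ltac:(lia) d; lia.
Qed.
Lemma prime_dvd_pow p a k : nprime p -> Nat.divide p (a ^ k) -> Nat.divide p a.
Proof.
move=> pp; elim: k => [|k IH] /=.
  move=> /Nat.divide_1_r p1. case: pp; lia.
by move=> /(euclid _ _ _ pp) [].
Qed.
Lemma prime_dvd_prime p q : nprime p -> nprime q -> Nat.divide p q -> p = q.
Proof. move=> [p1 _] [_ h] /h []; lia. Qed.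

Definition tnum (tau : nat -> Prop) n := 0 < n /\ forall p, nprime p -> Nat.divide p n -> tau p.
Definition compl (tau : nat -> Prop) p := ~ tau p.

Lemma tnum_1 tau : tnum tau 1.
Proof. split=> // p [p1 _] /Nat.divide_1_r; lia. Qed.
Lemma tnum_mul tau a b : tnum tau a -> tnum tau b -> tnum tau (a * b).
Proof. move=> [a0 ha] [b0 hb]; split; first nia. move=> p pp /(euclid _ _ _ pp) [/(ha _ pp)|/(hb _ pp)] //. Qed.
Lemma tnum_div tau a b : Nat.divide a b -> tnum tau b -> tnum tau a.
Proof.
move=> ab [b0 h]; split.
  case: (Nat.eq_dec a 0) => [e|]; last lia. move: ab; rewrite e => [[k]]; lia.
move=> p pp pa. apply: h => //. exact: Nat.divide_trans ab.
Qed.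
Lemma tnum_mono (tau sigma : nat -> Prop) n : (forall p, nprime p -> tau p -> sigma p) -> tnum tau n -> tnum sigma n.
Proof. by move=> h [n0 hn]; split=> // p pp /(hn _ pp); apply: h. Qed.
Lemma tnum_pow p k : nprime p -> tnum (eq p) (p ^ k).
Proof.
move=> pp; split; first by case: pp => p1 _; have := Nat.pow_nonzero p k; lia.
move=> q qp /(prime_dvd_pow _ _ _ qp) /(prime_dvd_prime _ _ qp pp) //.
Qed.
Lemma tnum_split tau n : 0 < n -> exists a b, n = a * b /\ tnum tau a /\ tnum (compl tau) b.
Proof.
elim/lt_wf_ind: n => n IH n0.
case: (Nat.eq_dec n 1) => [->|n1]; first by exists 1, 1; split=> //; split; apply: tnum_1.
have [p [pp [m em]]] := prime_divisor n ltac:(lia).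
have p1 : 1 < p by case: pp.
have [a [b [e [ta tb]]]] := IH m ltac:(nia) ltac:(nia).
have tp := tnum_pow p 1 pp. rewrite Nat.pow_1_r in tp.
case: (classic (tau p)) => tp'.
  exists (p * a), b; split; first by rewrite em e; nia.
  split=> //. apply: tnum_mul => //. by apply: tnum_mono tp => q _ <-.
exists a, (p * b); split; first by rewrite em e; nia.
split=> //. apply: tnum_mul => //. by apply: tnum_mono tp => q _ <-.
Qed.
Definition disjoint (tau sigma : nat -> Prop) := forall p, nprime p -> tau p -> sigma p -> False.
Lemma disjoint_compl tau : disjoint tau (compl tau).
Proof. by move=> p _ tp; apply. Qed.
Lemma disjoint_sym tau sigma : disjoint tau sigma -> disjoint sigma tau.
Proof. move=> h p pp s t; exact: (h p). Qed.
Lemma tnum_coprime tau sigma a b : disjoint tau sigma -> tnum tau a -> tnum sigma b -> Nat.gcd a b = 1.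
Proof.
move=> dj [a0 ha] [b0 hb]. have [g1 g2] := Nat.gcd_divide a b.
have g0 : Nat.gcd a b <> 0 by move=> /Nat.gcd_eq_0_l; lia.
apply: NNPP => ne. have [p [pp pd]] := prime_divisor (Nat.gcd a b) ltac:(lia).
apply: (dj p pp); [apply: ha => // | apply: hb => //]; apply: Nat.divide_trans pd _ => //.
Qed.

Section Torsion.
Variable G : Group.
Implicit Types (x y z g : G) (A B C H K L M N R X S : gset G) (tau sigma : nat -> Prop).

Definition tel tau x := exists n, tnum tau n /\ x ^+ n = gone.
(** For periodic nilpotent normal [R] this is the Hall [tau]-subgroup; [eq p] and [compl (eq p)]
    give [R_p] and [R_p'] of the overview. *)
Definition part R tau : gset G := fun x => R x /\ tel tau x.

Lemma tel_1 tau : tel tau gone. Proof. exists 1; split; [exact: tnum_1 | exact: gpow_one]. Qed.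
Lemma tel_pow tau x k : tel tau x -> tel tau (x ^+ k).
Proof. case=> n [tn e]; exists n; split=> //. by rewrite gpow_mulAC e gpow_one. Qed.
Lemma tel_inv tau x : tel tau x -> tel tau x^-1.
Proof. case=> n [tn e]; exists n; split=> //. by rewrite gpow_inv e inv1. Qed.
Lemma tel_conj tau x g : tel tau x -> tel tau (g^-1 ** (x ** g)).
Proof. case=> n [tn e]; exists n; split=> //. rewrite gpow_conj e. grp. Qed.
Lemma tel_mono tau sigma x : (forall p, nprime p -> tau p -> sigma p) -> tel tau x -> tel sigma x.
Proof. move=> h [n [tn e]]; exists n; split=> //. exact: tnum_mono tn. Qed.
Lemma tel_disjoint tau sigma x : disjoint tau sigma -> tel tau x -> tel sigma x -> x = gone.
Proof. move=> dj [n [tn en]] [m [tm em]]. exact: (coprime_trivial _ x n m (tnum_coprime _ _ _ _ dj tn tm)). Qed.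
Lemma tel_root tau sigma x n : disjoint tau sigma -> tel sigma x -> tnum tau n -> exists k, x = (x ^+ n) ^+ k.
Proof.
move=> dj [m [tm em]] tn. apply: (coprime_root _ x n m) => //; last by case: tn; lia. exact: tnum_coprime tn tm.
Qed.
Lemma tel_inter tau sigma x : tel tau x -> tel sigma x -> tel (fun p => tau p /\ sigma p) x.
Proof.
move=> [n [tn en]] [m [tm em]]. exists (Nat.gcd n m).
have [g1 g2] := Nat.gcd_divide n m. split.
  case: (tnum_div _ _ _ g1 tn) => g0 h1. case: (tnum_div _ _ _ g2 tm) => _ h2. split=> // p pp pd.
  split; [exact: h1 | exact: h2].
have [a [b E]] := Nat.gcd_bezout_pos n m ltac:(case: tn; lia).
have := gpow_multiple _ x n a en. by rewrite Nat.mul_comm E gpow_add (Nat.mul_comm b) gpow_multiple // mul1r.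
Qed.
(** With [n = a b] and [u b = 1 + v a], write [x] as [x ^ (u b)] times [x ^ (- v a)]; the factor
    [n - 1] turns the negative exponent into a natural one. *)
Lemma tel_split tau x n : 0 < n -> x ^+ n = gone ->
  exists i j, x = x ^+ i ** x ^+ j /\ tel tau (x ^+ i) /\ tel (compl tau) (x ^+ j).
Proof.
move=> n0 xn. have [a [b [e [ta tb]]]] := tnum_split tau n n0.
have g := tnum_coprime _ _ _ _ (disjoint_compl tau) ta tb.
have a0 : 0 < a by case: ta. have b0 : 0 < b by case: tb.
have [u [v E]] := Nat.gcd_bezout_pos b a ltac:(lia).
rewrite Nat.gcd_comm g in E.
exists (u * b), (v * a * (n - 1)); split; last split.
- rewrite E gpow_add gpow1 mulA -gpow_add. have -> : v * a + v * a * (n - 1) = n * (v * a) by nia.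
  by rewrite gpow_multiple // mul1r.
- exists a; split=> //. rewrite -gpow_mulA. have -> : u * b * a = n * u by nia. exact: gpow_multiple.
- exists b; split=> //. rewrite -gpow_mulA. have -> : v * a * (n - 1) * b = n * (v * (n - 1)) by nia. exact: gpow_multiple.
Qed.

(* [[~ a, b] ^+ n] and [[~ a ^+ n, b]] agree modulo the next term, so exponents pass down the lower central series. *)
Lemma lcs_factor_torsion (NN : nat -> Prop) S n0 : NN n0 ->
  (forall a b, NN a -> NN b -> exists c, NN c /\ Nat.divide a c /\ Nat.divide b c) ->
  normal G (generated G S) -> (forall s, S s -> exists n, NN n /\ s ^+ n = gone) ->
  forall i x, lcs G (generated G S) i x -> exists n, NN n /\ lcs G (generated G S) (Datatypes.S i) (x ^+ n).
Proof.
move=> N0 dir nM hS. set M := generated G S. have sM := normal_sub _ _ nM.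
(* The image of [A] is abelian, so there the elements killed by an exponent from the directed set
   [NN] form a subgroup, and it is enough to test generators. *)
have key : forall (A B : gset G) i (Q : Group) (f : G -> Q), hom G Q f ->
  (forall x, f x = gone <-> lcs G M (Datatypes.S i) x) -> subgroup G A -> subset G A (lcs G M i) ->
  subset G B A ->
  (forall x, B x -> exists n, NN n /\ f x ^+ n = gone) ->
  forall x, generated G B x -> exists n, NN n /\ f x ^+ n = gone.
  move=> A B i Q f fM fK sA AM BA hB x gx.
  suff: A x /\ exists n, NN n /\ f x ^+ n = gone by case.
  move: x gx. apply: (gen_min _ _ (fun x => A x /\ exists n, NN n /\ f x ^+ n = gone)); last first.
    by move=> x Bx; split; [exact: BA | exact: hB].
  split; first by split; [sone | exists n0; rewrite hom_1 // gpow_one].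
  split.
    move=> x y [Ax [a [Na ea]]] [Ay [b [Nb eb]]]; split; first by smul.
    have [c [Nc [ac bc]]] := dir a b Na Nb. exists c; split=> //.
    rewrite fM gpow_mulM; last by rewrite (gpow_divide _ _ _ _ ac ea) (gpow_divide _ _ _ _ bc eb) gmul_1l.
    apply/hom_commute => //. apply/fK. apply: lcs_comm; first exact: AM.
    apply: (lcs_in _ M i) => //. exact: AM.
  move=> x [Ax [a [Na ea]]]; split; first by sinv.
  by exists a; split=> //; rewrite hom_inv // gpow_inv ea inv1.
have back : forall i (Q : Group) (f : G -> Q), hom G Q f ->
  (forall x, f x = gone <-> lcs G M (Datatypes.S i) x) -> forall x,
  (exists n, NN n /\ f x ^+ n = gone) -> exists n, NN n /\ lcs G M (Datatypes.S i) (x ^+ n).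
  move=> i Q f fM fK x [n [Nn e]]; exists n; split=> //. by apply/fK; rewrite hom_pow.
elim=> [|i IH] x.
  have [Q [f [fM [fS fK]]]] := quotient_exists G (lcs G M 1) (lcs_normal _ _ _ nM).
  move=> gx. apply: (back 0 Q f) => //. apply: (key M S 0 Q f) => //; first by move=> y; exact: gen_incl.
  move=> s /hS [n [Nn e]]; exists n; split=> //. by rewrite -hom_pow // e hom_1.
have [Q [f [fM [fS fK]]]] := quotient_exists G (lcs G M (Datatypes.S (Datatypes.S i))) (lcs_normal _ _ _ nM).
move=> gx. apply: (back _ Q f) => //.
apply: (key (lcs G M (Datatypes.S i)) _ (Datatypes.S i) Q f _ fK _ _ _ _ x gx) => //; first exact: lcs_sub.
  by move=> y; exact: gen_incl.
move=> _ [a [b [La [Mb ->]]]]. have [n [Nn Ln]] := IH a La. exists n; split=> //.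
rewrite hom_comm // -comm_powl; last by rewrite -!hom_pow // -!hom_comm //; apply/fK; apply: lcs_comm.
rewrite -hom_comm //. apply/hom_commute => //; apply/fK. apply: lcs_comm; first exact: lcs_comm.
apply: (lcs_in _ M i) => //.
Qed.

(** Let [M] be generated by the [tau]-elements. Its lower central factors are [tau]-torsion, and the
    product of [c] successive exponents kills any given element of [M]. *)
Lemma part_normal R tau : normal G R -> nilpotent G R -> normal G (part R tau).
Proof.
move=> nR [c hc]. have sR := normal_sub _ _ nR.
set M := generated G (part R tau).
have MR : subset G M R by apply: gen_min => // x [].
have nM : normal G M.
  apply: normal_gen => x g [Rx tx]; apply: gen_incl; split; [exact: normal_conj | exact: tel_conj].
suff -> : part R tau = M by [].
apply: gset_eq => x; split; first exact: gen_incl.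
move=> Mx; split; first exact: MR.
have H : forall i, exists n, tnum tau n /\ lcs G M i (x ^+ n).
  elim=> [|i [n [tn Ln]]]; first by exists 1; rewrite gpow1; split=> //; exact: tnum_1.
  have [|m [tm Lm]] := lcs_factor_torsion (tnum tau) (part R tau) 1 (tnum_1 _) _ nM (fun s h => proj2 h) i _ Ln.
    move=> a b ta tb; exists (a * b); split; first exact: tnum_mul. split; [by exists b; lia | by exists a].
  exists (n * m); split; first exact: tnum_mul. by rewrite gpow_mulA.
have [n [tn Ln]] := H c. exists n; split=> //. apply: hc. exact: lcs_mono Ln.
Qed.

Lemma part_split R tau x : periodic G -> subgroup G R -> R x ->
  exists i j, x = x ^+ i ** x ^+ j /\ part R tau (x ^+ i) /\ part R (compl tau) (x ^+ j).
Proof.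
move=> per sR Rx. have [n [n0 xn]] := per x. have [i [j [e [h1 h2]]]] := tel_split tau x n n0 xn.
exists i, j; split=> //; split; split=> //; exact: sub_pow.
Qed.

Lemma normal_commute A B : normal G A -> normal G B -> (forall x, A x -> B x -> x = gone) ->
  forall a b, A a -> B b -> commute a b.
Proof.
move=> nA nB tr a b Aa Bb. apply/commute_comm; apply: tr; [exact: normal_comml | exact: normal_commr].
Qed.

Lemma coprime_normal_commute A B tau sigma : disjoint tau sigma -> normal G A -> normal G B ->
  (forall x, A x -> tel tau x) -> (forall x, B x -> tel sigma x) ->
  forall a b, A a -> B b -> commute a b.
Proof.
move=> dj nA nB tA tB; apply: normal_commute => // x /tA h1 /tB h2. exact: tel_disjoint dj h1 h2.
Qed.

(** If [x a = y b] then [b a^-1] lies in [X]. As [a] and [b] commute, raising to the order of [b]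
    leaves a power of [a^-1] that generates [a]. *)
Lemma prd_coprime_inter X A B tau sigma : subgroup G X -> disjoint tau sigma ->
  normal G A -> normal G B -> (forall x, A x -> tel tau x) -> (forall x, B x -> tel sigma x) ->
  inter G (prd G X A) (prd G X B) = X.
Proof.
move=> sX dj nA nB tA tB. have sA := normal_sub _ _ nA. have sB := normal_sub _ _ nB.
apply: gset_eq => g; split; last by move=> Xg; split; apply: prd_l.
case=> [[x [a [Xx [Aa e1]]]] [y [b [Xy [Bb e2]]]]].
have ab := coprime_normal_commute A B _ _ dj nA nB tA tB a b Aa Bb.
have E : y^-1 ** x = b ** a^-1.
  apply: (mul_cancel _ y). rewrite mulVK. apply: (mul_cancel_r _ a). rewrite !mulA gmul_Vl mul1r.
  by rewrite -e1 e2.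
have Xba : X (b ** a^-1) by rewrite -E; sdiv.
have [n [tn bn]] := tB b Bb.
have c : commute b a^-1 by apply: commute_inv; apply: commute_sym.
have Xan : X (a^-1 ^+ n).
  have := sub_pow _ _ _ n sX Xba. by rewrite gpow_mulM // bn gmul_1l.
have [k ek] := tel_root _ _ a^-1 n (disjoint_sym _ _ dj) (tel_inv _ _ (tA a Aa)) tn.
rewrite e1. apply: (sub_mul _ X) => //. apply: (sub_invE _ X) => //. rewrite ek. by spow.
Qed.

Lemma rank_le_part_union N tau sigma r1 r2 : locally_finite G -> periodic G -> normal G N -> nilpotent G N ->
  rank_le G (part N tau) r1 -> rank_le G (part N sigma) r2 ->
  rank_le G (part N (fun p => tau p \/ sigma p)) (r1 + r2).
Proof.
move=> lf per nN nilN k1 k2 L sL LN fL.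
have fin := lf L sL fL.
have sub r (rho : nat -> Prop) : rank_le G (part N rho) r -> exists l, length l <= r /\ inter G L (part N rho) = gl G l.
  move=> k. have sI : subgroup G (inter G L (part N rho)) by apply: sub_inter => //; apply: normal_sub; apply: part_normal.
  have [l [ll /generated_by_eq hl]] := k _ sI (inter_sub_r _ _ _) (finset_fg _ _ sI (finset_mono _ _ _ (inter_sub_l _ _ _) fin)).
  by exists l.
have [l1 [ll1 h1]] := sub _ _ k1. have [l2 [ll2 h2]] := sub _ _ k2.
exists (l1 ++ l2); split; first by rewrite length_app; lia.
have m1 : subset G (gl G l1) (gl G (l1 ++ l2)) by exact: gl_appl.
have m2 : subset G (gl G l2) (gl G (l1 ++ l2)) by exact: gl_appr.
move=> x; split; last first.
  have i1 : forall y, In y l1 -> L y by move=> y /gl_in; rewrite -h1 => [[]].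
  have i2 : forall y, In y l2 -> L y by move=> y /gl_in; rewrite -h2 => [[]].
  by apply: gl_min => // y /in_app_iff [/i1|/i2].
move=> Lx. have [Nx tx] := LN x Lx.
have [i [j [e [[Ni ti] [Nj tj]]]]] := part_split N tau x per (normal_sub _ _ nN) Nx.
change (gl G (l1 ++ l2) x).
rewrite e. smul; first exact: gl_sub.
  apply: m1; rewrite -h1; split; [by spow | by split].
apply: m2; rewrite -h2; split; [by spow | split=> //].
have := tel_inter _ _ _ (tel_pow _ _ j tx) tj. by apply: tel_mono => p _ [[]].
Qed.
End Torsion.

(** * Elementary abelian subgroups of nilpotent p-groups *)

Lemma dependent_choice (St : Type) (Inv : St -> Prop) (T : nat -> St -> St -> Prop) s0 : Inv s0 ->
  (forall k s, Inv s -> exists s', Inv s' /\ T k s s') ->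
  exists f : nat -> St, f 0 = s0 /\ forall k, Inv (f k) /\ T k (f k) (f (S k)).
Proof.
move=> i0 step.
pose nx k s := epsilon (inhabits s) (fun s' => Inv s' /\ T k s s').
have hn : forall k s, Inv s -> Inv (nx k s) /\ T k s (nx k s).
  move=> k s /(step k) ex. exact: (epsilon_spec (inhabits s) (fun s' => Inv s' /\ T k s s') ex).
exists (fix f n := match n with 0 => s0 | S k => nx k (f k) end); split=> // k.
set f := fix f n := match n with 0 => s0 | S k => nx k (f k) end.
have I : Inv (f k) by elim: k => [|k IH] //=; case: (hn k _ IH).
split=> //. by case: (hn k _ I).
Qed.

Lemma tnum_dvd_pow tau b n : tnum tau n -> (forall p, nprime p -> tau p -> Nat.divide p b) ->
  exists k, Nat.divide n (b ^ k).
Proof.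
move=> tn h. elim/lt_wf_ind: n tn => n IH tn. have n0 : 0 < n by case: tn.
case: (Nat.eq_dec n 1) => [->|n1]; first by exists 0; exists 1.
have [p [pp [m em]]] := prime_divisor n ltac:(lia).
have pd : Nat.divide p n by exists m.
have md : Nat.divide m n by exists p; lia.
have p1 : 1 < p by case: pp.
have [k [a ea]] := IH m ltac:(nia) (tnum_div _ _ _ md tn).
have [c ec] := h p pp (proj2 tn p pp pd).
exists (S k), (a * c). rewrite Nat.pow_succ_r' ea ec em; nia.
Qed.

Section Counting.
Variable G : Group.
Implicit Types (x y z g : G) (A B C H K L M N U X : gset G).

Definition el_ab p A := subgroup G A /\ (forall x y, A x -> A y -> commute x y) /\ forall x, A x -> x ^+ p = gone.

Lemma gen_commute A B : (forall a b, A a -> B b -> commute a b) ->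
  forall x y, generated G A x -> generated G B y -> commute x y.
Proof.
have half : forall (B : gset G) x, (forall b, B b -> commute x b) -> forall y, generated G B y -> commute x y.
  move=> {}B x h. apply: (gen_min _ _ (fun y => commute x y)) => //. exact: commute_sub.
move=> h x y gx gy. apply: (half B x) => // b Bb. apply: commute_sym.
apply: (half A b) => // a Aa. apply: commute_sym. exact: h.
Qed.

Lemma sep_app K (l1 l2 : list G) : sep G K l1 -> sep G K l2 ->
  (forall x y, In x l1 -> In y l2 -> ~ K (y^-1 ** x)) -> sep G K (l1 ++ l2).
Proof.
move=> s1 s2; elim: s1 => [|x l nx s IH] cr //=. constructor.
  move=> y /in_app_iff [/nx //|yl]. apply: cr => //. by left.
apply: IH => a b al bl. apply: cr => //. by right.
Qed.

(** The lower-bound counterpart of [idx_trans]. *)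
Lemma sep_prod K U (s P : list G) : subgroup G U -> subset G K U -> sep G U s -> sep G K P ->
  (forall x, In x P -> U x) -> sep G K (map (fun p => fst p ** snd p) (list_prod s P)).
Proof.
move=> sU KU; elim=> [|a s' na ss IH] sP PU /=; first by constructor.
rewrite map_app map_map /=. apply: sep_app; last 2 first.
- exact: IH.
- move=> x y /in_map_iff [b [<- bP]] /in_map_iff [[c d] [<- /in_prod_iff [cs dP]]] /= /KU Ux.
  apply: (na c cs).
  have -> : c^-1 ** a = d ** (((c ** d)^-1 ** (a ** b)) ** b^-1) by grp.
  smul => //; first exact: PU. smul => //. sinv => //. exact: PU.
- elim: sP {PU} => [|x P' nx _ IHP] /=; first by constructor.
constructor=> // y /in_map_iff [b [<- bP]] k. apply: (nx b bP).
by have -> : b^-1 ** x = (a ** b)^-1 ** (a ** x) by grp.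
Qed.

Definition powers L m : gset G := fun y => exists x, L x /\ y = x ^+ m.
Definition omega L m : gset G := fun x => L x /\ x ^+ m = gone.

Section Abelian.
Variables (L : gset G) (sL : subgroup G L) (cL : forall x y, L x -> L y -> commute x y).

Lemma powers_sub m : subgroup G (powers L m).
Proof.
split; first by exists gone; split; [sone | rewrite gpow_one].
split=> [_ _ [x [Lx ->]] [y [Ly ->]]|_ [x [Lx ->]]].
  exists (x ** y); split; [by smul | rewrite gpow_mulM //; exact: cL].
by exists x^-1; split; [sinv | rewrite gpow_inv].
Qed.
Lemma powers_in m : subset G (powers L m) L.
Proof. move=> _ [x [Lx ->]]. by spow. Qed.
Lemma omega_sub m : subgroup G (omega L m).
Proof.
split; first by split; [sone | rewrite gpow_one].
split=> [x y [Lx ex] [Ly ey]|x [Lx ex]].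
  split; first by smul. rewrite gpow_mulM ?ex ?ey ?gmul_1l //; exact: cL.
split; [by sinv | by rewrite gpow_inv ex inv1].
Qed.

(* [L / L[m]] is isomorphic to [L^m], so [L / L^m] and [L[m]] have the same order. *)
Lemma idx_powers m t : finset G L -> idx_le G (trivial_set G) (omega L m) t -> idx_le G (powers L m) L t.
Proof.
move=> finL idx. have sT := sub_triv G. have sP := powers_sub m.
(* The least upper bound [n] is the exact order of [L^m], so it also yields [n] distinct
   elements. *)
have [n [hn mn]] : exists n, idx_le G (trivial_set G) (powers L m) n /\
   forall k, idx_le G (trivial_set G) (powers L m) k -> n <= k.
  have ex : exists n, idx_le G (trivial_set G) (powers L m) n.
    have [l hl] := finset_mono _ _ _ (powers_in m) finL. exists (length l). apply: idx_of_cover => // h Ph.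
    exists h; split; [exact: hl | exact: gmul_Vl].
  case: ex => k; elim/lt_wf_ind: k => k IH hk.
  case: (classic (exists j, j < k /\ idx_le G (trivial_set G) (powers L m) j)) => [[j [jk hj]]|no].
    exact: (IH j).
  exists k; split=> // j hj. apply: NNPP => nj; apply: no; exists j; split=> //; lia.
apply: NNPP => ni. have [s [ls [sL' ss]]] := sep_exists _ _ _ _ sP ni.
have n0 : n <> 0.
  case: hn => [[|a l] [h1 [h2 h3]]].
    by have [x [[] _]] := h3 gone (sub_1 _ _ sP).
  move=> n0; move: h1; rewrite /= n0; lia.
have np : ~ idx_le G (trivial_set G) (powers L m) (n - 1) by move=> /mn; lia.
have [P [lP [PL sepP]]] := sep_exists _ _ _ _ sT np.
have TP : subset G (trivial_set G) (powers L m) by move=> x ->; exact: (sub_1 _ _ sP).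
(* These are [S t * n] distinct elements of [L], whose order is at most [t * n]. *)
have big := sep_prod _ _ _ _ sP TP ss sepP PL.
have i2 : idx_le G (omega L m) L n.
  case: hn => l [h1 [h2 h3]]. apply: (idx_le_leq _ _ _ (length l)) => //.
  apply: (idx_of_fun _ _ _ _ (fun x => x ^+ m)); first exact: omega_sub.
    move=> x Lx. have [y [yl e]] := h3 (x ^+ m) (ex_intro _ x (conj Lx eq_refl)).
    by rewrite -(eq_of_div _ _ _ e).
  move=> x y Lx Ly e; split; first by sdiv.
  rewrite gpow_mulM; last by rewrite gpow_inv e gmul_Vl.
  by apply: commute_sym; apply: commute_inv; apply: cL.
have i3 := idx_trans _ _ _ _ _ _ sT idx i2.
have := sep_length _ _ L _ _ sT big _ i3. rewrite length_map length_prod ls lP => k.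
suff : S t * S (n - 1) <= t * n by nia.
apply: k => x /in_map_iff [[a b] [<- /in_prod_iff [/sL' La /PL /powers_in Lb]]] /=. by smul.
Qed.

(** Substitute [L = <l> L^b] into itself. Once [b ^ k] kills [L], the list [l] generates it. *)
Lemma frattini_gen (l : list G) b : (forall x, In x l -> L x) ->
  (forall x, L x -> exists h y, gl G l h /\ L y /\ x = h ** y ^+ b) ->
  forall k x, L x -> exists h y, gl G l h /\ L y /\ x = h ** y ^+ (b ^ k).
Proof.
move=> lL hb. have sl := gl_sub _ l. have glL : subset G (gl G l) L by apply: gl_min.
elim=> [|k IH] x Lx.
  exists gone, x; rewrite gmul_1l Nat.pow_0_r gpow1; split=> //. sone => //.
have [h [y [gh [Ly ->]]]] := IH x Lx. have [h' [y' [gh' [Ly' ->]]]] := hb y Ly.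
exists (h ** h' ^+ (b ^ k)), y'; split; first by smul => //; spow.
split=> //. rewrite gpow_mulM; first by apply: cL; [exact: glL | spow].
by rewrite mulA -gpow_mulA -Nat.pow_succ_r'.
Qed.
End Abelian.

Lemma finite_common_exponent L (P : nat -> Prop) : finset G L -> P 1 -> (forall a b, P a -> P b -> P (a * b)) ->
  (forall x, L x -> exists n, P n /\ x ^+ n = gone) -> exists n, P n /\ forall x, L x -> x ^+ n = gone.
Proof.
move=> fin P1 Pm h. have [l hl] := finset_list _ _ fin.
have : forall x, In x l -> exists n, P n /\ x ^+ n = gone by move=> x /hl /h.
have : forall x, L x -> In x l by move=> x /hl.
elim: l L {h fin hl} => [|a l IH] L hL hx; first by exists 1; split=> // x /hL.
have [n [Pn hn]] := IH (fun x => In x l) (fun x i => i) (fun x xl => hx x (or_intror xl)).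
have [m [Pm' em]] := hx a (or_introl eq_refl).
exists (m * n); split; first exact: Pm. move=> x /hL /= [<-|xl]; first exact: gpow_multiple.
rewrite Nat.mul_comm. apply: gpow_multiple. exact: hn.
Qed.

(** Coset representatives of [L^p] generate a finite abelian [p]-group [L]. Their number is the
    order, not the dimension, of [L[p]]; only finiteness of the rank is wanted here. *)
Lemma abelian_p_rank p t Z : nprime p -> locally_finite G -> subgroup G Z ->
  (forall x y, Z x -> Z y -> commute x y) -> (forall x, Z x -> tel G (eq p) x) ->
  idx_le G (trivial_set G) (omega Z p) t -> rank_le G Z t.
Proof.
move=> pp lf sZ cZ tZ idx L sL LZ fL.
have cL : forall x y, L x -> L y -> commute x y by move=> x y /LZ ? /LZ ?; apply: cZ.
have fin := lf L sL fL.
have i1 : idx_le G (trivial_set G) (omega L p) t.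
  by apply: idx_le_restrict idx; [exact: sub_triv | move=> x [/LZ]].
have [l [ll [lL cov]]] := idx_powers L sL cL p t fin i1.
exists l; split=> // x; split; last by apply: gl_min.
move=> Lx.
have [n [tn hn]] := finite_common_exponent L (tnum (eq p)) fin (tnum_1 _) (tnum_mul _) (fun x Lx => tZ x (LZ x Lx)).
have [k nk] := tnum_dvd_pow (eq p) p n tn ltac:(move=> q _ <-; exact: Nat.divide_refl).
have [|h [y [gh [Ly ->]]]] := frattini_gen L sL cL l p lL _ k x Lx.
  move=> z Lz. have [a [al [y [Ly ey]]]] := cov z Lz. exists a, y; split; first exact: gl_in.
  by split=> //; rewrite -ey mulVK.
by rewrite (gpow_divide _ _ _ _ nk (hn y Ly)) mul1r.
Qed.
End Counting.

Section InfiniteElementary.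
Variable p : nat.
Hypothesis pp : nprime p.

(* Let [Z] be the centre of [N] and [U / Z] an infinite elementary abelian subgroup of [N / Z]. The commutators of
   [U] lie in the finite group [Z[p]], so centralisers of finite subsets have finite index in [U] and one can choose
   infinitely many commuting elements of [U], distinct modulo [Z]. They generate an abelian group [B] with [B / B^p]
   infinite, so [B[p]] is infinite. *)
Lemma elementary_of_infinite_rank c : forall (G : Group) (N : gset G), locally_finite G -> normal G N ->
  (forall x, lcs G N c x -> x = gone) -> (forall x, N x -> tel G (eq p) x) ->
  (forall A, el_ab G p A -> subset G A N -> finset G A) -> finite_rank G N.
Proof.
elim: c => [|c IH] G N lf nN hc tN hA.
  exists 0 => L sL LN _. exists []; split=> // x; split.
    move=> /LN /hc ->. exact: (sub_1 _ _ (gl_sub _ [])).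
  by apply: (gl_min _ [] L).
have sN := normal_sub _ _ nN.
pose Z := inter G N (cent G N).
have ZN : subset G Z N by exact: inter_sub_l.
have nZ : normal G Z by apply: normal_inter => //; exact: cent_normal.
have sZ := normal_sub _ _ nZ.
have cZ : forall x y, Z x -> Z y -> commute x y by move=> x y [_ h] [Ny _]; apply: h.
have eOm : forall B, subgroup G B -> subset G B N -> (forall x y, B x -> B y -> commute x y) ->
   exists t, idx_le G (trivial_set G) (omega G B p) t.
  move=> B sB BN cB. have [l hl] := hA (omega G B p)
    (conj (omega_sub _ B sB cB p) (conj (fun x y hx hy => cB x y (proj1 hx) (proj1 hy)) (fun x hx => proj2 hx)))
    (fun x hx => BN x (proj1 hx)).
  exists (length l). apply: idx_of_cover; first exact: sub_triv. move=> h /hl hin. exists h; split=> //. exact: gmul_Vl.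
have [t ht] := eOm Z sZ ZN cZ.
have rZ := abelian_p_rank _ p t Z pp lf sZ cZ (fun x Zx => tN x (ZN x Zx)) ht.
have [Q [f [fM [fS fK]]]] := quotient_exists G Z nZ.
suff [r hr] : finite_rank Q (img G Q f N).
  exists (t + r). apply: (rank_le_extension G Q f) => //. apply: rank_le_mono rZ. by move=> x [/fK].
apply: IH => //.
- exact: img_locally_finite lf.
- exact: img_normal.
- move=> y; rewrite -img_lcs // => [[x [Lx <-]]]. apply/fK; split; first exact: lcs_in Lx.
  move=> n Nn. apply/commute_comm. apply: hc. exact: lcs_comm.
- move=> y [x [/tN [n [tn e]] <-]]. exists n; split=> //. by rewrite -hom_pow // e hom_1.
- move=> A [sA [cA eA]] AN. apply: NNPP => nfA.
pose U := inter G N (pre G Q f A).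
have sU : subgroup G U by apply: sub_inter => //; exact: pre_sub.
have ZU : subset G Z U.
  move=> z Zz; split; first exact: ZN. rewrite /pre. have -> : f z = gone by apply/fK. exact: sub_1.
have nfi : ~ finite_index_in G Z U.
  move=> fi. apply: nfA. apply: (finset_mono _ _ (img G Q f U)).
    move=> y Ay. have [x [Nx e]] := AN y Ay. exists x; split=> //; split=> //. by rewrite /pre e.
  apply: (img_finset _ _ _ fM Z) => // x. exact: (proj2 (fK x)).
have [zl hzl] : finset G (omega G Z p).
  by apply: finset_fi_triv; apply/idx_finite; exists t.
have comZ : forall u v, U u -> U v -> Z [~ u, v].
  move=> u v [_ Au] [_ Av]. apply/fK. rewrite hom_comm //. apply/commute_comm. exact: cA.
have powZ : forall u, U u -> Z (u ^+ p).
  move=> u [_ Au]. apply/fK. rewrite hom_pow //. exact: eA.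
have comO : forall u v, U u -> U v -> In [~ u, v] zl.
  move=> u v Uu Uv. apply: hzl; split; first exact: comZ.
  rewrite -comm_powl; first by apply: (proj2 (comZ u v Uu Uv)); case: Uu.
  apply/commute_comm. apply: (proj2 (powZ u Uu)); by case: Uv.
have hcent : forall l, (forall x, In x l -> U x) -> finite_index_in G (inter G U (cent G (fun x => In x l))) U /\
     subgroup G (inter G U (cent G (fun x => In x l))).
  have sC : forall l, subgroup G (inter G U (cent G (fun x => In x l))).
    by move=> l; apply: sub_inter => //; exact: cent_sub.
  elim=> [|a l IHl] lU; (split; last exact: sC).
    rewrite inter_eq; [by move=> x _ s [] | exact: fi_refl].
  have [fi _] := IHl (fun x xl => lU x (or_intror xl)).
  have Ua := lU a (or_introl eq_refl).
  have i1 : idx_le G (inter G U (cent G (fun x => In x [a]))) U (length zl).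
    apply: (idx_of_fun _ _ _ _ (fun u => [~ u, a])) => //; first by move=> u Uu; apply: comO.
    move=> u v Uu Uv e. have Uw : U (u^-1 ** v) by sdiv. split=> // x [<-|[]].
    apply/commute_comm.
    have E : [~ v, a] = ((u^-1 ** v)^-1 ** ([~ u, a] ** (u^-1 ** v))) ** [~ u^-1 ** v, a] by grp.
    have c1 := proj2 (comZ u a Uu Ua) _ (proj1 Uw).
    move: E; rewrite -e c1 mulKV -{1}(mul1r _ [~ u, a]) => /mul_cancel <- //.
  have f1 : finite_index_in G (inter G U (cent G (fun x => In x [a]))) U by apply/idx_finite; exists (length zl).
  apply: fi_mono (fi_inter _ _ _ _ (sC _) (sC _) (inter_sub_l _ _ _) f1 fi).
  move=> u [[Uu h1] [_ h2]]; split=> // x [<-|xl]; [apply: h1; by left | exact: h2].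
pose Inv (l : list G) := (forall x, In x l -> U x) /\ (forall x y, In x l -> In y l -> commute x y) /\ sep G Z l.
have [||s [s0 hs]] := dependent_choice (list G) Inv (fun _ l l' => exists a, l' = a :: l) [].
+ by split=> //; split=> //; constructor.
+ move=> _ l [lU [cl sl]]. have [fi sC] := hcent l lU.
  have [a [[Ua ca] na]] : exists a, inter G U (cent G (fun x => In x l)) a /\ forall x, In x l -> ~ Z (x^-1 ** a).
    apply: NNPP => no. apply: nfi. apply: (fi_trans _ _ _ _ sZ _ fi). apply/idx_finite; exists (length l).
    apply: idx_of_cover => // h Ch. apply: NNPP => no2. apply: no; exists h; split=> // x xl Zx. apply: no2. by exists x.
  exists (a :: l); split; last by exists a. split; first by move=> x /= [<-|/lU].
  split; last by constructor.
  move=> x y /= [<-|xl] [<-|yl] //; [exact: ca | apply: commute_sym; exact: ca | exact: cl].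
+ have len : forall k, length (s k) = k.
  by elim=> [|k IHk]; [rewrite s0 | have [_ [a ->]] := hs k; rewrite /= IHk].
have incl : forall i j, i <= j -> forall x, In x (s i) -> In x (s j).
  move=> i j; elim=> [|m _ IHm] // x /IHm xi. have [_ [a ->]] := hs m. by right.
pose B := generated G (fun x => exists k, In x (s k)).
have sB : subgroup G B by apply: gen_sub.
have BN : subset G B N.
  apply: gen_min => // x [k xk]. by have [[lU _] _] := hs k; case: (lU x xk).
have cB : forall x y, B x -> B y -> commute x y.
  apply: gen_commute => a b [i ai] [j bj]. have [[_ [cl _]] _] := hs (max i j).
  apply: cl; [apply: (incl i) => //; lia | apply: (incl j) => //; lia].
have [tb htb] := eOm B sB BN cB.
have [[lU [_ sl]] _] := hs (S tb).
pose L := gl G (s (S tb)).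
have LB : subset G L B by apply: gl_min => // x xl; apply: gen_incl; exists (S tb).
have sL : subgroup G L by exact: gl_sub.
have i1 : idx_le G (powers G L p) L tb.
  apply: idx_powers => //; first by move=> x y /LB ? /LB ?; apply: cB.
    by apply: lf => //; exact: gl_fg.
  by apply: idx_le_restrict htb; [exact: sub_triv | move=> x [/LB]].
(* [L^p] lies in [Z] because [U / Z] has exponent [p]; so [L] meets at most [tb] cosets of [Z],
   against [S tb] separated elements. *)
have i2 : idx_le G Z L tb.
  apply: idx_le_mono i1 => _ [x [Lx ->]]. apply: powZ. move: x Lx. exact: gl_min.
have := sep_length _ _ _ _ _ sZ sl _ i2. rewrite len => k.
suff : S tb <= tb by lia. apply: k => x. exact: gl_in.
Qed.
End InfiniteElementary.

(** * Subnormal subgroups of finite rank acting on nilpotent groups *)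

Section Centralizers.
Variable G : Group.
Implicit Types (x y z g : G) (A B C H K L M N S U X : gset G).

(** Left cosets of the centraliser of [a] correspond to the conjugates [x a x^-1], which dictates
    the side of the inverse. *)
Lemma fi_cent_finset X S : subgroup G X -> finset G S ->
  (forall x s, X x -> S s -> S (x ** (s ** x^-1))) -> finite_index_in G (inter G X (cent G S)) X.
Proof.
move=> sX /finset_list [l hl] inv.
have : subset G S (fun x => In x l) by move=> x /hl.
have lS : forall x, In x l -> S x by move=> x /hl.
move=> sub. suff H : forall l', (forall x, In x l' -> In x l) -> finite_index_in G (inter G X (cent G (fun x => In x l'))) X.
  apply: fi_mono (H l (fun _ h => h)). move=> x [Xx cx]; split=> //. exact: cent_anti cx.
have sC : forall l', subgroup G (inter G X (cent G (fun x => In x l'))) by move=> l'; apply: sub_inter => //; exact: cent_sub.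
elim=> [|a l' IH] inc.
  rewrite inter_eq; [by move=> x _ s [] | exact: fi_refl].
have fi := IH (fun x xl => inc x (or_intror xl)).
have Sa : S a by apply: lS; apply: inc; left.
have i1 : finite_index_in G (inter G X (cent G (fun x => In x [a]))) X.
  apply/idx_finite; exists (length l). apply: (idx_of_fun _ _ _ _ (fun x => x ** (a ** x^-1))) => //.
    by move=> x Xx; apply: sub; exact: inv.
  move=> x y Xx Xy e. split; first by sdiv. move=> s [<-|[]].
  rewrite /commute. have -> : x^-1 ** y ** a = x^-1 ** ((y ** (a ** y^-1)) ** y) by grp.
  rewrite -e. grp.
apply: fi_mono (fi_inter _ _ _ _ (sC _) (sC _) (inter_sub_l _ _ _) i1 fi).
move=> x [[Xx h1] [_ h2]]; split=> // s [<-|sl]; [apply: h1; by left | exact: h2].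
Qed.

(* If [X] centralises [L1] and [[L0, X] <= L1] with [L1] normal in [L0], then [x |-> [v, x]] takes values in the
   centre of [L1]; so the action of [X] on [L0] is abelian of exponent dividing that of [L1]. *)
Lemma fi_cent_step X L0 L1 m : subgroup G X -> finite_rank G X -> subgroup G L1 -> subgroup G L0 ->
  0 < m -> (forall x, L1 x -> x ^+ m = gone) -> subset G L1 L0 ->
  (forall l v, L1 l -> L0 v -> L1 (v^-1 ** (l ** v))) ->
  (forall v x, L0 v -> X x -> L1 [~ v, x]) ->
  subset G X (cent G L1) -> finite_index_in G (inter G X (cent G L0)) X.
Proof.
move=> sX rX s1 s0 m0 em L10 n1 h cX.
have sC := cent_sub G L0. have sI := sub_inter _ _ _ sX sC.
have fixed : forall x l, X x -> L1 l -> x^-1 ** (l ** x) = l.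
  by move=> x l Xx Ll; rewrite -(cX x Xx l Ll) mulKV.
have central : forall v x l, L0 v -> X x -> L1 l -> commute [~ v, x] l.
  move=> v x l Lv Xx Ll.
  have Ll' : L1 (v ** (l ** v^-1)).
    have := n1 l v^-1 Ll (sub_inv _ _ _ s0 Lv). by rewrite invK.
  have e1 := fixed x _ Xx (n1 _ v Ll' Lv).
  have e2 := fixed x _ Xx Ll'.
  have E : x^-1 ** (v^-1 ** ((v ** (l ** v^-1)) ** v) ** x) =
     (x^-1 ** (v^-1 ** x)) ** ((x^-1 ** (v ** (l ** v^-1) ** x)) ** (x^-1 ** (v ** x))) by grp.
  move: E; rewrite e2 e1.
  have -> : v^-1 ** (v ** (l ** v^-1) ** v) = l by grp.
  move=> E. rewrite /commute {1}E. grp.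
have comX : forall v x y, L0 v -> X x -> X y -> [~ v, x ** y] = [~ v, x] ** [~ v, y].
  move=> v x y Lv Xx Xy.
  have -> : [~ v, x ** y] = [~ v, y] ** (y^-1 ** ([~ v, x] ** y)) by grp.
  rewrite fixed //; first exact: h. apply: central => //. exact: h.
have powX : forall v x n, L0 v -> X x -> [~ v, x ^+ n] = [~ v, x] ^+ n.
  move=> v x; elim=> [|n IH] Lv Xx; first by rewrite /=; grp.
  rewrite !gpowS comX //; first by spow. by rewrite IH.
apply: (fin_index_of_rank _ _ _ m) => //; first exact: inter_sub_l.
  move=> x y Xx Xy; split; first by scomm. move=> v Lv. apply: commute_sym. apply/commute_comm.
  have Xc : X [~ x, y] by scomm.
  apply: (mul_cancel _ [~ v, y ** x]). rewrite -comX //; first by smul.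
  have -> : y ** x ** [~ x, y] = x ** y by grp.
  rewrite mul1r !comX //. apply: central => //. exact: h.
move=> x Xx; split; first by spow. move=> v Lv. apply: commute_sym. apply/commute_comm.
rewrite powX //. apply: em. exact: h.
Qed.

(** The lower central series of [M] cuts [X /\ M] into abelian sections of bounded exponent and
    finite rank, which are finite. *)
Lemma finset_of_bounded_nilpotent X M m : subgroup G X -> finite_rank G X -> subgroup G M -> nilpotent G M ->
  0 < m -> (forall x, M x -> x ^+ m = gone) -> finset G (inter G X M).
Proof.
move=> sX rX sM [c hc] m0 em.
have sI : forall i, subgroup G (inter G X (lcs G M i)) by move=> i; apply: sub_inter => //; exact: lcs_sub.
have H : forall i, finite_index_in G (inter G X (lcs G M i)) (inter G X M).
  { elim=> [|i IH]; first by apply: fi_refl; exact: sub_inter.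
  apply: fi_trans IH => //. apply: (fin_index_of_rank _ _ _ m) => //.
  - by move=> x [Xx /lcs_S Mx]; split=> //; exact: Mx.
  - move=> x y [Xx Lx] [Xy Ly]; split; first by scomm. apply: lcs_comm => //. exact: lcs_in Ly.
  - move=> x [Xx /lcs_in Mx]. rewrite em; first exact: Mx. exact: (sub_1 _ _ (sI (S i))).
  - apply: finite_rank_mono rX. exact: inter_sub_l. }
apply: (idx_finset _ _ _ _ _ (H c)) => //. exists [gone] => x [_ /hc ->]. by left.
Qed.

(** Climb the chain [s i] from [X] to [G], starting from the finite group [M /\ X]. Since [X <= s i]
    is normalised by [s (S i)], commutators of [M /\ s (S i)] with [X] fall into [M /\ s i], so
    [fi_cent_step] gains one term at a time. *)
Lemma fi_cent_bounded X M m : subnormal G X -> finite_rank G X -> normal G M -> nilpotent G M ->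
  0 < m -> (forall x, M x -> x ^+ m = gone) -> finite_index_in G (inter G X (cent G M)) X.
Proof.
move=> snX rX nM nilM m0 em. have sX := subnormal_sub _ _ snX. have sM := normal_sub _ _ nM.
case: snX => n [s [s0 [sn hs]]].
have ss : forall i, i <= n -> subgroup G (s i).
  move=> i le. case: (Nat.eq_dec i n) => [->|ne]; first by rewrite sn; exact: sub_full.
  by case: (hs i ltac:(lia)).
have Xs : forall i, i <= n -> subset G X (s i).
  elim=> [|i IH] le; first by rewrite s0. move=> x /(IH ltac:(lia)). by have [_ [_ [h _]]] := hs i le; apply: h.
have H : forall i, i <= n -> finite_index_in G (inter G X (cent G (inter G M (s i)))) X.
  { elim=> [|i IH] le.
    rewrite s0. apply: fi_cent_finset => //.
      rewrite interC. exact: finset_of_bounded_nilpotent nilM m0 em.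
    move=> x y Xx [My Xy]; split; last by smul => //; smul => //; sinv.
    have := normal_conj _ _ _ x^-1 nM My. by rewrite invK.
  have fi := IH ltac:(lia).
  have [si [si' [inc nrm]]] := hs i le.
  set X1 := inter G X (cent G (inter G M (s i))) in fi.
  have sX1 : subgroup G X1 by apply: sub_inter => //; exact: cent_sub.
  have f2 : finite_index_in G (inter G X1 (cent G (inter G M (s (S i))))) X1.
  { apply: (fi_cent_step _ _ (inter G M (s i)) m) => //; try exact: sub_inter.
    - apply: finite_rank_mono rX. exact: inter_sub_l.
    - by move=> x [Mx _]; apply: em.
    - by move=> x [Mx /inc]; split.
    - by move=> l v [Ml sl] [Mv sv]; split; [exact: normal_conj | exact: nrm].
    - move=> v x [Mv sv] [Xx _]; split; first exact: normal_comml.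
      have -> : [~ v, x] = (v^-1 ** (x^-1 ** v)) ** x by grp.
      have sx := Xs i ltac:(lia) x Xx. smul => //. apply: nrm => //. by sinv.
    - exact: inter_sub_r. }
  apply: fi_mono (fi_trans _ _ _ _ _ f2 fi); last first.
    by apply: sub_inter => //; exact: cent_sub.
  by move=> x [[Xx _] cx]. }
have := H n (le_n _). rewrite sn. by have -> : inter G M fullset = M by apply: inter_eq.
Qed.

Lemma el_ab_finite_rank p A : 0 < p -> el_ab G p A -> finite_rank G A -> finset G A.
Proof.
move=> p0 [sA [cA eA]] rA. have sT := sub_triv G.
have fi : finite_index_in G (trivial_set G) A.
  apply: (fin_index_of_rank _ _ _ p) => //.
    by move=> x ->; sone.
  move=> x y Ax Ay. apply/commute_comm. exact: cA.
exact: finset_fi_triv fi.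
Qed.

Lemma gl_el_ab_finset p A (l : list G) : 0 < p -> el_ab G p A -> (forall x, In x l -> A x) -> finset G (gl G l).
Proof.
move=> p0 [sA [cA eA]] lA. have sT := sub_triv G.
have [|||||U [sU [_ [_ [lU idx]]]]] := adjoin_list _ A (trivial_set G) p l sA sT.
- by move=> x ->; sone.
- move=> x y Ax Ay. apply/commute_comm. exact: cA.
- exact: lA.
- exact: p0.
- by move=> x /lA /eA.
- apply: (finset_mono _ _ U); first exact: gl_min.
  apply: finset_fi_triv. apply/idx_finite. by eexists; exact: idx.
Qed.

(** A common element has the form [a^i h] with [h] in [<u>], so [a^i] is in [<u, w>]. If [p] does
    not divide [i], so is [a]; otherwise [a^i] is trivial and the element is already in [<u>]. *)
Lemma gl_cons_disjoint p A (a : G) (u w : list G) : nprime p -> el_ab G p A ->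
  A a -> (forall x, In x u -> A x) -> (forall x, In x w -> A x) ->
  (forall x, gl G u x -> gl G w x -> x = gone) -> ~ gl G (u ++ w) a ->
  forall x, gl G (a :: u) x -> gl G w x -> x = gone.
Proof.
move=> pp [sA [cA eA]] Aa uA wA dis na.
have p1 : 1 < p by case: pp.
have su := gl_sub _ u. have sw := gl_sub _ w. have suw := gl_sub _ (u ++ w).
have guA : subset G (gl G u) A by apply: gl_min.
have adj : subset G (gl G (a :: u)) (adjoin G (gl G u) a).
  have s : subgroup G (adjoin G (gl G u) a).
    apply: (adjoin_subgroup _ _ _ p) => //; last by rewrite eA //; apply: (sub_1 _ _ su).
      move=> v gv. have -> : a^-1 ** (v ** a) = v by rewrite (cA v a) ?mulKV //; exact: guA. exact: gv.
    lia.
  apply: gl_min => // x [<-|xu]; [exact: adjoin_in | apply: adjoin_incl; exact: gl_in].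
move=> x /adj [i hi] wx.
have m1 : subset G (gl G u) (gl G (u ++ w)) by exact: gl_appl.
have m2 : subset G (gl G w) (gl G (u ++ w)) by exact: gl_appr.
have ai : gl G (u ++ w) (a ^+ i).
  rewrite -(invK _ (a ^+ i)). sinv => //. apply: (sub_mull _ _ _ x suw (m2 _ wx)). exact: m1.
case: (prime_gcd p i pp) => [[k ek]|g].
  apply: dis => //. move: hi. rewrite ek Nat.mul_comm gpow_multiple; first exact: eA. by rewrite inv1 gmul_1l.
exfalso; apply: na.
case: (Nat.eq_dec i 0) => [i0|i0]; first by move: g; rewrite i0 Nat.gcd_0_r; lia.
have [k ->] := coprime_root _ a i p ltac:(by rewrite Nat.gcd_comm) i0 (eA a Aa). by spow.
Qed.

(** Two lists grow alternately, each time by an element of [A] outside the finite group generated so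
    far; [A1] and [A2] are the unions of the generated chains. *)
Lemma infinite_split p A : nprime p -> el_ab G p A -> ~ finset G A ->
  exists A1 A2, (subgroup G A1 /\ subset G A1 A /\ ~ finset G A1) /\
    (subgroup G A2 /\ subset G A2 A /\ ~ finset G A2) /\ forall x, A1 x -> A2 x -> x = gone.
Proof.
move=> pp eA nf. have p0 : 0 < p by case: pp; lia.
have ex : forall l, (forall x, In x l -> A x) -> exists a, A a /\ ~ gl G l a.
  move=> l lA. apply: NNPP => no. apply: nf. apply: finset_mono (gl_el_ab_finset p A l p0 eA lA).
  move=> a Aa. apply: NNPP => na; apply: no; by exists a.
pose Inv (s : list G * list G) := (forall x, In x (fst s) -> A x) /\ (forall x, In x (snd s) -> A x) /\
  NoDup (fst s) /\ NoDup (snd s) /\ (forall x, gl G (fst s) x -> gl G (snd s) x -> x = gone).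
have [||f [f0 hf]] := dependent_choice _ Inv (fun _ s s' => exists a b, s' = (a :: fst s, b :: snd s)) ([], []).
- split=> //; split=> //; split; first by constructor. split; first by constructor.
  by move=> x /= h _; move: h; apply: (gl_min _ [] (trivial_set G) (sub_triv G)).
- move=> _ [u w] [/= uA [wA [nu [nw dis]]]].
  have [a [Aa na]] := ex (u ++ w) ltac:(move=> x /in_app_iff [/uA|/wA] //).
  have [b [Ab nb]] := ex (w ++ (a :: u)) ltac:(move=> x /in_app_iff [/wA //|[<- //|/uA //]]).
  have d1 := gl_cons_disjoint p A a u w pp eA Aa uA wA dis na.
  have uA' : forall x, In x (a :: u) -> A x by move=> x [<- //|/uA].
  have d2 := gl_cons_disjoint p A b w (a :: u) pp eA Ab wA uA' (fun x h1 h2 => d1 x h2 h1) nb.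
  exists (a :: u, b :: w); split; last by exists a, b.
  split=> //; split=> /=; first by move=> x [<- //|/wA].
  split; first by constructor=> // au; apply: na; apply: gl_in; apply/in_app_iff; left.
  split; first by constructor=> // bw; apply: nb; apply: gl_in; apply/in_app_iff; left.
  by move=> x h1 h2; apply: d2.
- have mono1 : forall i j, i <= j -> forall x, In x (fst (f i)) -> In x (fst (f j)).
    move=> i j; elim=> [|m _ IH] // x /IH h. have [_ [a [b ->]]] := hf m. by right.
  have mono2 : forall i j, i <= j -> forall x, In x (snd (f i)) -> In x (snd (f j)).
    move=> i j; elim=> [|m _ IH] // x /IH h. have [_ [a [b ->]]] := hf m. by right.
  have len : forall k, length (fst (f k)) = k /\ length (snd (f k)) = k.
    elim=> [|k [h1 h2]]; first by rewrite f0. have [_ [a [b ->]]] := hf k. by rewrite /= h1 h2.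
  have gen (h : list G * list G -> list G) :
    (forall i j, i <= j -> forall x, In x (h (f i)) -> In x (h (f j))) ->
    (forall k, length (h (f k)) = k) -> (forall k, NoDup (h (f k))) -> (forall k x, In x (h (f k)) -> A x) ->
    exists A1, (subgroup G A1 /\ subset G A1 A /\ ~ finset G A1) /\ forall x, A1 x -> exists k, forall j, k <= j -> gl G (h (f j)) x.
    move=> mono ln nd inA.
    have gm : forall i j, i <= j -> subset G (gl G (h (f i))) (gl G (h (f j))).
      move=> i j le; apply: gl_min; first exact: gl_sub. move=> x xi; apply: gl_in; exact: (mono i).
    exists (fun x => exists k, forall j, k <= j -> gl G (h (f j)) x); split=> //; split.
      split; first by exists 0 => j _; apply: (sub_1 _ _ (gl_sub _ _)).
      split=> [x y [i hi] [k hk]|x [i hi]].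
        exists (max i k) => j le. apply: (sub_mul _ _ _ _ (gl_sub _ _)); [apply: hi; lia | apply: hk; lia].
      exists i => j le. apply: (sub_inv _ _ _ (gl_sub _ _)). exact: hi.
    split.
      move=> x [k hk]. move: (hk k (le_n _)). apply: gl_min; [by case: eA | exact: inA].
    case=> l hl. have inc : incl (h (f (S (length l)))) l.
      move=> x xk. apply: hl. exists (S (length l)) => j le. apply: (gm _ _ le). exact: gl_in.
    have := NoDup_incl_length (nd _) inc. rewrite ln. lia.
  have [A1 [h1 g1]] := gen fst mono1 (fun k => proj1 (len k)) (fun k => proj1 (proj2 (proj2 (proj1 (hf k))))) (fun k => proj1 (proj1 (hf k))).
  have [A2 [h2 g2]] := gen snd mono2 (fun k => proj2 (len k)) (fun k => proj1 (proj2 (proj2 (proj2 (proj1 (hf k)))))) (fun k => proj1 (proj2 (proj1 (hf k)))).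
  exists A1, A2; split=> //; split=> // x /g1 [i hi] /g2 [k hk].
  have [[_ [_ [_ [_ d]]]] _] := hf (max i k). apply: d; [apply: hi; lia | apply: hk; lia].
Qed.

Definition infinite_rank_cn := forall H, subnormal G H -> infinite_rank G H -> cn G H.

Lemma cn_of_infinite_p_rank p N X : nprime p -> locally_finite G -> infinite_rank_cn ->
  normal G N -> nilpotent G N -> (forall x, N x -> tel G (eq p) x) -> infinite_rank G N ->
  subnormal G X -> finite_rank G X -> cn G X.
Proof.
move=> pp lf hyp nN [c hc] tN infN snX rX. have p0 : 0 < p by case: pp; lia.
have sN := normal_sub _ _ nN. have sX := subnormal_sub _ _ snX.
have [A [eA [AN nfA]]] : exists A, el_ab G p A /\ subset G A N /\ ~ finset G A.
  apply: NNPP => no. apply: infN. apply: (elementary_of_infinite_rank p pp c) => // A eA AN.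
  apply: NNPP => nf. apply: no. by exists A.
pose S0 : gset G := fun x => N x /\ x ^+ p = gone.
pose M := generated G S0.
have MN : subset G M N by apply: gen_min => // x [].
have nM : normal G M.
  apply: normal_gen => x g [Nx ex]; apply: gen_incl; split; first exact: normal_conj.
  rewrite gpow_conj ex. grp.
have sM := normal_sub _ _ nM.
have nilM : nilpotent G M by exists c => x /(lcs_mono _ _ _ _ MN) /hc.
have step := lcs_factor_torsion G (eq p) S0 p eq_refl
  ltac:(move=> a b <- <-; exists p; split=> //; split; exact: Nat.divide_refl) nM
  (fun s h => ex_intro _ p (conj eq_refl (proj2 h))).
(* The generators have order dividing [p], so each lower central factor of [M] has exponent dividing
   [p]. *)
have em : forall x, M x -> x ^+ (p ^ c) = gone.
  move=> x Mx. have H : forall i, lcs G M i (x ^+ (p ^ i)).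
    elim=> [|i IH]; first by rewrite Nat.pow_0_r gpow1.
    have [n [<- h]] := step i _ IH. by rewrite Nat.pow_succ_r' Nat.mul_comm gpow_mulA.
  apply: hc. apply: lcs_mono (H c). exact: MN.
have m0 : 0 < p ^ c by have := Nat.pow_nonzero p c; lia.
have AM : subset G A M.
  move=> x Ax; apply: gen_incl; split; first exact: AN. by case: eA => _ [_]; apply.
pose X0 := inter G X (cent G M).
have sX0 : subgroup G X0 by apply: sub_inter => //; exact: cent_sub.
have fX0 : finite_index_in G X0 X by apply: (fi_cent_bounded X M (p ^ c)).
have snX0 : subnormal G X0.
  apply: subnormal_step snX. split=> //; split=> //; split; first exact: inter_sub_l.
  move=> k h Xk [Xh ch]; split; first by sdiv => //; smul.
  exact: (normal_conj _ _ _ _ (cent_normal _ _ nM)).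
have finXM := finset_of_bounded_nilpotent X M (p ^ c) sX rX sM nilM m0 em.
apply: (cn_commens _ _ X0) => //; first by apply: commens_sym; apply: commens_fi => //; exact: inter_sub_l.
have [A1 [A2 [[s1 [A1A nf1]] [[s2 [A2A nf2]] dis]]]] := infinite_split p A pp eA nfA.
have cXM : forall x m, X0 x -> M m -> commute x m by move=> x m [_ cx]; exact: cx.
(* [B] is not known to be normal in [G]; the product is subnormal because [X0] centralises the
   nilpotent group [M]. *)
have good : forall B, subgroup G B -> subset G B A -> ~ finset G B -> subgroup G (prd G X0 B) /\ cn G (prd G X0 B).
  move=> B sB BA nfB.
  have sn : subnormal G (prd G X0 B).
    by apply: (prd_central_subnormal _ _ M) => // x /BA /AM.
  split; first exact: subnormal_sub. apply: hyp => // fr. apply: nfB.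
  apply: (el_ab_finite_rank p) => //.
    by case: eA => _ [cA eA]; split=> //; split=> [x y /BA ? /BA ?|x /BA]; [exact: cA | exact: eA].
  apply: finite_rank_mono fr. exact: prd_r.
have [sp1 cn1] := good A1 s1 A1A nf1. have [sp2 cn2] := good A2 s2 A2A nf2.
have cn12 := cn_inter _ _ _ sp1 sp2 cn1 cn2.
apply: cn_commens cn12 => //; first exact: sub_inter.
apply: commens_fi => //; first by move=> x Xx; split; apply: prd_l.
have [l hl] := finXM.
apply/idx_finite; exists (length l).
(* For [g = x1 a1 = x2 a2] take [x1^-1 x2 = a1 a2^-1], an element of the finite group [X /\ M]. It
   determines [a1] since [A1 /\ A2] is trivial, and [a1] determines the coset of [g] modulo [X0]. *)
pose fc g := epsilon (inhabits gone) (fun x => exists x1 a1 a2, X0 x1 /\ A1 a1 /\ A2 a2 /\ g = x1 ** a1 /\ a1 = x ** a2 /\ X0 x).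
have hfc : forall g, inter G (prd G X0 A1) (prd G X0 A2) g -> exists x1 a1 a2, X0 x1 /\ A1 a1 /\ A2 a2 /\ g = x1 ** a1 /\ a1 = fc g ** a2 /\ X0 (fc g).
  move=> g [[x1 [a1 [Xx1 [Aa1 e1]]]] [x2 [a2 [Xx2 [Aa2 e2]]]]].
  apply: (epsilon_spec (inhabits gone) (fun x => exists x1 a1 a2, X0 x1 /\ A1 a1 /\ A2 a2 /\ g = x1 ** a1 /\ a1 = x ** a2 /\ X0 x)).
  exists (x1^-1 ** x2), x1, a1, a2; split=> //; split=> //; split=> //; split=> //; split; last by sdiv.
  by rewrite mulA -e2 e1 mulKV.
apply: (idx_of_fun _ _ _ _ fc) => //.
  move=> g /hfc [x1 [a1 [a2 [Xx1 [Aa1 [Aa2 [e1 [e2 Xf]]]]]]]]. apply: hl; split; first by case: Xf.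
  have : M a1 by apply: AM; apply: A1A. rewrite e2. apply: sub_mull => //. apply: AM; exact: A2A.
move=> g h /hfc [x1 [a1 [a2 [Xx1 [Aa1 [Aa2 [e1 [e2 Xf]]]]]]]] /hfc [y1 [b1 [b2 [Xy1 [Ab1 [Ab2 [d1 [d2 Xd]]]]]]]] E.
have ab : a1^-1 ** b1 = a2^-1 ** b2 by rewrite d2 e2 E; grp.
have : a1^-1 ** b1 = gone by apply: dis; [by sdiv | rewrite ab; by sdiv].
move=> /eq_of_div ee. rewrite e1 d1 -ee.
have -> : (x1 ** a1)^-1 ** (y1 ** a1) = a1^-1 ** ((x1^-1 ** y1) ** a1) by grp.
have Xxy : X0 (x1^-1 ** y1) by sdiv.
rewrite (cXM _ a1 Xxy); first by apply: AM; apply: A1A. by rewrite mulKV.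
Qed.
End Centralizers.

(** * Normal nilpotent subgroups of infinite rank *)

Section NilpotentInfiniteRank.
Variable G : Group.
Implicit Types (x y z g : G) (A B C H K L M N S U X : gset G).

Lemma cn_of_prd X A B tau sigma : subgroup G X -> disjoint tau sigma ->
  normal G A -> normal G B -> (forall x, A x -> tel G tau x) -> (forall x, B x -> tel G sigma x) ->
  cn G (prd G X A) -> cn G (prd G X B) -> cn G X.
Proof.
move=> sX dj nA nB tA tB cA cB. rewrite -(prd_coprime_inter G X A B tau sigma) //.
apply: cn_inter => //; exact: prd_n_sub.
Qed.

Lemma infinite_rank_mono H K : subset G H K -> infinite_rank G H -> infinite_rank G K.
Proof. by move=> HK i f; apply: i; apply: finite_rank_mono f. Qed.

Lemma cn_of_infinite_nilpotent N X : locally_finite G -> periodic G -> infinite_rank_cn G ->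
  normal G N -> nilpotent G N -> infinite_rank G N -> subnormal G X -> cn G X.
Proof.
move=> lf per hyp nN nilN infN snX. have sN := normal_sub _ _ nN.
case: (classic (finite_rank G X)) => [rX|iX]; last exact: hyp.
have nP := fun tau => part_normal G N tau nN nilN.
have sP := fun tau => normal_sub _ _ (nP tau).
case: (classic (exists p, nprime p /\ infinite_rank G (part G N (eq p)))) => [[p [pp ip]]|no].
  apply: (cn_of_infinite_p_rank G p (part G N (eq p))) => //.
    by apply: nilpotent_mono nilN => x [].
  by move=> x [].
have pmono : forall tau sigma, (forall p, nprime p -> tau p -> sigma p) -> subset G (part G N tau) (part G N sigma).
  move=> tau sigma h x [Nx tx]; split=> //. exact: tel_mono tx.
have low : forall m, finite_rank G (part G N (fun p => p < m)).
  elim=> [|m [r IH]].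
    exists 0 => L sL LN _. exists []; split=> // x; split; last by apply: (gl_min _ [] L).
    move=> /LN [_ tx]. have -> : x = gone by apply: (tel_disjoint _ _ _ x _ tx tx) => p _ h; lia.
    exact: (sub_1 _ _ (gl_sub _ [])).
  case: (classic (nprime m)) => pm; last first.
    exists r. apply: rank_le_mono IH. apply: pmono => p pp le.
    case: (Nat.eq_dec p m) => [e|]; [by rewrite e in pp | lia].
  have [s hs] : finite_rank G (part G N (eq m)) by apply: NNPP => n; apply: no; exists m.
  exists (r + s). apply: rank_le_mono (rank_le_part_union G N _ _ r s lf per nN nilN IH hs).
  apply: pmono => p pp le. lia.
have high : forall m, infinite_rank G (part G N (fun p => m <= p)).
  move=> m [s hs]. have [r hr] := low m. apply: infN. exists (r + s).
  apply: rank_le_mono (rank_le_part_union G N _ _ r s lf per nN nilN hr hs).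
  move=> x Nx; split=> //. have [n [n0 e]] := per x. exists n; split=> //; split=> // p _ _. lia.
(* A finitely generated subgroup involves finitely many primes, so if all these blocks had rank at
   most [k], the whole part above [m] would. *)
have block : forall m k, exists m', m < m' /\ ~ rank_le G (part G N (fun p => m <= p < m')) k.
  move=> m k. apply: NNPP => nb. apply: (high m). exists k => L sL LN [l /generated_by_eq hl].
  have [b hb] : exists b, forall x, In x l -> tel G (fun p => m <= p < b) x.
    have : forall x, In x l -> tel G (fun p => m <= p) x by move=> x /gl_in; rewrite -hl => /LN [].
    elim: l {hl} => [|a l IH] h; first by exists 0.
    have [b hb] := IH (fun x xl => h x (or_intror xl)).
    have [n [[n0 tn] e]] := h a (or_introl eq_refl).
    exists (b + S n) => x [<-|/hb]; last by apply: tel_mono => p _; lia.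
    exists n; split=> //; split=> // p pp pn. have := tn p pp pn. have := Nat.divide_pos_le p n n0 pn. lia.
  apply: NNPP => nl. apply: nb. exists (m + S b); split; first lia. move=> rk. apply: nl.
  apply: rk => //; last by rewrite hl; exact: gl_fg.
  rewrite hl. apply: gl_min => // x xl; split.
    have /gl_in : In x l by []. rewrite -hl => /LN [] //.
  apply: tel_mono (hb x xl) => p _; lia.
have [||m [_ hm]] := dependent_choice nat (fun _ => True)
  (fun k m m' => m < m' /\ ~ rank_le G (part G N (fun p => m <= p < m')) k) 0.
- by [].
- by move=> k s _; have [m' h] := block s k; exists m'.
- have mm : forall i j, i <= j -> m i <= m j.
    move=> i j; elim=> [|n _ IH] //. have [_ [lt _]] := hm n. lia.
  (* Block [k] has rank above [k]; the even blocks form [pi] and the odd ones lie in its complement,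
     so both parts have infinite rank. *)
  pose pi p := exists k, m (2 * k) <= p < m (S (2 * k)).
  have inf1 : infinite_rank G (part G N pi).
    move=> [r hr]. have [_ [_ nr]] := hm (2 * r). apply: nr.
    apply: (rank_le_leq _ _ r); first lia. apply: rank_le_mono hr. apply: pmono => p _ h. by exists r.
  have inf2 : infinite_rank G (part G N (compl pi)).
    move=> [r hr]. have [_ [_ nr]] := hm (S (2 * r)). apply: nr.
    apply: (rank_le_leq _ _ r); first lia. apply: rank_le_mono hr. apply: pmono => p _ h [k hk].
    case: (le_lt_dec k r) => kr; [have := mm (S (2 * k)) (S (2 * r)) ltac:(lia) | have := mm (S (S (2 * r))) (2 * k) ltac:(lia)]; lia.
  have sX := subnormal_sub _ _ snX.
  apply: (cn_of_prd X (part G N pi) (part G N (compl pi)) pi (compl pi)) => //; try exact: disjoint_compl; try exact: nP; try by move=> x [].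
  + apply: hyp; first exact: prd_subnormal. apply: infinite_rank_mono inf1. exact: prd_r.
  + apply: hyp; first exact: prd_subnormal. apply: infinite_rank_mono inf2. exact: prd_r.
Qed.
End NilpotentInfiniteRank.

(** * Rank of abelian torsion groups *)

Section AbelianGenerators.
Variable G : Group.
Implicit Types (x y z g : G) (A B C H K L M N S U X : gset G).

Lemma sep_powers U x q : nprime q -> subgroup G U -> U (x ^+ q) -> ~ U x ->
  sep G U (map (gpow G x) (rev (seq 0 q))).
Proof.
move=> qp sU Uq nU. have : q <= q by []. elim: {1 3}q => [|n IH] le; first by constructor.
rewrite seq_S rev_app_distr /=. constructor; last by apply: IH; lia.
move=> y /in_map_iff [i [<- hi]] Ki. have ii := proj1 (in_seq _ _ _) (proj2 (in_rev _ _) hi).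
have {}Ki : U (x ^+ (n - i)).
  move: Ki. have {1}-> : n = i + (n - i) by lia. by rewrite gpow_add mulKV.
apply: nU. have g := prime_gcd_lt q (n - i) qp ltac:(lia).
have [a [b E]] := Nat.gcd_bezout_pos q (n - i) ltac:(lia). rewrite g in E.
have : U (x ^+ (a * q)) by rewrite Nat.mul_comm gpow_mulA; spow.
rewrite E gpow_add gpow1 Nat.mul_comm gpow_mulA => h. apply: (sub_mull _ _ _ _ sU _ h). by spow.
Qed.

Section Lattice.
Variables (L : gset G) (sL : subgroup G L) (cL : forall x y, L x -> L y -> commute x y).

Definition span_mod (l : list G) q : gset G := fun v => exists h y, gl G l h /\ L y /\ v = h ** y ^+ q.

Lemma span_mod_sub l q : (forall x, In x l -> L x) -> subgroup G (span_mod l q).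
Proof.
move=> lL. have sl := gl_sub _ l. have glL : subset G (gl G l) L by apply: gl_min.
split; first by exists gone, gone; rewrite gpow_one gmul_1l; split; [sone | split=> //; sone].
split.
  move=> _ _ [h [y [gh [Ly ->]]]] [h' [y' [gh' [Ly' ->]]]].
  exists (h ** h'), (y ** y'); split; first by smul. split; first by smul.
  rewrite gpow_mulM; first exact: cL.
  rewrite !mulA -(mulA _ (y ^+ q)) (cL (y ^+ q) h'); [by spow | exact: glL | by rewrite !mulA].
move=> _ [h [y [gh [Ly ->]]]]. exists h^-1, y^-1; split; first by sinv. split; first by sinv.
rewrite invM -gpow_inv. apply: cL; [by spow => //; sinv | by sinv => //; exact: glL].
Qed.
Lemma span_mod_mono l l' q : subset G (gl G l) (gl G l') -> subset G (span_mod l q) (span_mod l' q).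
Proof. by move=> ll' v [h [y [/ll' gh [Ly ->]]]]; exists h, y. Qed.
Lemma span_mod_gl l q : subset G (gl G l) (span_mod l q).
Proof. move=> h gh; exists h, gone; split=> //; split; [by sone | by rewrite gpow_one mul1r]. Qed.
Lemma span_mod_pow l q y : L y -> span_mod l q (y ^+ q).
Proof. move=> Ly; exists gone, y; split; [exact: (sub_1 _ _ (gl_sub _ l)) | by rewrite gmul_1l]. Qed.

(** [L / L^q] is a vector space over the field of [q] elements: a vector [x] outside [U] multiplies
    the number of known cosets by [q]. *)
Lemma basis_step q (l s : list G) U x : nprime q -> subgroup G U -> subset G (powers G L q) U -> subset G U L ->
  (forall y, In y l -> L y) -> subset G U (span_mod l q) -> sep G (powers G L q) s -> (forall y, In y s -> U y) ->
  L x -> ~ U x ->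
  exists s' U', subgroup G U' /\ subset G (powers G L q) U' /\ subset G U' L /\
    subset G U' (span_mod (x :: l) q) /\ sep G (powers G L q) s' /\ (forall y, In y s' -> U' y) /\
    length s' = q * length s.
Proof.
move=> qp sU CU UL lL Ul ss sUin Lx nUx.
have q0 : 0 < q by case: qp; lia.
have Uq : U (x ^+ q) by apply: CU; exists x.
have sA : subgroup G (adjoin G U x).
  apply: (adjoin_subgroup _ _ _ q) => // v Uv. by rewrite (cL v x) ?mulKV //; exact: UL.
exists (map (fun p => fst p ** snd p) (list_prod (map (gpow G x) (rev (seq 0 q))) s)), (adjoin G U x).
have lL' : forall y, In y (x :: l) -> L y by move=> y [<- //|/lL].
have sS := span_mod_sub (x :: l) q lL'.
split=> //; split; first by move=> y /CU; exact: adjoin_incl.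
split; first exact: adjoin_sub.
split.
  apply: adjoin_sub => //.
    move=> y /Ul. apply: span_mod_mono. apply: gl_min; first exact: gl_sub.
    by move=> z zl; apply: gl_in; right.
  apply: span_mod_gl. apply: gl_in; by left.
split; first by apply: (sep_prod _ _ U) => //; exact: sep_powers.
split; last by rewrite length_map length_prod length_map length_rev length_seq.
move=> y /in_map_iff [[a b] [<- /in_prod_iff [/in_map_iff [i [<- _]] /sUin Ub]]] /=.
apply: (sub_mul _ _ _ _ sA); last exact: adjoin_incl. apply: (sub_pow _ _ _ _ sA). exact: adjoin_in.
Qed.

Lemma generators_mod_prime q n : nprime q -> idx_le G (powers G L q) L (q ^ n) ->
  exists l, length l = n /\ (forall x, In x l -> L x) /\ subset G L (span_mod l q).
Proof.
move=> qp idx. have sP := powers_sub G L sL cL q.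
have H : forall k, exists l s U, length l <= k /\ (forall y, In y l -> L y) /\ subgroup G U /\ subset G (powers G L q) U /\
  subset G U L /\ subset G U (span_mod l q) /\
  (subset G L U \/ (sep G (powers G L q) s /\ (forall y, In y s -> U y) /\ length s = q ^ k)).
  elim=> [|k [l [s [U [ll [lL [sU [CU [UL [Ul alt]]]]]]]]]].
    exists [], [gone], (powers G L q). do 4 (split=> //).
    split; first exact: powers_in. split; first by move=> _ [y [Ly ->]]; exact: span_mod_pow.
    right; split; first by constructor=> //; constructor.
    split=> // y [<-|[]]; exact: (sub_1 _ _ sP).
  case: (classic (subset G L U)) => LU.
    exists l, s, U; split; first lia. do 5 (split=> //). by left.
  case: alt => [//|[ss [sin ls]]].
  have [x [Lx nx]] : exists x, L x /\ ~ U x.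
    apply: NNPP => no; apply: LU => x Lx; apply: NNPP => nx; apply: no; by exists x.
  have [s' [U' [sU' [CU' [UL' [Ul' [ss' [sin' ls']]]]]]]] := basis_step q l s U x qp sU CU UL lL Ul ss sin Lx nx.
  exists (x :: l), s', U'; split; first by rewrite /=; lia.
  split; first by move=> y [<- //|/lL]. do 4 (split=> //). right; split=> //; split=> //. by rewrite ls' ls.
have [l [s [U [ll [lL [sU [CU [UL [Ul alt]]]]]]]]] := H n.
have LU : subset G L U.
  case: alt => [//|[ss [sin ls]]]. move=> x Lx; apply: NNPP => nx.
  have [s' [U' [sU' [CU' [UL' [Ul' [ss' [sin' ls']]]]]]]] := basis_step q l s U x qp sU CU UL lL Ul ss sin Lx nx.
  have := sep_length _ _ L _ _ sP ss' (fun y h => UL' y (sin' y h)) idx.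
  rewrite ls' ls. have := Nat.pow_nonzero q n. case: qp => q1 _. nia.
(* Padding to length exactly [n] lets the lists for different primes be merged entrywise. *)
exists (l ++ repeat gone (n - length l)); split; first by rewrite length_app repeat_length; lia.
split; first by move=> x /in_app_iff [/lL //|/(repeat_spec _ _ _) ->]; sone.
move=> x /LU /Ul. apply: span_mod_mono. apply: gl_min; first exact: gl_sub.
move=> z zl; apply: gl_in; apply/in_app_iff; by left.
Qed.

Definition list_mul (l : list nat) := fold_right Nat.mul 1 l.
Lemma list_mul_dvd (l : list nat) q : In q l -> Nat.divide q (list_mul l).
Proof.
elim: l => [|a l IH] //= [->|/IH [k ->]]; [by exists (list_mul l); lia | by exists (a * k); lia].
Qed.
Lemma prime_dvd_list_mul (l : list nat) q : nprime q -> (forall p, In p l -> nprime p) ->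
  Nat.divide q (list_mul l) -> In q l.
Proof.
move=> qp; elim: l => [|a l IH] h /=; first by move=> /Nat.divide_1_r e; case: qp; lia.
move=> /(euclid _ _ _ qp) [/(prime_dvd_prime _ _ qp (h a (or_introl eq_refl))) ->|d]; first by left.
by right; apply: IH => // p pl; apply: h; right.
Qed.

(* Lists for different primes are merged entrywise, with exponents chosen by the Chinese remainder theorem. *)
Lemma generators_mod_primes n (qs : list nat) : NoDup qs ->
  (forall q, In q qs -> nprime q /\ idx_le G (powers G L q) L (q ^ n)) ->
  exists l, length l = n /\ (forall x, In x l -> L x) /\ forall q, In q qs -> subset G L (span_mod l q).
Proof.
elim: qs => [|q0 qs IH] nd hq.
  exists (repeat gone n); split; first exact: repeat_length.
  by split=> // x /(repeat_spec _ _ _) ->; sone.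
inversion nd as [|a b nin nd' [ea eb]]; subst a b.
have [l1 [e1 [l1L h1]]] := IH nd' (fun q ql => hq q (or_intror ql)).
have [qp idx] := hq q0 (or_introl eq_refl).
have [l2 [e2 [l2L h2]]] := generators_mod_prime q0 n qp idx.
set P := list_mul qs.
have q1 : 1 < q0 by case: qp.
have g : Nat.gcd q0 P = 1.
  case: (prime_gcd q0 P qp) => // d. exfalso. apply: nin. apply: prime_dvd_list_mul d => // p pl.
  by case: (hq p (or_intror pl)).
have P0 : P <> 0.
  move=> e. rewrite e Nat.gcd_0_r in g. lia.
have [a [b E1]] := Nat.gcd_bezout_pos q0 P ltac:(lia).
have [c [d E2]] := Nat.gcd_bezout_pos P q0 ltac:(lia).
rewrite g in E1. rewrite Nat.gcd_comm g in E2.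
(* As [a q0 = 1 + b P] and [c P = 1 + d q0], the entry is congruent to its first component modulo
   [q]-th powers for [q] in [qs], and to the second modulo [q0]-th powers. *)
pose mk := fun p : G * G => fst p ^+ (a * q0) ** snd p ^+ (c * P).
set l := map mk (combine l1 l2).
have lL : forall x, In x l -> L x.
  move=> x /in_map_iff [[u v] [<- uv]]. rewrite /mk /=. smul => //; spow => //.
    apply: l1L. exact: in_combine_l uv.
  apply: l2L. exact: in_combine_r uv.
exists l; split; first by rewrite /l length_map length_combine e1 e2 Nat.min_id.
split=> // q ql.
have sS := span_mod_sub l q lL.
have red : forall l', (forall x, In x l' -> span_mod l q x) -> subset G (span_mod l' q) (span_mod l q).
  move=> l' hl' _ [h [y [gh [Ly ->]]]]. apply: (sub_mul _ _ _ _ sS); last exact: span_mod_pow.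
  move: h gh. exact: gl_min.
have pairs : forall (T1 T2 : Type) (x1 : list T1) (x2 : list T2), length x1 = length x2 ->
  (forall u, In u x1 -> exists v, In (u, v) (combine x1 x2)) /\ (forall v, In v x2 -> exists u, In (u, v) (combine x1 x2)).
  move=> T1 T2; elim=> [|u x1 IHx] [|v x2] //= [e]. have [i1 i2] := IHx x2 e. split.
    move=> u' [<-|/i1 [v' h]]; [by exists v; left | by exists v'; right].
  move=> v' [<-|/i2 [u' h]]; [by exists u; left | by exists u'; right].
have [p1 p2] := pairs _ _ l1 l2 ltac:(by rewrite e1 e2).
case: ql => [e|ql].
  subst q. move=> x /h2. apply: red => // v vl. have [u uv] := p2 v vl.
  have Lu : L u by apply: l1L; exact: in_combine_l uv. have Lv := l2L v vl.
  have m : span_mod l q0 (mk (u, v)) by apply: span_mod_gl; apply: gl_in; apply: in_map.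
  have k1 : span_mod l q0 (u ^+ (a * q0)) by rewrite gpow_mulA; apply: span_mod_pow; spow.
  have k2 : span_mod l q0 (v ^+ (d * q0)) by rewrite gpow_mulA; apply: span_mod_pow; spow.
  have sS' := span_mod_sub l q0 lL.
  have := sub_mulr _ _ _ _ sS' k1 m. rewrite /= E2 gpow_add gpow1 => k3. exact: (sub_mull _ _ _ _ sS' k2 k3).
move=> x /(h1 q ql). apply: red => // u ul. have [v uv] := p1 u ul.
have Lu := l1L u ul. have Lv : L v by apply: l2L; exact: in_combine_r uv.
have [r er] : Nat.divide q P by exact: list_mul_dvd.
have m : span_mod l q (mk (u, v)) by apply: span_mod_gl; apply: gl_in; apply: in_map.
have k1 : span_mod l q (v ^+ (c * P)).
  rewrite er Nat.mul_assoc gpow_mulA; apply: span_mod_pow; by spow.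
have k2 : span_mod l q (u ^+ (b * P)).
  rewrite er Nat.mul_assoc gpow_mulA; apply: span_mod_pow; by spow.
have := sub_mull _ _ _ _ sS k1 m. rewrite /= E1 gpow_add gpow1 => k3. exact: (sub_mull _ _ _ _ sS k2 k3).
Qed.

(** From [L = <l> L^q] for the primes [q] dividing [m], one gets [L = <l> L^m = <l>] by peeling
    primes off [m]. *)
Lemma generators_of_primes n m : 0 < m -> (forall x, L x -> x ^+ m = gone) ->
  (forall q, nprime q -> idx_le G (powers G L q) L (q ^ n)) ->
  exists l, length l = n /\ L = gl G l.
Proof.
move=> m0 em idx.
have [qs0 [_ hqs0]] := list_filter nat (fun q => nprime q /\ Nat.divide q m) (seq 0 (S m)).
have hqs : forall q, In q (nodup Nat.eq_dec qs0) <-> nprime q /\ Nat.divide q m.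
  move=> q; rewrite nodup_In hqs0; split; [tauto | move=> [h1 h2]; split=> //].
  apply/in_seq. have := Nat.divide_pos_le q m m0 h2. lia.
have [l [ll [lL hl]]] := generators_mod_primes n _ (NoDup_nodup Nat.eq_dec qs0)
   (fun q ql => conj (proj1 (proj1 (hqs q) ql)) (idx q (proj1 (proj1 (hqs q) ql)))).
exists l; split=> //.
have sl := gl_sub _ l. have glL : subset G (gl G l) L by apply: gl_min.
have H : forall j, 0 < j -> (forall q, nprime q -> Nat.divide q j -> Nat.divide q m) -> subset G L (span_mod l j).
  { elim/lt_wf_ind=> j IH j0 hj x Lx.
  case: (Nat.eq_dec j 1) => [->|j1]; first by exists gone, x; rewrite gpow1 gmul_1l; split=> //; sone.
  have [q [qp [k ek]]] := prime_divisor j ltac:(lia).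
  have q1 : 1 < q by case: qp.
  have [|||h [y [gh [Ly ->]]]] := IH k _ _ _ x Lx.
  - nia.
  - nia.
  - move=> p pp pk. apply: hj => //. apply: Nat.divide_trans pk _. exists q; lia.
  - have qd : Nat.divide q j by exists k.
    have [h' [y' [gh' [Ly' ->]]]] := hl q (proj2 (hqs q) (conj qp (hj q qp qd))) y Ly.
    exists (h ** h' ^+ k), y'; split; first by smul => //; spow. split=> //.
    rewrite gpow_mulM; first by apply: cL; [exact: glL | spow].
    by rewrite mulA -gpow_mulA ek Nat.mul_comm. }
apply: gset_eq => x; split; last exact: glL.
move=> /(H m m0 (fun q _ h => h)) [h [y [gh [Ly ->]]]]. by rewrite em // mul1r.
Qed.
End Lattice.

Lemma abelian_rank n : locally_finite G -> periodic G -> (forall x y, commute x y) ->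
  (forall q, nprime q -> idx_le G (trivial_set G) (omega G fullset q) (q ^ n)) -> rank_le G fullset n.
Proof.
move=> lf per c hq L sL _ fL. have fin := lf L sL fL.
have cL : forall x y, L x -> L y -> commute x y by move=> x y _ _; exact: c.
have [m [m0 em]] := finite_common_exponent G L (lt 0) fin Nat.lt_0_1 Nat.mul_pos_pos (fun x _ => per x).
have [|l [ll ->]] := generators_of_primes L sL cL n m m0 em.
- move=> q qp. apply: idx_powers => //. by apply: idx_le_restrict (hq q qp); [exact: sub_triv | move=> x []].
- by exists l; split; [lia | move=> x].
Qed.
End AbelianGenerators.

(** If some [n] bounded the dimensions for all primes, [G / G'] would have rank at most [n] and [G]
    rank at most [r + n]. *)
Lemma large_elementary_sections (G : Group) : locally_finite G -> periodic G -> infinite_rank G fullset ->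
  finite_rank G (derived G) -> forall n, exists q, nprime q /\
    ~ idx_le G (derived G) (fun g => derived G (g ^+ q)) (q ^ n).
Proof.
move=> lf per inf [r hr] n. apply: NNPP => no. apply: inf.
have nR := derived_normal G.
have [Q [f [fM [fS fK]]]] := quotient_exists G _ nR.
exists (r + n). apply: (rank_le_extension G Q f) => //.
  by apply: rank_le_mono hr => x [/fK].
rewrite img_full //. apply: abelian_rank.
- exact: img_locally_finite lf.
- exact: img_periodic per.
- move=> y z. have [x <-] := fS y. have [w <-] := fS z. apply/hom_commute => //. apply/fK. exact: derived_comm.
- move=> q qp. have i : idx_le G (derived G) (fun g => derived G (g ^+ q)) (q ^ n).
    by apply: NNPP => ni; apply: no; exists q.
  have i2 := img_idx G Q f fM _ _ _ i.
  apply: idx_le_mono (idx_le_restrict _ _ _ _ _ _ _ i2).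
  + by move=> y [x [/fK h <-]].
  + apply: img_sub => //. exact: normal_sub.
  + move=> y [_ ey]. have [x e] := fS y. exists x; split=> //. apply/fK. by rewrite hom_pow // e.
Qed.

(** * Coprime actions of elementary abelian groups *)

Section CoprimeAction.
Variable G : Group.
Implicit Types (x y z g w u v e : G) (A B C E H K L M N S U V W X : gset G).

Definition cj w g : G := g^-1 ** (w ** g).
Lemma cj_mul w g h : cj w (g ** h) = cj (cj w g) h.
Proof. rewrite /cj. grp. Qed.
Lemma cj_mulM u v g : cj (u ** v) g = cj u g ** cj v g.
Proof. rewrite /cj. grp. Qed.
Lemma cj_1 g : cj gone g = gone.
Proof. rewrite /cj. grp. Qed.
Lemma cj_fixed w g : cj w g = w <-> commute w g.
Proof.
rewrite /cj /commute; split=> [h|->]; last by rewrite mulKV.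
by rewrite -{2}h mulVK.
Qed.

Fixpoint bprod (F : nat -> G) (n : nat) : G := match n with 0 => gone | S m => bprod F m ** F m end.

Lemma bprod_ext F F' n : (forall i, i < n -> F i = F' i) -> bprod F n = bprod F' n.
Proof. elim: n => [|n IH] h //=. rewrite IH; first by move=> i le; apply: h; lia. by rewrite h. Qed.
Lemma bprod_in A F n : subgroup G A -> (forall i, i < n -> A (F i)) -> A (bprod F n).
Proof.
move=> sA; elim: n => [|n IH] h /=; first by sone. smul => //; [apply: IH => i le; apply: h; lia | exact: h].
Qed.
Lemma bprod_const w n : bprod (fun _ => w) n = w ^+ n.
Proof. by elim: n => [|n IH] //=; rewrite IH -gpowSr. Qed.
Lemma bprod_cj F n g : cj (bprod F n) g = bprod (fun i => cj (F i) g) n.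
Proof. elim: n => [|n IH] /=; [exact: cj_1 | by rewrite cj_mulM IH]. Qed.
Lemma bprod_shift F n : bprod F (S n) = F 0 ** bprod (fun i => F (S i)) n.
Proof. elim: n => [|n IH]; first by rewrite /= gmul_1l mul1r. by rewrite [LHS]/= -/(bprod F (S n)) IH /= mulA. Qed.
Lemma bprod_trivial F n : (forall i, i < n -> F i = gone) -> bprod F n = gone.
Proof. move=> h. rewrite (bprod_ext _ (fun _ => gone)) // bprod_const. exact: gpow_one. Qed.

Section InAbelian.
Variables (T : gset G) (nT : normal G T) (cT : forall x y, T x -> T y -> commute x y).
Let sT : subgroup G T := normal_sub _ _ nT.

Lemma bprod_mul F F' n : (forall i, T (F i)) -> (forall i, T (F' i)) ->
  bprod (fun i => F i ** F' i) n = bprod F n ** bprod F' n.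
Proof.
move=> h h'; elim: n => [|n IH] /=; first by rewrite gmul_1l.
rewrite IH !mulA. congr (_ ** _). rewrite -!mulA. congr (_ ** _). apply: cT => //. exact: (bprod_in T).
Qed.
Lemma bprod_exchange (F : nat -> nat -> G) n m : (forall i j, T (F i j)) ->
  bprod (fun i => bprod (F i) m) n = bprod (fun j => bprod (fun i => F i j) n) m.
Proof.
move=> h; elim: m => [|m IH] /=; first by apply: bprod_trivial.
rewrite bprod_mul // ?IH // => i. by apply: (bprod_in T).
Qed.

Lemma cj_eq_mod w g h : T w -> cent G T (g^-1 ** h) -> cj w g = cj w h.
Proof.
move=> Tw c. have -> : h = g ** (g^-1 ** h) by rewrite mulVK.
rewrite cj_mul. symmetry; apply/cj_fixed. apply: commute_sym. apply: c. exact: normal_conj.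
Qed.

Definition orbit_prod g q w := bprod (fun i => cj w (g ^+ i)) q.

(** The norm of [w] under [g]: conjugation by [g] permutes its factors cyclically. *)
Lemma orbit_prod_fixed g q w : T w -> cent G T (g ^+ q) -> commute (orbit_prod g q w) g.
Proof.
move=> Tw cq. apply/cj_fixed. rewrite /orbit_prod bprod_cj.
rewrite (bprod_ext _ (fun i => cj w (g ^+ S i))); first by move=> i _; rewrite -cj_mul -gpowSr.
have Tc : forall i, T (cj w (g ^+ i)) by move=> i; exact: normal_conj.
have e : w ** bprod (fun i => cj w (g ^+ S i)) q = bprod (fun i => cj w (g ^+ i)) (S q).
  rewrite bprod_shift /=. congr (_ ** _). by rewrite /cj inv1 gmul_1l mul1r.
apply: (mul_cancel _ w). rewrite e /=.
have -> : cj w (g ^+ q) = w by apply/cj_fixed; apply: commute_sym; exact: cq.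
apply: cT => //. exact: (bprod_in T).
Qed.

(* The product of [w ^ ((a b^k)^i)] over [i, k < q] is [w ^+ q] times the factors [i <> 0], each of which is
   fixed by [b]. *)
Lemma two_commuting_fixed W q a b : nprime q -> subgroup G W -> subset G W T ->
  (forall w, W w -> W (cj w a)) -> (forall w, W w -> W (cj w b)) ->
  cent G T [~ a, b] -> cent G T (a ^+ q) -> cent G T (b ^+ q) ->
  (forall w, W w -> commute w b -> w = gone) ->
  (forall k w, W w -> commute w (a ** b ^+ k) -> w = gone) ->
  forall w, W w -> w ^+ q = gone.
Proof.
move=> qp sW WT Wa Wb cab caq cbq fb fab w Ww.
have q1 : 1 < q by case: qp.
have nC := cent_normal G T nT.
have [Q [f [fM [fS fK]]]] := quotient_exists G _ nC.
have act : forall u g h, T u -> f g = f h -> cj u g = cj u h.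
  move=> u g h Tu /(hom_eq _ _ _ fM) /fK c. exact: cj_eq_mod.
have fab' : commute (f a) (f b) by apply/hom_commute => //; apply/fK.
have Wpow : forall g, (forall u, W u -> W (cj u g)) -> forall i u, W u -> W (cj u (g ^+ i)).
  move=> g h; elim=> [|i IH] u Wu; first by rewrite /cj /= inv1 gmul_1l mul1r.
  rewrite gpowS cj_mul. apply: IH. exact: h.
have Wab : forall k u, W u -> W (cj u (a ** b ^+ k)).
  move=> k u Wu. rewrite cj_mul. apply: (Wpow _) => //. exact: Wa.
have fpow : forall k i, f ((a ** b ^+ k) ^+ i) = f (a ^+ i ** (b ^+ i) ^+ k).
  move=> k i. rewrite hom_pow // fM gpow_mulM; first by rewrite hom_pow //; exact: commute_pow.
  rewrite fM !(hom_pow _ _ _ fM). by rewrite (gpow_mulAC _ (f b) k i).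
(* For fixed [k] the product is fixed by [a b^k], hence trivial; so the double product is trivial
   when taken by rows. *)
have row : forall k, bprod (fun i => cj w ((a ** b ^+ k) ^+ i)) q = gone.
  move=> k. apply: (fab k).
    apply: (bprod_in W) => // i _. apply: (Wpow _) => //. exact: Wab.
  apply: (orbit_prod_fixed _ q w); first exact: WT.
  apply/fK. rewrite fpow fM gpow_mulAC -(gpow_mulA _ b k q) (Nat.mul_comm k q) gpow_mulA.
  have -> : f (a ^+ q) = gone by apply/fK.
  rewrite hom_pow //. have -> : f (b ^+ q) = gone by apply/fK. by rewrite gpow_one gmul_1l.
have col : forall i, 0 < i < q -> bprod (fun k => cj (cj w (a ^+ i)) ((b ^+ i) ^+ k)) q = gone.
  move=> i hi. set u := cj w (a ^+ i).
  have Wu : W u by apply: Wpow.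
  apply: fb.
    apply: (bprod_in W) => // k _. apply: (Wpow _) => //. exact: Wpow.
  set n := bprod _ _.
  have cbi : commute n (b ^+ i).
    apply: orbit_prod_fixed; first exact: WT.
    rewrite gpow_mulAC. apply: (sub_pow _ (cent G T)) => //. exact: cent_sub.
  have Tn : T n by apply: (bprod_in T) => // k _; apply: WT; apply: (Wpow (b ^+ i)); [exact: Wpow | exact: Wpow].
  have cbQ : commute n (b ^+ q) by apply: commute_sym; exact: cbq.
  have [c [d E]] := Nat.gcd_bezout_pos i q ltac:(lia).
  have g1 : Nat.gcd i q = 1 by rewrite Nat.gcd_comm; exact: prime_gcd_lt.
  have h1 : commute n (b ^+ (c * i)) by rewrite Nat.mul_comm gpow_mulA; exact: commute_pow.
  have h2 : commute n (b ^+ (d * q)) by rewrite Nat.mul_comm gpow_mulA; exact: commute_pow.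
  move: h1; rewrite E g1 gpow_add gpow1 => h1.
  have -> : b = (b ** b ^+ (d * q)) ** (b ^+ (d * q))^-1 by grp.
  apply: commute_mul => //. exact: commute_inv.
have tot : bprod (fun i => bprod (fun k => cj w ((a ** b ^+ k) ^+ i)) q) q = gone.
  rewrite -(bprod_exchange (fun k i => cj w ((a ** b ^+ k) ^+ i))); last by apply: bprod_trivial => k _; exact: row.
  move=> k i. apply: normal_conj => //. exact: WT.
move: tot. case: q q1 qp caq cbq row col => [|q'] q1 qp caq cbq row col; first lia.
pose F i := bprod (fun k => cj w ((a ** b ^+ k) ^+ i)) (S q').
change (bprod F (S q') = gone -> w ^+ S q' = gone).
rewrite bprod_shift (bprod_trivial (fun i => F (S i))).
  move=> i le. rewrite -(col (S i)); first lia.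
  apply: bprod_ext => k _. rewrite -cj_mul. apply: act; [exact: WT | exact: fpow].
rewrite mul1r => <-. rewrite -bprod_const. apply: bprod_ext => k _.
by rewrite /cj inv1 gmul_1l mul1r.
Qed.

Variables (p q : nat) (pp : nprime p) (qp : nprime q) (pq : p <> q).
Hypothesis tT : forall x, T x -> tel G (eq p) x.

Lemma coprime_order w : T w -> w ^+ q = gone -> w = gone.
Proof.
move=> Tw wq. apply: (tel_disjoint G (eq p) (eq q)); first by move=> s _ <- h; apply: pq.
  exact: tT.
by exists q; split=> //; have := tnum_pow q 1 qp; rewrite Nat.pow_1_r.
Qed.

(** By induction on the order of [z], [[z, e]] has [p]-th power [[z^p, e] = 1]. It is then
    centralised by [e], so its [q]-th power is [[z, e^q] = 1] as well. *)
Lemma cent_of_omega e : cent G T (e ^+ q) -> (forall z, omega G T p z -> commute z e) -> cent G T e.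
Proof.
move=> ceq ce. have H : forall k z, T z -> z ^+ (p ^ k) = gone -> commute z e.
  elim=> [|k IH] z Tz; first by rewrite Nat.pow_0_r gpow1 => ->; apply: commute_sym; exact: commute_1.
  rewrite Nat.pow_succ_r' gpow_mulA => zk.
  have Tc : T [~ z, e] by exact: normal_comml.
  have c1 : commute [~ z, e] z by exact: cT.
  have cp : [~ z, e] ^+ p = gone.
    rewrite -comm_powl //. apply/commute_comm. apply: IH => //. by spow.
  have ce' : commute [~ z, e] e by exact: ce.
  apply/commute_comm. apply: coprime_order => //. rewrite -comm_powr //. apply/commute_comm. apply: commute_sym. exact: ceq.
move=> z Tz. apply: commute_sym. have [n [tn en]] := tT z Tz.
have [k nk] := tnum_dvd_pow (eq p) p n tn ltac:(move=> s _ <-; exact: Nat.divide_refl).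
apply: (H k) => //. exact: gpow_divide en.
Qed.

Section Chain.
Variable E0 : gset G.
Hypothesis cE0 : forall e h, E0 e -> E0 h -> cent G T [~ e, h].
Hypothesis qE0 : forall e, E0 e -> cent G T (e ^+ q).
Variables (lE : list G).
Hypothesis lE0 : forall e, In e lE -> E0 e.
Hypothesis lEcov : forall e, E0 e -> exists x, In x lE /\ cent G T (x^-1 ** e).

(** These correspond to the subgroups of the group induced by [E0] on [T], which is elementary
    abelian. *)
Definition good E := subgroup G E /\ subset G E E0 /\ subset G (inter G E0 (cent G T)) E.

Lemma good_normal E x u : good E -> subgroup G E0 -> E0 x -> E u -> E (cj u x).
Proof.
move=> [sE [EE0 cE]] sE0 Ex Eu. rewrite /cj conj_comm. smul => //. apply: cE; split.
  scomm => //. exact: EE0.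
apply: cE0 => //. exact: EE0.
Qed.

Lemma adjoin_good E x : subgroup G E0 -> good E -> E0 x -> good (adjoin G E x) /\ idx_le G E (adjoin G E x) q.
Proof.
move=> sE0 gE Ex. have [sE [EE0 cE]] := gE. have q0 : 0 < q by case: qp; lia.
have Eq : E (x ^+ q) by apply: cE; split; [spow | exact: qE0].
split; last exact: adjoin_idx.
split; first by apply: (adjoin_subgroup _ _ _ q) => // v Ev; exact: good_normal.
split; first exact: adjoin_sub. by move=> y /cE; exact: adjoin_incl.
Qed.

(** [E'] is chosen greedily, testing only the finitely many representatives [lE]: elements congruent
    modulo the centraliser of [T] have the same fixed points. *)
Lemma maximal_fixing U u E : subgroup G E0 -> good E -> U u -> u <> gone -> subset G U T ->
  exists E', good E' /\ subset G E' E /\ (exists w, U w /\ w <> gone /\ cent G E' w) /\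
    forall e, E e -> E' e \/ forall w, U w -> cent G E' w -> commute w e -> w = gone.
Proof.
move=> sE0 gE Uu nu UT. have [sE [EE0 cE]] := gE.
have fixC : forall w, T w -> cent G (inter G E0 (cent G T)) w by move=> w Tw e [_ c]; apply: commute_sym; exact: c.
have H : forall l, (forall e, In e l -> E e) -> exists E', good E' /\ subset G E' E /\
   (exists w, U w /\ w <> gone /\ cent G E' w) /\
   forall e, In e l -> E' e \/ forall w, U w -> cent G E' w -> commute w e -> w = gone.
  elim=> [|a l IH] lEE.
    exists (inter G E0 (cent G T)); split.
      split; first by apply: sub_inter => //; exact: cent_sub. split=> //. exact: inter_sub_l.
    split=> //. split=> //. exists u; split=> //; split=> //. apply: fixC; exact: UT.
  have [E' [gE' [E'E [[w [Uw [nw fw]]] hl]]]] := IH (fun e el => lEE e (or_intror el)).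
  have Ea := lEE a (or_introl eq_refl).
  case: (classic (exists w, U w /\ w <> gone /\ cent G E' w /\ commute w a)) => [[w' [Uw' [nw' [fw' cw']]]]|no].
    have [ga _] := adjoin_good E' a sE0 gE' (EE0 a Ea).
    exists (adjoin G E' a); split=> //; split; first exact: adjoin_sub.
    split.
      exists w'; split=> //; split=> //. apply: (adjoin_sub _ _ _ (fun e => commute w' e)) => //. exact: commute_sub.
    move=> e /= [<-|/hl [E'e|h]]; first by left; apply: adjoin_in; case: gE'.
      left. exact: adjoin_incl.
    right=> v Uv fv. apply: h => // x E'x. apply: fv. exact: adjoin_incl.
  exists E'; split=> //; split=> //; split; first by exists w.
  move=> e /= [<-|/hl //]. right=> v Uv fv cv. apply: NNPP => nv; apply: no. by exists v.
have [l [_ hl]] := list_filter _ (fun x => E x) lE.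
have [E' [gE' [E'E [ex hE']]]] := H l ltac:(by move=> e /hl []).
exists E'; split=> //; split=> //; split=> //. move=> e Ee.
have [x [xl cx]] := lEcov e (EE0 e Ee).
have cC : inter G E0 (cent G T) (x^-1 ** e) by split=> //; sdiv; [exact: sE0 | exact: lE0 | exact: EE0].
have Ex : E x.
  apply: (sub_mull _ _ _ (x^-1 ** e)^-1^-1 sE); last by rewrite invK mulVK. apply: sub_inv => //. apply: sub_inv => //. exact: cE.
have [sE' [_ cE']] := gE'.
case: (hE' x (proj2 (hl x) (conj xl Ex))) => [E'x|h].
  left. rewrite -(mulVK _ x e). smul => //. exact: cE'.
right=> w Uw fw cw. apply: h => //.
have -> : x = e ** (x^-1 ** e)^-1 by grp.
apply: commute_mul => //. apply: commute_inv. apply: fixC => //. exact: UT.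
Qed.

(** If the maximal [E'] had index above [q], two elements [a], [b] independent modulo [E'] would act
    on the fixed points [W] of [E'] so that [b] and every [a b^k] fix only the identity. Then [W]
    has exponent [q], so it is trivial, against the choice of [E']. *)
Lemma fixed_point_small_index U u E : subgroup G E0 -> good E -> subgroup G U -> subset G U T ->
  (forall e w, E e -> U w -> U (cj w e)) -> U u -> u <> gone ->
  exists E', good E' /\ subset G E' E /\ idx_le G E' E q /\ exists w, U w /\ w <> gone /\ cent G E' w.
Proof.
move=> sE0 gE sU UT inv Uu nu. have [sE [EE0 cE]] := gE.
have q1 : 1 < q by case: qp.
have [E' [gE' [E'E [ex hE']]]] := maximal_fixing U u E sE0 gE Uu nu UT.
have [sE' [E'0 cE']] := gE'.
exists E'; split=> //; split=> //; split=> //.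
case: (classic (subset G E E')) => [EE'|nE].
  have -> : E' = E by apply: gset_eq => x; split; [exact: E'E | exact: EE'].
  apply: (idx_le_leq _ _ _ 1); [lia | exact: idx_refl].
have [a [Ea na]] : exists a, E a /\ ~ E' a.
  apply: NNPP => no; apply: nE => x Ex; apply: NNPP => nx; apply: no; by exists x.
have [gA idA] := adjoin_good E' a sE0 gE' (EE0 a Ea).
have [sA [A0 cA]] := gA.
case: (classic (subset G E (adjoin G E' a))) => [EA|nEA].
  exact: idx_le_restrict EA idA.
exfalso.
have [b [Eb nb]] : exists b, E b /\ ~ adjoin G E' a b.
  apply: NNPP => no; apply: nEA => x Ex; apply: NNPP => nx; apply: no; by exists x.
have [w [Uw [nw fw]]] := ex.
pose W := inter G U (cent G E').
have Ua : adjoin G E' a a by exact: adjoin_in.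
have sW : subgroup G W.
  by apply: sub_inter => //; exact: cent_sub.
have Winv : forall e, E e -> forall w, W w -> W (cj w e).
  move=> e Ee x [Ux fx]; split; first exact: inv. move=> h E'h.
  have := fx _ (good_normal _ _ _ gE' sE0 (sub_inv _ _ _ sE0 (EE0 _ Ee)) E'h). rewrite /commute /cj invK => k.
  have -> : e^-1 ** (x ** e) ** h = e^-1 ** ((x ** (e ** (h ** e^-1))) ** e) by grp.
  rewrite k. grp.
have nofix : forall e, E e -> ~ E' e -> forall w, W w -> commute w e -> w = gone.
  move=> e Ee ne x [Ux fx]. case: (hE' e Ee) => // h. exact: h.
apply: nw. apply: coprime_order; first exact: UT.
apply: (two_commuting_fixed W q a b) => //.
- by move=> x [/UT].
- exact: Winv.
- exact: Winv.
- by apply: cE0; exact: EE0.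
- by apply: qE0; exact: EE0.
- by apply: qE0; exact: EE0.
- apply: nofix => // E'b. apply: nb. exact: adjoin_incl.
- move=> k. apply: nofix; first by smul => //; spow.
(* Suppose [a b^k] is in [E']. If [q] divides [k], then [a] is in [E']; otherwise [b] lies in [E']
   extended by [a]. *)
move=> h. case: (prime_gcd q k qp) => [[j ej]|g].
  apply: na. apply: (sub_mull _ _ _ (b ^+ k) sE') => //.
  rewrite ej Nat.mul_comm gpow_mulA. spow => //. apply: cE'; split; [by spow => //; exact: EE0 | by apply: qE0; exact: EE0].
apply: nb.
have Ak : adjoin G E' a (b ^+ k).
  apply: (sub_mulr _ _ a _ sA) => //. exact: adjoin_incl.
have Aq : adjoin G E' a (b ^+ q).
  apply: adjoin_incl. apply: cE'; split; [by spow => //; exact: EE0 | by apply: qE0; exact: EE0].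
have [c [d EE]] := Nat.gcd_bezout_pos q k ltac:(lia). rewrite g in EE.
have h1 : adjoin G E' a (b ^+ (c * q)) by rewrite Nat.mul_comm gpow_mulA; apply: (sub_pow _ _ _ _ sA).
move: h1; rewrite EE gpow_add gpow1 => h1.
apply: (sub_mull _ _ _ _ sA _ h1). rewrite Nat.mul_comm gpow_mulA. exact: (sub_pow _ _ _ _ sA).
Qed.

(* A non-central [e] in [E] has [[V, e]] meeting the fixed points of [E] trivially, so a fixed point of a
   subgroup of index [q] inside [[V, e]] enlarges the space of fixed points. *)
Lemma chain_step E (s : list G) Fx : subgroup G E0 -> good E -> ~ subset G E (cent G T) ->
  subgroup G Fx -> subset G Fx (omega G T p) -> (forall w, Fx w -> cent G E w) ->
  sep G (trivial_set G) s -> (forall x, In x s -> Fx x) ->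
  exists E' s' Fx', good E' /\ idx_le G E' E q /\ subgroup G Fx' /\ subset G Fx' (omega G T p) /\
    (forall w, Fx' w -> cent G E' w) /\ sep G (trivial_set G) s' /\ (forall x, In x s' -> Fx' x) /\
    length s' = p * length s.
Proof.
move=> sE0 gE nE sF FV Ff ss sF'. have [sE [EE0 cE]] := gE.
have p0 : 0 < p by case: pp; lia.
have sV := omega_sub G T sT cT p.
have nV : normal G (omega G T p).
  apply: normal_of => // x g [Tx ex]; split; first exact: normal_conj. rewrite gpow_conj ex. grp.
have VT : subset G (omega G T p) T by move=> x [].
have [e [Ee ne]] : exists e, E e /\ ~ forall z, omega G T p z -> commute z e.
  apply: NNPP => no; apply: nE => e Ee. apply: cent_of_omega; first by apply: qE0; exact: EE0.
  apply: NNPP => h; apply: no; by exists e.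
have [v [Vv nv]] : exists v, omega G T p v /\ ~ commute v e.
  apply: NNPP => no; apply: ne => z Vz; apply: NNPP => h; apply: no; by exists z.
pose U : gset G := fun u => exists v, omega G T p v /\ u = [~ v, e].
have UV : subset G U (omega G T p) by move=> _ [x [Vx ->]]; exact: normal_comml.
have Vc : forall x y, omega G T p x -> omega G T p y -> commute x y by move=> x y [? _] [? _]; exact: cT.
have cM : forall x y, omega G T p x -> omega G T p y -> [~ x ** y, e] = [~ x, e] ** [~ y, e].
  move=> x y Vx Vy. have -> : [~ x ** y, e] = y^-1 ** ([~ x, e] ** y) ** [~ y, e] by grp.
  congr (_ ** _). apply/cj_fixed. apply: Vc => //. exact: normal_comml.
have sU : subgroup G U.
  split; first by exists gone; split; [sone | rewrite comm1].
  split=> [_ _ [x [Vx ->]] [y [Vy ->]]|_ [x [Vx ->]]].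
    by exists (x ** y); split; [smul | rewrite cM].
  exists x^-1; split; first by sinv. symmetry. apply: inv_eq. rewrite -cM //; first by sinv. by rewrite mulVr comm1.
have invU : forall h w, E h -> U w -> U (cj w h).
  move=> h _ Eh [x [Vx ->]]. exists (cj x h); split; first exact: normal_conj.
  rewrite /cj conjR. have c := cE0 _ _ (EE0 _ Ee) (EE0 _ Eh).
  rewrite (conj_comm _ e h). set y := h^-1 ** (x ** h).
  have Ty : T y by apply: VT; exact: normal_conj.
  have -> : [~ y, e ** [~ e, h]] = [~ y, [~ e, h]] ** ([~ e, h]^-1 ** ([~ y, e] ** [~ e, h])) by grp.
  have -> : [~ y, [~ e, h]] = gone by apply/commute_comm; apply: commute_sym; exact: c.
  rewrite gmul_1l. apply/cj_fixed. apply: commute_sym. apply: c. exact: normal_comml.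
have [E' [gE' [E'E [idx [w [Uw [nw fw]]]]]]] := fixed_point_small_index U [~ v, e] E sE0 gE sU
  (fun x h => VT x (UV x h)) invU (ex_intro _ v (conj Vv eq_refl)) (fun h => nv (proj2 (commute_comm _ v e) h)).
(* If [w = [x, e]] is fixed by [e], then [w^q = [x, e^q] = 1], and [w] is a [p]-element. *)
have nFw : ~ Fx w.
  move=> Fw. apply: nw. have cwe := Ff w Fw e Ee.
  case: Uw => x [[Tx _] ew]. apply: coprime_order; first by case: (FV w Fw).
  rewrite ew -comm_powr; first by rewrite -ew. apply/commute_comm. apply: commute_sym. apply: qE0 => //. exact: EE0.
have Vw := UV w Uw.
have Fwp : Fx (w ^+ p) by case: Vw => _ ->; sone.
have sFw : subgroup G (adjoin G Fx w).
  apply: (adjoin_subgroup _ _ _ p) => // x Fxx. rewrite (Vc x w) ?mulKV //. exact: FV.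
exists E', (map (fun r => fst r ** snd r) (list_prod (map (gpow G w) (rev (seq 0 p))) s)), (adjoin G Fx w).
split=> //; split=> //; split=> //; split; first exact: adjoin_sub.
split.
  apply: (adjoin_sub _ _ _ (cent G E')) => //; first exact: cent_sub.
  move=> x /Ff h y /E'E. exact: h.
split.
  apply: (sep_prod _ _ Fx) => //; first by move=> x ->; sone. exact: sep_powers.
split; last by rewrite length_map length_prod length_map length_rev length_seq.
move=> y /in_map_iff [[a b] [<- /in_prod_iff [/in_map_iff [i [<- _]] /sF' Fb]]] /=.
apply: (sub_mul _ _ _ _ sFw); last exact: adjoin_incl. apply: (sub_pow _ _ _ _ sFw). exact: adjoin_in.
Qed.

(** Each descent by a factor [q] in [E] multiplies the known fixed points in [T[p]] by [p], and
    [T[p]] has at most [p ^ r] elements; so after [r] descents the action is trivial. *)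
Lemma coprime_action_index r : subgroup G E0 -> rank_le G T r -> idx_le G (cent G T) E0 (q ^ r).
Proof.
move=> sE0 rT. have sC := cent_sub G T.
have p1 : 1 < p by case: pp. have q1 : 1 < q by case: qp.
have sV := omega_sub G T sT cT p.
have VT : subset G (omega G T p) T by move=> x [].
have idV : idx_le G (trivial_set G) (omega G T p) (p ^ r).
{ apply: idx_of_rank => //; try (by exact: sub_triv); try lia.
  - by move=> x ->; sone.
  - move=> x y [Tx _] [Ty _]. apply/commute_comm. exact: cT.
  - by move=> x [_].
  - exact: rank_le_mono rT. }
have g0 : good E0 by split=> //; split=> //; exact: inter_sub_l.
have H : forall k, exists E s Fx, good E /\ idx_le G E E0 (q ^ k) /\ (subset G E (cent G T) \/
   (subgroup G Fx /\ subset G Fx (omega G T p) /\ (forall w, Fx w -> cent G E w) /\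
    sep G (trivial_set G) s /\ (forall x, In x s -> Fx x) /\ length s = p ^ k)).
{ elim=> [|k [E [s [Fx [gE [idx alt]]]]]].
    exists E0, [gone], (trivial_set G); split=> //; split; first exact: idx_refl. right.
    split; first exact: sub_triv. split; first by move=> x ->; sone.
    split; first by move=> w -> e _; apply: commute_sym; exact: commute_1.
    split; first by constructor=> //; constructor. split=> // x [<-|[]] //.
  case: (classic (subset G E (cent G T))) => [Ec|nE].
    exists E, s, Fx; split=> //; split; last by left.
    apply: idx_le_leq idx. rewrite Nat.pow_succ_r'. nia.
  case: alt => [//|[sF [FV [Ff [ss [sF' ls]]]]]].
  have [E' [s' [Fx' [gE' [idx' [sF2 [FV' [Ff' [ss' [sF2' ls']]]]]]]]]] := chain_step E s Fx sE0 gE nE sF FV Ff ss sF'.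
  exists E', s', Fx'; split=> //; split; last by right; do 5 (split=> //); rewrite ls' ls.
  apply: idx_trans idx' idx. by case: gE'. }
have [E [s [Fx [gE [idx alt]]]]] := H r.
apply: idx_le_mono idx. apply: NNPP => nE.
case: alt => [//|[sF [FV [Ff [ss [sF' ls]]]]]].
have [E' [s' [Fx' [gE' [idx' [sF2 [FV' [Ff' [ss' [sF2' ls']]]]]]]]]] := chain_step E s Fx sE0 gE nE sF FV Ff ss sF'.
have := sep_length _ _ _ _ _ (sub_triv G) ss' (fun x h => FV' x (sF2' x h)) idV.
rewrite ls' ls. have := Nat.pow_nonzero p r. nia.
Qed.
End Chain.
End InAbelian.
End CoprimeAction.

(** * Sections centralising infinitely many primary components *)

Definition infinite_primes (B : nat -> Prop) := forall m, exists p, m <= p /\ nprime p /\ B p.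

Lemma infinite_primes_split B (P : nat -> Prop) : infinite_primes B ->
  infinite_primes (fun p => B p /\ P p) \/ infinite_primes (fun p => B p /\ ~ P p).
Proof.
move=> iB. case: (classic (infinite_primes (fun p => B p /\ P p))) => [|ni]; first by left.
right=> m. apply: NNPP => nm. apply: ni => k.
have [p [le [pp Bp]]] := iB (max m k). exists p; split; first lia. split=> //; split=> //.
apply: NNPP => nP; apply: nm; exists p; split=> //; lia.
Qed.

(** Refining [B] once for each [t] makes the truth of [P p t] independent of [p] in [B']. *)
Lemma infinite_primes_pigeonhole (T : Type) (l : list T) (P : nat -> T -> Prop) B : infinite_primes B ->
  exists B', infinite_primes B' /\ (forall p, B' p -> B p) /\
    forall t, In t l -> (forall p, B' p -> P p t) \/ (forall p, B' p -> ~ P p t).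
Proof.
move=> iB; elim: l => [|a l [B1 [i1 [B1B h1]]]]; first by exists B.
case: (infinite_primes_split B1 (fun p => P p a) i1) => i2.
  exists (fun p => B1 p /\ P p a); split=> //; split; first by move=> p [/B1B].
  move=> t [<-|/h1 [h|h]]; [left; by move=> p [] | left; by move=> p [/h] | right; by move=> p [/h]].
exists (fun p => B1 p /\ ~ P p a); split=> //; split; first by move=> p [/B1B].
move=> t [<-|/h1 [h|h]]; [right; by move=> p [] | left; by move=> p [/h] | right; by move=> p [/h]].
Qed.

Section FiniteRankDerived.
Variable G : Group.
Implicit Types (x y z g w u v e : G) (A B C E H K L M N S U V W X : gset G).
Notation R := (derived G).
Variables (c r : nat).
Hypothesis hc : forall x, lcs G R c x -> x = gone.
Hypothesis hr : rank_le G R r.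
Hypothesis per : periodic G.

Let nR : normal G R := derived_normal G.
Let sR : subgroup G R := normal_sub _ _ nR.
Let nilR : nilpotent G R := ex_intro _ c hc.

Lemma idx_inter_any K1 K2 H a b : subgroup G K1 -> subgroup G K2 -> subgroup G H ->
  idx_le G K1 H a -> idx_le G K2 H b -> idx_le G (inter G K1 K2) H (a * b).
Proof.
move=> s1 s2 sH i1 i2.
have i2' := idx_le_interr _ _ _ _ _ s2 sH (fun _ h => h) i2.
have := idx_inter _ _ _ _ _ _ s1 (sub_inter _ _ _ s2 sH) (inter_sub_r _ _ _) i1 i2'.
by apply: idx_le_mono => x [? []].
Qed.

(** Trivial action on the image of the [p]-elements of [lcs R i] in the abelian factor
    [lcs R i / lcs R (S i)]. *)
Definition centralizes_factor p i : gset G := fun g =>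
  forall u, lcs G R i u -> tel G (eq p) u -> lcs G R (S i) [~ u, g].

Lemma centralizes_factor_pre p i (Q : Group) (f : G -> Q) : hom G Q f ->
  (forall x, f x = gone <-> lcs G R (S i) x) ->
  centralizes_factor p i = pre G Q f (cent Q (img G Q f (part G (lcs G R i) (eq p)))).
Proof.
move=> fM fK. apply: gset_eq => g; split.
  move=> h _ [u [[Lu tu] <-]]. apply: commute_sym. apply/hom_commute => //; apply/fK. exact: h.
move=> h u Lu tu. apply/fK. apply/hom_commute => //. apply: commute_sym. apply: h. by exists u.
Qed.

Lemma centralizes_factor_sub p i : subgroup G (centralizes_factor p i).
Proof.
have [Q [f [fM [fS fK]]]] := quotient_exists G _ (lcs_normal _ _ (S i) nR).
rewrite (centralizes_factor_pre p i Q f fM fK). apply: pre_sub => //. exact: cent_sub.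
Qed.
Lemma centralizes_factor_derived p i : subset G R (centralizes_factor p i).
Proof. move=> g Rg u Lu _. exact: lcs_comm. Qed.

Lemma centralizes_factor_idx p q i E : nprime p -> nprime q -> p <> q -> subgroup G E -> subset G R E ->
  (forall e, E e -> R (e ^+ q)) -> finite_index_in G R E -> idx_le G (centralizes_factor p i) E (q ^ r).
Proof.
move=> pp qp pq sE RE Eq [lE [lE1 lE2]].
have nL := lcs_normal _ _ i nR. have sL := normal_sub _ _ nL.
have LR := lcs_in G R i sR.
have nilL : nilpotent G (lcs G R i) by apply: nilpotent_mono LR nilR.
have [Q [f [fM [fS fK]]]] := quotient_exists G _ (lcs_normal _ _ (S i) nR).
have nP := part_normal G _ (eq p) nL nilL. have sP := normal_sub _ _ nP.
set T := img G Q f (part G (lcs G R i) (eq p)).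
have nT : normal Q T by apply: img_normal.
have RT : forall x, R x -> cent Q T (f x).
  move=> x Rx _ [u [[Lu tu] <-]]. apply: commute_sym. apply/hom_commute => //; apply/fK. exact: lcs_comm.
have cT : forall x y : Q, T x -> T y -> commute x y.
  move=> _ y [u [[Lu tu] <-]] Ty. exact: (RT u (LR u Lu)).
have tT : forall x : Q, T x -> tel Q (eq p) x.
  move=> _ [u [[Lu [n [tn en]]] <-]]. exists n; split=> //. by rewrite -hom_pow // en hom_1.
rewrite (centralizes_factor_pre p i Q f fM fK). apply: pre_idx => //; first exact: cent_sub.
apply: (coprime_action_index Q T nT cT p q pp qp pq tT _ _ _ (map f lE)).
- move=> _ _ [x [Ex <-]] [y [Ey <-]]. rewrite -hom_comm //. apply: RT. exact: derived_comm.
- move=> _ [x [Ex <-]]. rewrite -hom_pow //. apply: RT. exact: Eq.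
- move=> _ /in_map_iff [x [<- /lE1 Ex]]. by exists x.
- move=> _ [x [Ex <-]]. have [y [yl Ry]] := lE2 x Ex. exists (f y); split; first exact: in_map.
  rewrite -hom_div //. exact: RT.
- exact: img_sub.
- apply: img_rank => //. apply: rank_le_mono hr. by move=> x [/LR].
Qed.

Definition centralizes_factors p : gset G := fun g => forall i, centralizes_factor p i g.
Lemma centralizes_factors_sub p : subgroup G (centralizes_factors p).
Proof.
have := sub_forall G nat (fun _ => True) _ (centralizes_factor_sub p). congr (subgroup _ _).
by apply: gset_eq => g; split=> h i; [exact: h | move=> _; exact: h].
Qed.
Lemma centralizes_factors_derived p : subset G R (centralizes_factors p).
Proof. move=> g Rg i. exact: centralizes_factor_derived. Qed.

Lemma centralizes_factors_idx p q E : nprime p -> nprime q -> p <> q -> subgroup G E -> subset G R E ->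
  (forall e, E e -> R (e ^+ q)) -> finite_index_in G R E -> idx_le G (centralizes_factors p) E (q ^ (r * c)).
Proof.
move=> pp qp pq sE RE Eq fE.
have s := centralizes_factor_sub p.
have H : forall k, idx_le G (fun g => forall i, i < k -> centralizes_factor p i g) E (q ^ (r * k)) /\
   subgroup G (fun g => forall i, i < k -> centralizes_factor p i g).
  elim=> [|k [IH sk]].
    split; last exact: (sub_forall G nat).
    rewrite Nat.mul_0_r. exists [gone]; split=> //; split; first by move=> x [<-|[]]; sone.
    move=> h Eh; exists gone; split; [by left | move=> i; lia].
  split.
    have := idx_inter_any _ _ _ _ _ sk (s k) sE IH (centralizes_factor_idx p q k E pp qp pq sE RE Eq fE).
    rewrite -Nat.pow_add_r. have -> : r * k + r = r * S k by lia.
    apply: idx_le_mono => x [h1 h2] i le. case: (Nat.eq_dec i k) => [->|ne] //. apply: h1; lia.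
  exact: (sub_forall G nat).
have [h _] := H c. apply: idx_le_mono h => g hg i. case: (le_lt_dec c i) => ci; last exact: hg.
move=> u Lu _. have -> : u = gone by apply: hc; exact: lcs_le Lu.
rewrite comm1. apply: sub_1. exact: lcs_sub.
Qed.

(** Go up from the bottom of the series: [[u, g]] lies one term lower, so it commutes with [g], and
    [[u, g]^n = [u, g^n] = 1] with [n] a power-of-[q] number while [[u, g]] is a [p]-element. *)
Lemma coprime_centralizes p q g : nprime p -> nprime q -> p <> q -> tel G (eq q) g ->
  centralizes_factors p g -> forall u, R u -> tel G (eq p) u -> commute u g.
Proof.
move=> pp qp pq [n [tn en]] Dg.
have nP := part_normal G R (eq p) nR nilR.
suff H : forall j i, c <= i + j -> forall u, lcs G R i u -> tel G (eq p) u -> commute u g.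
  by move=> u Ru; apply: (H c 0).
elim=> [|j IH] i le u Lu tu.
  have -> : u = gone by apply: hc; apply: lcs_le Lu => //; lia. apply: commute_sym. exact: commute_1.
have Lw := Dg i u Lu tu.
have [_ tw] : part G R (eq p) [~ u, g] by apply: normal_comml => //; split=> //; exact: lcs_in Lu.
have cw := IH (S i) ltac:(lia) _ Lw tw.
apply/commute_comm. apply: (tel_disjoint G (eq p) (eq q)) => //; first by move=> s _ <- h; apply: pq.
exists n; split=> //. by rewrite -comm_powr // en comm_1.
Qed.

Lemma root_sub q : subgroup G (fun g => R (g ^+ q)).
Proof.
have [Q [f [fM [fS fK]]]] := quotient_exists G _ nR.
split; first by rewrite gpow_one; sone.
split=> [x y hx hy|x hx]; last by rewrite gpow_inv; sinv.
apply/fK. rewrite hom_pow // fM gpow_mulM.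
  apply/hom_commute => //. apply/fK. exact: derived_comm.
rewrite -!hom_pow //. have -> : f (x ^+ q) = gone by apply/fK. have -> : f (y ^+ q) = gone by apply/fK.
by rewrite gmul_1l.
Qed.

Definition big_section q n := nprime q /\ ~ idx_le G R (fun g => R (g ^+ q)) (q ^ n).

Lemma big_section_mono q m n : m <= n -> big_section q n -> big_section q m.
Proof.
move=> mn [qp h]; split=> // i; apply: h. apply: idx_le_leq i. apply: Nat.pow_le_mono_r => //. case: qp; lia.
Qed.

Lemma finite_big_section q n : big_section q n -> exists E, subgroup G E /\ subset G R E /\
  (forall e, E e -> R (e ^+ q)) /\ finite_index_in G R E /\ ~ idx_le G R E (q ^ n).
Proof.
move=> [qp h]. have [l [ll [lE sl]]] := sep_exists _ _ _ _ sR h.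
have q0 : 0 < q by case: qp; lia.
have RE : subset G R (fun g => R (g ^+ q)) by move=> x Rx; spow.
have [E [sE [RE' [EE [lE' idx]]]]] := adjoin_list G _ R q l (root_sub q) sR RE
   (fun x y _ _ => derived_comm G x y) lE q0 lE.
exists E; split=> //; split=> //; split=> //; split; first by apply/idx_finite; eexists; exact: idx.
move=> i. have := sep_length _ _ _ _ _ sR sl lE' i. rewrite ll; lia.
Qed.

(** With [q] outside [tau], the [q]-elements of [E] act coprimely on each [R_p], so triviality on
    the factors becomes triviality on [R_p]. *)
Definition good_section (tau : nat -> Prop) k := exists q E, nprime q /\ ~ tau q /\ subgroup G E /\ subset G R E /\
  (forall e, E e -> R (e ^+ q)) /\ ~ idx_le G R E (q ^ k) /\
  forall p, tau p -> subset G E (centralizes_factors p).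

(* Each prime of [B] costs at most a factor [q ^ (r * c)] in the order of the finite section [E / R], which has only
   finitely many subgroups; so one of them works for infinitely many primes of [B]. *)
Lemma good_section_step (s : list nat) (B : nat -> Prop) k : (forall p, In p s -> nprime p) ->
  (forall p, B p -> nprime p) -> infinite_primes B ->
  (forall n, exists q, ~ In q s /\ big_section q n) ->
  exists B' : nat -> Prop, infinite_primes B' /\ (forall p, B' p -> B p) /\
    good_section (fun p => In p s \/ B' p) k.
Proof.
move=> sp Bp iB big. set rho := r * c.
(* [rho] dimensions are given up for each prime of [s], and [rho] more for all primes of the new
   infinite set together. *)
have [q [qs bq]] := big (k + rho + rho * length s). have qp : nprime q by case: bq.
have [E [sE [RE [Eq [fE nE]]]]] := finite_big_section _ _ bq.
pose Ds l : gset G := fun g => forall p, In p l -> centralizes_factors p g.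
have sDs : forall l, subgroup G (Ds l).
  move=> l. apply: (sub_forall G nat). exact: centralizes_factors_sub.
have i1 : idx_le G (Ds s) E (q ^ (rho * length s)).
  elim: s sp qs {bq nE big} => [|a l IH] sp qs.
    rewrite Nat.mul_0_r. exists [gone]; split=> //; split; first by move=> x [<-|[]]; sone.
    move=> h Eh; exists gone; split; [by left | by move=> p []].
  have aq : a <> q by move=> e; apply: qs; left.
  have := idx_inter_any _ _ _ _ _ (sDs l) (centralizes_factors_sub a) sE
    (IH (fun p pl => sp p (or_intror pl)) (fun ql => qs (or_intror ql)))
    (centralizes_factors_idx a q E (sp a (or_introl eq_refl)) qp aq sE RE Eq fE).
  rewrite -Nat.pow_add_r. have -> : rho * length l + r * c = rho * length (a :: l) by rewrite /= /rho; nia.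
  by apply: idx_le_mono => x [h1 h2] p [<-|/h1].
pose E1 := inter G (Ds s) E.
have sE1 : subgroup G E1 by apply: sub_inter.
have RE1 : subset G R E1 by move=> x Rx; split; [move=> p _; exact: centralizes_factors_derived | exact: RE].
have idE1 : idx_le G E1 E (q ^ (rho * length s)) by exact: (idx_le_interr _ _ E).
have fE1 : finite_index_in G R E1.
  case/idx_finite: fE => n hn. apply/idx_finite; exists n. apply: idx_le_restrict hn => //. exact: inter_sub_r.
case: (fE1) => l [lE1 lcov].
have iB' : infinite_primes (fun p => B p /\ p <> q).
  move=> m. have [p [le [pp Bp']]] := iB (max m (S q)). exists p; split; first lia. split=> //; split=> //. lia.
have [B2 [iB2 [B2B hB2]]] := infinite_primes_pigeonhole G l centralizes_factors _ iB'.
exists B2; split=> //; split; first by move=> p /B2B [].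
pose E2 := inter G E1 (fun g => forall p, B2 p -> centralizes_factors p g).
have sE2 : subgroup G E2.
  apply: sub_inter => //. apply: (sub_forall G nat). exact: centralizes_factors_sub.
have RE2 : subset G R E2 by move=> x Rx; split; [exact: RE1 | move=> p _; exact: centralizes_factors_derived].
(* A representative of [E1 / R] passes the test for all primes of [B2] or for none, so the bound at
   one prime [p] serves for all. *)
have idE2 : idx_le G E2 E1 (q ^ rho).
  have [p [_ [pp B2p]]] := iB2 0. have [_ npq] := B2B p B2p.
  have i2 := centralizes_factors_idx p q E1 pp qp npq sE1 RE1 (fun e h => Eq e (proj2 h)) fE1.
  apply: idx_le_mono (idx_le_interr _ _ _ _ _ (centralizes_factors_sub p) sE1 (fun _ h => h) i2).
  move=> g [Dg E1g]; split=> // p' B2p'.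
  have [x [xl Rx]] := lcov g E1g.
  have Dx : centralizes_factors p x.
    apply: (sub_mull _ _ _ (x^-1 ** g) (centralizes_factors_sub p)); [exact: centralizes_factors_derived | by rewrite mulVK].
  case: (hB2 x xl) => [h|h]; last by exfalso; apply: (h p B2p).
  rewrite -(mulVK _ x g). apply: (sub_mul _ _ _ _ (centralizes_factors_sub p')); first exact: h.
  exact: centralizes_factors_derived.
exists q, E2; split=> //; split; first by move=> [//|/B2B []].
split=> //; split=> //; split; first by move=> e [[_ /Eq]].
split.
  move=> i. apply: nE. rewrite !Nat.pow_add_r.
  by have := idx_trans _ _ _ _ _ _ sR (idx_trans _ _ _ _ _ _ sR i idE2) idE1.
move=> p [ps|B2p] x [[Dx _] hx]; [exact: Dx | exact: hx].
Qed.

(** Large sections must avoid the primes already chosen. If one [q] has sections of every size,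
    remove [q] from [B]; otherwise each prime has bounded sections and finitely many can be avoided.
    Then diagonalise: step [k] commits one prime to the list and shrinks the reservoir so that a
    section of size [k] survives for both; [tau] is the set of committed primes. *)
Lemma good_sections_exist (B : nat -> Prop) : infinite_primes B -> (forall n, exists q, big_section q n) ->
  exists tau : nat -> Prop, infinite_primes tau /\ (forall p, tau p -> B p) /\ (forall p, tau p -> nprime p) /\
    forall k, good_section tau k.
Proof.
move=> iB big.
have [B0 [iB0 [B0B [B0p hB0]]]] : exists B0 : nat -> Prop, infinite_primes B0 /\ (forall p, B0 p -> B p) /\
  (forall p, B0 p -> nprime p) /\
  forall s, (forall p, In p s -> B0 p) -> forall n, exists q, ~ In q s /\ big_section q n.
  case: (classic (exists q, forall n, big_section q n)) => [[q hq]|no].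
    exists (fun p => B p /\ nprime p /\ p <> q); split.
      move=> m. have [p [le [pp Bp]]] := iB (max m (S q)). exists p; split; first lia.
      split=> //; split=> //; split=> //. lia.
    split; first by move=> p []. split; first by move=> p [_ []].
    move=> s hs n; exists q; split=> // /hs [_ [_]]. by apply.
  exists (fun p => B p /\ nprime p); split.
    move=> m. have [p [le [pp Bp]]] := iB m. by exists p.
  split; first by move=> p []. split; first by move=> p [].
  move=> s _ n.
  have [m0 hN] : exists m0, forall q, In q s -> ~ big_section q m0.
    elim: s => [|a s [m0 hN]]; first by exists 0.
    have [m hm] : exists m, ~ big_section a m.
      apply: NNPP => nm; apply: no; exists a => m. apply: NNPP => h; apply: nm; by exists m.
    exists (max m0 m) => q [<-|/hN nq] h.
      apply: hm. apply: big_section_mono h. lia.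
    apply: nq. apply: big_section_mono h. lia.
  have [q hq] := big (max n m0). exists q; split.
    move=> /hN; apply. apply: big_section_mono hq. lia.
  apply: big_section_mono hq. lia.
pose Inv (s : list nat * (nat -> Prop)) := (forall p, In p (fst s) -> B0 p) /\ (forall p, snd s p -> B0 p) /\ infinite_primes (snd s).
pose T (k : nat) (s s' : list nat * (nat -> Prop)) := exists p, snd s p /\ fst s' = p :: fst s /\
  (forall x : nat, snd s' x -> snd s x /\ p < x) /\ good_section (fun x : nat => In x (fst s') \/ snd s' x) k.
have [||f [f0 hf]] := dependent_choice _ Inv T ([], B0).
- by split.
- move=> k [s B1] [/= h1 [h2 h3]].
  have [B2 [iB2 [B2B [q [E [qp [nq [sE [RE [Eq [nE hE]]]]]]]]]]] := good_section_step s B1 k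
    (fun p ps => B0p p (h1 p ps)) (fun p pB => B0p p (h2 p pB)) h3 (hB0 s h1).
  have [p [_ [pp B2p]]] := iB2 0.
  exists (p :: s, fun x : nat => B2 x /\ p < x); split.
    split=> /=; first by move=> x [<-|/h1 //]; apply: h2; exact: B2B.
    split; first by move=> x [/B2B /h2].
    move=> m. have [x [le [xp B2x]]] := iB2 (max m (S p)). exists x; split; first lia. split=> //; split=> //. lia.
  exists p; split; first exact: B2B. split=> //; split; first by move=> x [/B2B].
  exists q, E; split=> //; split.
    move=> /= [[e|qs]|[B2q _]]; apply: nq; [right; by rewrite -e | by left | by right].
  do 4 (split=> //). move=> x /= [[<-|xs]|[B2x _]]; apply: hE; [by right | by left | by right].
- pose tau (x : nat) := exists k, In x (fst (f k)).
  have mono : forall i j, i <= j -> forall x : nat, In x (fst (f i)) -> In x (fst (f j)).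
    move=> i j; elim=> [|m _ IH] // x /IH h. have [_ [p [_ [-> _]]]] := hf m. by right.
  have smono : forall i j, i <= j -> forall x : nat, snd (f j) x -> snd (f i) x.
    move=> i j; elim=> [|m _ IH] // x h. apply: IH. have [_ [p [_ [_ [h2 _]]]]] := hf m. by case: (h2 x h).
  have later : forall i j, i <= j -> forall x : nat, In x (fst (f j)) -> In x (fst (f i)) \/ snd (f i) x.
    move=> i j; elim=> [|m im IH] x; first by left.
    have [_ [p [sp [-> _]]]] := hf m. move=> [<-|/IH //]. right. exact: smono sp.
  have low : forall k (x : nat), snd (f k) x -> k <= x.
    elim=> [|k IH] x h; first lia. have [_ [p [sp [_ [h2 _]]]]] := hf k. have := IH p sp. have [_ ] := h2 x h. lia.
  have tB0 : forall p, tau p -> B0 p by move=> p [k pk]; have [[h _] _] := hf k; apply: h.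
  exists tau; split.
    move=> m. have [[_ [sB0 _]] [p [sp [e _]]]] := hf m. exists p; split; first exact: low.
    split; first by apply: B0p; exact: sB0. exists (S m). rewrite e. by left.
  split; first by move=> p /tB0 /B0B. split; first by move=> p /tB0 /B0p.
  move=> k. have [_ [p [sp [e [h2 [q [E [qp [nq [sE [RE [Eq [nE hE]]]]]]]]]]]]] := hf k.
  have sub : forall x : nat, tau x -> In x (fst (f (S k))) \/ snd (f (S k)) x.
    move=> x [j xj]. case: (le_lt_dec j (S k)) => le; first by left; exact: (mono j).
    apply: (later _ j) => //. lia.
  exists q, E; split=> //; split; first by move=> /sub.
  do 4 (split=> //). by move=> x /sub; exact: hE.
Qed.

Lemma tel_compl_all (tau : nat -> Prop) x : (forall p, nprime p -> tau p -> tel G (compl (eq p)) x) -> tel G (compl tau) x.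
Proof.
move=> h. have [n [n0 xn]] := per x. have [i [j [e [h1 h2]]]] := tel_split G tau x n n0 xn.
suff yi : x ^+ i = gone by rewrite e yi gmul_1l.
have {}h : forall p, nprime p -> tau p -> tel G (compl (eq p)) (x ^+ i) by move=> p pp tp; apply: tel_pow; exact: h.
move: h1 h; set y := x ^+ i. move=> [m [tm ym]] h.
elim/lt_wf_ind: m tm ym => m IH tm ym.
case: (Nat.eq_dec m 1) => [m1|m1]; first by move: ym; rewrite m1 gpow1.
have m0 : 0 < m by case: tm.
have [p [pp pm]] := prime_divisor m ltac:(lia).
have [a [ta ya]] := h p pp (proj2 tm p pp pm).
have [d1 d2] := Nat.gcd_divide m a.
have y2 : y ^+ Nat.gcd m a = gone.
  have [u [v E]] := Nat.gcd_bezout_pos m a m0.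
  have := gpow_multiple _ y m u ym. by rewrite Nat.mul_comm E gpow_add (Nat.mul_comm v) gpow_multiple // mul1r.
apply: (IH (Nat.gcd m a)) => //; last exact: tnum_div tm.
have := Nat.divide_pos_le _ _ m0 d1 => le.
case: (Nat.eq_dec (Nat.gcd m a) m) => [E|]; last lia.
exfalso. apply: (proj2 ta p pp) => //. rewrite E in d2. exact: Nat.divide_trans pm d2.
Qed.

Definition commuting_part tau : gset G := fun a => tel G (compl tau) a /\
  forall p, nprime p /\ tau p -> cent G (part G R (eq p)) a.

(** For [p] in [tau], modulo [R_p'] the commutator is its [p]-component [u], which commutes with
    [a]. So [u^n = [a^n, b] = 1] for the [tau']-exponent [n] of [a], and [u] is trivial. *)
Lemma commuting_part_comm tau a b : commuting_part tau a -> part G R (compl tau) [~ a, b].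
Proof.
move=> [[n [tn an]] ca]. split; first exact: derived_comm.
apply: tel_compl_all => p pp tp.
have [i [j [e [Pu Pv]]]] := part_split G R (eq p) _ per sR (derived_comm G a b).
move: e Pu Pv; set u := [~ a, b] ^+ i; set v := [~ a, b] ^+ j => e Pu [_ tv].
suff u1 : u = gone by rewrite e u1 gmul_1l.
have nV := part_normal G R (compl (eq p)) nR nilR.
have [Q [f [fM [fS fK]]]] := quotient_exists G _ nV.
have fv : f v = gone by apply/fK; split=> //; apply: (sub_mulr _ R u) => //; [case: Pu | rewrite -e; exact: derived_comm].
have fe : [~ f a, f b] = f u by rewrite -hom_comm // e fM fv mul1r.
have cau : commute (f u) (f a).
  rewrite /commute -!fM. congr f. symmetry. exact: (ca p (conj pp tp)).
have un : f u ^+ n = gone.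
  rewrite -fe -comm_powl; first by rewrite fe. by rewrite -hom_pow // an hom_1 // comm1.
have : part G R (compl (eq p)) (u ^+ n) by apply/fK; rewrite hom_pow.
move=> [_ tun]. case: Pu => _ tu.
have un1 : u ^+ n = gone by apply: (tel_disjoint G _ _ _ (disjoint_compl (eq p)) _ tun); exact: tel_pow.
apply: (tel_disjoint G (eq p) (compl tau)) => //; first by move=> s _ <-.
by exists n.
Qed.

(** Only products need care: modulo [R_tau'] the factors commute, so a [tau']-power of [x y] falls
    into [R_tau']. *)
Lemma commuting_part_normal tau : normal G (commuting_part tau).
Proof.
have nP p : normal G (part G R (eq p)) := part_normal G R (eq p) nR nilR.
have sC : subgroup G (fun x => forall p, nprime p /\ tau p -> cent G (part G R (eq p)) x).
  apply: (sub_forall G nat) => p. exact: cent_sub.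
have nV := part_normal G R (compl tau) nR nilR.
have [Q [f [fM [fS fK]]]] := quotient_exists G _ nV.
apply: normal_of.
  split; first by split; [exact: tel_1 | exact: (sub_1 _ _ sC)].
  split=> [x y hx hy|x [tx cx]]; last by split; [exact: tel_inv | exact: (sub_inv _ _ _ sC)].
  have [[n [tn xn]] cx] := hx. have [[m [tm ym]] cy] := hy. split; last exact: (sub_mul _ _ _ _ sC).
  have k : part G R (compl tau) ((x ** y) ^+ (n * m)).
    apply/fK. rewrite hom_pow // fM gpow_mulM.
      apply/hom_commute => //. apply/fK. exact: commuting_part_comm.
    rewrite -!hom_pow // (gpow_multiple _ _ _ _ xn) Nat.mul_comm (gpow_multiple _ _ _ _ ym). by rewrite hom_1 // gmul_1l.
  case: k => _ [a [ta ea]]. exists (n * m * a); split; last by rewrite gpow_mulA.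
  by do 2 (apply: tnum_mul => //).
move=> x g [tx cx]; split; first exact: tel_conj.
move=> p hp. exact: (normal_conj _ _ _ _ (cent_normal _ _ (nP p)) (cx p hp)).
Qed.

(** The [q]-component of an element of [E] lies in [A] and its [q']-component in [R], so
    [E = (E /\ A) R]; rank [s] for [A] would bound the order of [E / R] by [q ^ s]. *)
Lemma commuting_part_infinite_rank tau : (forall k, good_section tau k) -> infinite_rank G (commuting_part tau).
Proof.
move=> good [s hs]. set A := commuting_part tau in hs *.
have sA : subgroup G A := normal_sub _ _ (commuting_part_normal tau).
have [q [E [qp [nq [sE [RE [Eq [nE hE]]]]]]]] := good s.
apply: nE. have q1 : 1 < q by case: qp.
have sEA := sub_inter _ _ _ sE sA.
have i : idx_le G (inter G R (inter G E A)) (inter G E A) (q ^ s).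
{ apply: idx_of_rank => //.
  - exact: sub_inter.
  - exact: inter_sub_r.
  - by move=> x y hx hy; split; [exact: derived_comm | scomm].
  - lia.
  - by move=> x [Ex Ax]; split; [exact: Eq | split; spow].
  - apply: rank_le_mono hs. exact: inter_sub_r. }
case: i => l [ll [lE lc]]. apply: (idx_le_leq _ _ _ (length l)) => //. apply: idx_of_cover => // e Ee.
have [n [n0 en]] := per e. have [i [j [ee [ti tj]]]] := tel_split G (eq q) e n n0 en.
have Ei : inter G E A (e ^+ i).
  split; first by spow. split; first by apply: tel_mono ti => p _ <-.
  move=> p [pp tp] u [Ru tu]. apply: commute_sym. apply: (coprime_centralizes p q) => //; first by move=> h; rewrite -h in nq.
  apply: hE => //. by spow.
have Rj : R (e ^+ j).
  case: tj => m [tm em].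
  have g : Nat.gcd q m = 1.
    case: (prime_gcd q m qp) => // d. exfalso. apply: (proj2 tm q qp d). by [].
  have [k ->] := coprime_root _ (e ^+ j) q m g ltac:(lia) em. spow => //. apply: Eq. by spow.
have [x [xl [Rx _]]] := lc _ Ei. exists x; split=> //. rewrite ee -mulA. by smul.
Qed.

Lemma commuting_part_exists (B : nat -> Prop) : infinite_primes B -> (forall n, exists q, big_section q n) ->
  exists tau : nat -> Prop, infinite_primes tau /\ (forall p, tau p -> B p) /\ infinite_rank G (commuting_part tau).
Proof.
move=> iB big. have [tau [it [tB [_ good]]]] := good_sections_exist B iB big.
exists tau; split=> //; split=> //. exact: commuting_part_infinite_rank.
Qed.
End FiniteRankDerived.

(** * Actions on divisible groups *)

Section Divisible.
Variable G : Group.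
Implicit Types (x y z g w u v e : G) (A B C D E H K L M N S U V W X : gset G).
Variables (T : gset G) (nT : normal G T) (cT : forall x y, T x -> T y -> commute x y).
Variables (b : nat) (b0 : 0 < b).
Hypothesis tT : forall x, T x -> exists k, x ^+ (b ^ k) = gone.
Let sT : subgroup G T := normal_sub _ _ nT.

Lemma powers_normal m : normal G (powers G T m).
Proof.
apply: normal_of; first exact: powers_sub. move=> _ g [y [Ty ->]].
exists (g^-1 ** (y ** g)); split; [exact: normal_conj | by rewrite gpow_conj].
Qed.
Lemma omega_normal m : normal G (omega G T m).
Proof.
apply: normal_of; first exact: omega_sub. move=> y g [Ty ey]; split; first exact: normal_conj.
rewrite gpow_conj ey; grp.
Qed.
Lemma powers_le i j : i <= j -> subset G (powers G T (b ^ j)) (powers G T (b ^ i)).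
Proof.
move=> le _ [x [Tx ->]]. exists (x ^+ (b ^ (j - i))); split; first by spow.
rewrite -gpow_mulA -Nat.pow_add_r. congr (x ^+ (b ^ _)). lia.
Qed.

Lemma decreasing_stable (l : list G) (P : nat -> gset G) : (forall i j, i <= j -> subset G (P j) (P i)) ->
  exists k, forall x, In x l -> P k x -> forall j, P j x.
Proof.
move=> dec; elim: l => [|a l [k hk]]; first by exists 0.
case: (classic (forall j, P j a)) => [all|].
  by exists k => x [<- //|xl]; apply: hk.
move=> /not_all_ex_not [j nj]. exists (k + j) => x [<-|xl] Px; first by exfalso; apply: nj; apply: dec Px; lia.
apply: hk => //. apply: dec Px; lia.
Qed.

(** Since [T[b]] is finite, some [k] is such that its elements lying in [T^(b^k)] lie in every
    [T^(b^j)]. *)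
Lemma divisible_part : finset G (omega G T b) -> exists k, forall x, powers G T (b ^ k) x ->
  exists y, powers G T (b ^ k) y /\ x = y ^+ b.
Proof.
case=> l hl. have [k hk] := decreasing_stable l (fun i => powers G T (b ^ i)) powers_le.
exists k. have sD := powers_sub G T sT cT (b ^ k).
have DT := powers_in G T sT (b ^ k).
suff H : forall n x, powers G T (b ^ k) x -> x ^+ (b ^ n) = gone -> exists y, powers G T (b ^ k) y /\ x = y ^+ b.
  move=> x Dx. have [n en] := tT x (DT x Dx). exact: (H n).
elim=> [|n IH] x Dx.
  rewrite Nat.pow_0_r gpow1 => ->. exists gone; split; [exact: (sub_1 _ _ sD) | by rewrite gpow_one].
move=> xn.
have Ox : omega G T b (x ^+ (b ^ n)).
  split; first by spow => //; exact: DT. by rewrite -gpow_mulA Nat.mul_comm -Nat.pow_succ_r'.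
have [t [Tt et]] := hk _ (hl _ Ox) (sub_pow _ _ _ _ sD Dx) (k + S n).
(* Now [x] and [w^b] have the same [b^n]-th power, so the induction hypothesis applies to their
   quotient. *)
pose w := t ^+ (b ^ k).
have Dw : powers G T (b ^ k) w by exists t.
have ew : x ^+ (b ^ n) = (w ^+ b) ^+ (b ^ n).
  rewrite et /w -!gpow_mulA. congr (t ^+ _). rewrite Nat.pow_add_r Nat.pow_succ_r'. nia.
have [||y [Dy ey]] := IH (x ** (w ^+ b)^-1).
- apply: (sub_mul _ _ _ _ sD) => //. apply: (sub_inv _ _ _ sD). exact: (sub_pow _ _ _ _ sD).
- rewrite gpow_mulM.
    apply: commute_inv. apply: cT; [exact: DT | spow => //; exact: DT].
  by rewrite gpow_inv ew mulVr.
- exists (y ** w); split; first exact: (sub_mul _ _ _ _ sD).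
  rewrite gpow_mulM; first by apply: cT; exact: DT. rewrite -ey. grp.
Qed.

(* Let [c = [z, e]] with [z ^+ (b * b)] centralised by [e]; then [c] lies in [T[b^2]], so [e] centralises [c] and
   [c ^+ l = [z, e ^+ l]] is trivial for a suitable prime [l], whence [[z ^+ b, e] = c ^+ b] is trivial too. *)
Lemma cent_divisible D n e : subgroup G D -> subset G D T -> (forall x, D x -> exists y, D y /\ x = y ^+ b) ->
  0 < n -> e ^+ n = gone -> (forall z, omega G T (b * b) z -> commute z e) -> forall d, D d -> commute d e.
Proof.
move=> sD DT div. elim/lt_wf_ind: n e => n IH e n0 en ce.
case: (Nat.eq_dec n 1) => n1.
  move: en; rewrite n1 gpow1 => -> d _. exact: commute_1.
have [l [lp [m em]]] := prime_divisor n ltac:(lia). have l1 : 1 < l by case: lp.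
have cl : forall d, D d -> commute d (e ^+ l).
  apply: (IH m); [nia | nia | by rewrite -gpow_mulA Nat.mul_comm -em |].
  move=> z Oz. apply: commute_pow. exact: ce.
suff H : forall j d, D d -> d ^+ (b ^ j) = gone -> commute d e.
  move=> d Dd. have [k dk] := tT d (DT d Dd). exact: (H k).
elim=> [|j IHj] d Dd dj.
  move: dj; rewrite Nat.pow_0_r gpow1 => ->. apply: commute_sym. exact: commute_1.
have [z [Dz ez]] := div d Dd. have Tz := DT z Dz.
have Tc : T [~ z, e] by exact: normal_comml.
have cz : commute [~ z, e] z by exact: cT.
have zb : commute (z ^+ (b * b)) e.
  rewrite gpow_mulA -ez. apply: IHj; first by spow. by rewrite -gpow_mulA -Nat.pow_succ_r'.
have cbb : [~ z, e] ^+ (b * b) = gone by rewrite -comm_powl //; apply/commute_comm.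
have ce' : commute [~ z, e] e by exact: ce.
have cl' : [~ z, e] ^+ l = gone by rewrite -comm_powr //; apply/commute_comm; exact: cl.
rewrite ez. apply/commute_comm. rewrite comm_powl //.
case: (prime_gcd l b lp) => [lb|g]; first exact: gpow_divide cl'.
suff -> : [~ z, e] = gone by rewrite gpow_one.
apply: (coprime_trivial _ _ l (b * b)) => //.
case: (prime_gcd l (b * b) lp) => // /(euclid _ _ _ lp) [] lb; have := Nat.gcd_greatest l b l (Nat.divide_refl l) lb;
  rewrite g => /Nat.divide_1_r; lia.
Qed.

(** [D] is the divisible part, and [C] centralises the two finite groups [T[b^2]] and [T / D]; by
    [cent_divisible] it then centralises [D]. *)
Lemma centralizing_subgroup : periodic G -> finite_rank G T -> exists C D, normal G C /\ finite_index_in G C fullset /\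
  subgroup G D /\ (forall t g, T t -> C g -> D [~ t, g]) /\ forall d g, D d -> C g -> [~ d, g] = gone.
Proof.
move=> per rT.
have finO : forall m, 0 < m -> finset G (omega G T m).
  move=> m m0. have sO := omega_sub G T sT cT m. have tr := sub_triv G.
  have fi : finite_index_in G (trivial_set G) (omega G T m).
  { apply: (fin_index_of_rank _ _ _ m) => //.
    - by move=> x ->; exact: (sub_1 _ _ sO).
    - move=> x y [Tx _] [Ty _]. apply/commute_comm. exact: cT.
    - by move=> x [].
    - apply: finite_rank_mono rT. by move=> x []. }
  exact: finset_fi_triv fi.
have [k hk] := divisible_part (finO b b0).
set D := powers G T (b ^ k) in hk.
have sD : subgroup G D by apply: powers_sub.
have DT : subset G D T by apply: powers_in.
have nD : normal G D by apply: powers_normal.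
pose O2 := omega G T (b * b).
have nO2 : normal G O2 by apply: omega_normal.
have fi1 : finite_index_in G (cent G O2) fullset.
  have := fi_cent_finset G fullset O2 (sub_full G) (finO (b * b) ltac:(nia)).
  have -> : inter G fullset (cent G O2) = cent G O2 by rewrite interC; apply: inter_eq.
  apply. move=> x s _ Os. have := normal_conj _ _ _ x^-1 nO2 Os. by rewrite invK.
have fTD : finite_index_in G D T.
{ apply: (fin_index_of_rank _ _ _ (b ^ k)) => //.
  - move=> x y Tx Ty. have -> : [~ x, y] = gone by apply/commute_comm; exact: cT. exact: (sub_1 _ _ sD).
  - have := Nat.pow_nonzero b k; lia.
  - by move=> x Tx; exists x. }
have [Q [f [fM [fS fK]]]] := quotient_exists G D nD.
pose C2 := pre G Q f (cent Q (img G Q f T)).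
have nimT : normal Q (img G Q f T) by apply: img_normal.
have nC2 : normal G C2 by apply: pre_normal => //; apply: cent_normal.
have sC2 := normal_sub _ _ nC2.
have fimT : finset Q (img G Q f T).
  apply: (img_finset _ _ _ fM D) => // x. exact: (proj2 (fK x)).
have fi2 : finite_index_in G C2 fullset.
  have := fi_cent_finset Q fullset (img G Q f T) (sub_full Q) fimT.
  have -> : inter Q fullset (cent Q (img G Q f T)) = cent Q (img G Q f T) by rewrite interC; apply: inter_eq.
  move=> h. have {}h : finite_index_in Q (cent Q (img G Q f T)) fullset.
    apply: h => x s _ Os. have := normal_conj _ _ _ x^-1 nimT Os. by rewrite invK.
  have := pre_fi G Q f fM fS _ _ (cent_sub _ _) h. by rewrite pre_full.
exists (inter G (cent G O2) C2), D; split; first by apply: normal_inter => //; exact: cent_normal.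
split; first by apply: fi_inter => //; exact: cent_sub.
split=> //; split.
  move=> t g Tt [_ C2g]. apply/fK. rewrite hom_comm //. apply/commute_comm. apply: commute_sym.
  apply: C2g. by exists t.
move=> d g Dd [cg _]. apply/commute_comm. have [n [n0 en]] := per g.
apply: (cent_divisible D n g) => // z Oz. apply: commute_sym. exact: cg.
Qed.
End Divisible.

(* The elements acting trivially on suitable sections [lcs R i >= D >= lcs R (S i)] form a nilpotent group. *)
Lemma nilpotent_finite_index (G : Group) b c : periodic G -> 0 < b ->
  (forall x, lcs G (derived G) c x -> x = gone) -> finite_rank G (derived G) ->
  (forall x, derived G x -> exists k, gpow G x (b ^ k) = gone) ->
  exists C, normal G C /\ nilpotent G C /\ finite_index_in G C fullset.
Proof.
move=> per b0 hc rR tR. have nR := derived_normal G. have sR := normal_sub _ _ nR.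
have step : forall i, exists C D, normal G C /\ finite_index_in G C fullset /\ subgroup G D /\
   (forall t g, lcs G (derived G) i t -> C g -> D [~ t, g]) /\
   (forall d g, D d -> C g -> lcs G (derived G) (S i) [~ d, g]).
{ move=> i. have [Q [f [fM [fS fK]]]] := quotient_exists G _ (lcs_normal _ _ (S i) nR).
  have nL := lcs_normal _ _ i nR. have sL := normal_sub _ _ nL. have LR := lcs_in G _ i sR.
  have [|||||C [D [nC [fC [sD [h1 h2]]]]]] := centralizing_subgroup Q (img G Q f (lcs G (derived G) i)) _ _ b b0.
  - exact: img_normal.
  - move=> _ _ [x [Lx <-]] [y [Ly <-]]. apply/hom_commute => //; apply/fK. apply: lcs_comm => //. exact: LR.
  - move=> _ [x [Lx <-]]. have [k ek] := tR x (LR x Lx). exists k. by rewrite -hom_pow // ek hom_1.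
  - exact: img_periodic per.
  - apply: img_finite_rank => //. exact: finite_rank_mono rR.
  - exists (pre G Q f C), (pre G Q f D); split; first exact: pre_normal.
    split; first by have := pre_fi G Q f fM fS _ _ (normal_sub _ _ nC) fC; rewrite pre_full.
    split; first exact: pre_sub.
    split; first by move=> t g Lt Cg; rewrite /pre hom_comm //; apply: h1 => //; exists t.
    by move=> d g Dd Cg; apply/fK; rewrite hom_comm //; apply: h2. }
have H : forall k, exists C, normal G C /\ finite_index_in G C fullset /\ forall i, i < k -> exists D, subgroup G D /\
   (forall t g, lcs G (derived G) i t -> C g -> D [~ t, g]) /\
   (forall d g, D d -> C g -> lcs G (derived G) (S i) [~ d, g]).
  elim=> [|k [C [nC [fC hC]]]].
    exists fullset; split; first exact: normal_full. split; first by apply: fi_refl; exact: sub_full.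
    by move=> i; lia.
  have [C' [D' [nC' [fC' [sD' [h1 h2]]]]]] := step k.
  exists (inter G C C'); split; first exact: normal_inter.
  split; first by apply: fi_inter => //; exact: normal_sub.
  move=> i le. case: (Nat.eq_dec i k) => [->|ne].
    by exists D'; split=> //; split=> [t g Lt [_ C'g]|d g Dd [_ C'g]]; [apply: h1 | apply: h2].
  have [D [sD [k1 k2]]] := hC i ltac:(lia).
  by exists D; split=> //; split=> [t g Lt [Cg _]|d g Dd [Cg _]]; [apply: k1 | apply: k2].
have [C [nC [fC hC]]] := H c. exists C; split=> //; split=> //.
(* Two steps for each lower central factor of [R], by way of [D], after one step from [C] into
   [R]. *)
have L : forall i, i <= c -> subset G (lcs G C (S (i + i))) (lcs G (derived G) i).
  elim=> [|i IH] le; first by apply: comm_min => // a d _ _; exact: derived_comm.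
  have [D [sD [h1 h2]]] := hC i ltac:(lia). have {}IH := IH ltac:(lia).
  have e : S i + S i = S (S (i + i)) by lia.
  rewrite e. apply: comm_min; first exact: lcs_sub.
  move=> a g La Cg. apply: h2 => //. move: a La. apply: comm_min => // a d La Cd. apply: h1 => //. exact: IH.
exists (S (c + c)) => x /(L c (le_n _)). exact: hc.
Qed.

(** * Derived subgroups of finite rank *)

Lemma finite_group_rank (G : Group) : finset G fullset -> finite_rank G fullset.
Proof.
case=> l hl. exists (length l) => L sL _ _.
have [l' [ll' h']] := list_filter _ L l. exists l'; split=> // x; split.
  move=> Lx. apply: gl_in. apply/h'; split=> //. exact: hl.
by apply: (gl_min _ l' L) => // y /h' [].
Qed.

Lemma infinite_rank_finite_index (G : Group) (C : gset G) : locally_finite G -> normal G C ->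
  finite_index_in G C fullset -> infinite_rank G fullset -> infinite_rank G C.
Proof.
move=> lf nC fC inf [r hr]. apply: inf.
have [Q [f [fM [fS fK]]]] := quotient_exists G C nC.
have [s hs] : finite_rank Q fullset.
  apply: finite_group_rank. rewrite -(img_full G Q f fS).
  apply: (img_finset _ _ _ fM C) => // x. exact: (proj2 (fK x)).
exists (r + s). apply: (rank_le_extension G Q f) => //; last by rewrite img_full.
by apply: rank_le_mono hr => x [/fK].
Qed.

Lemma img_infinite_rank_cn (G Q : Group) (f : G -> Q) : hom G Q f -> surj G Q f ->
  infinite_rank_cn G -> infinite_rank_cn Q.
Proof.
move=> fM fS hyp H snH infH. have sH := subnormal_sub _ _ snH.
have [N [nN cN]] : cn G (pre G Q f H).
  apply: hyp; first exact: pre_subnormal. move=> fr. apply: infH.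
  rewrite -(img_pre G Q f fS H). apply: img_finite_rank => //. exact: pre_sub.
exists (img G Q f N); split; first exact: img_normal.
rewrite -(img_pre G Q f fS H). exact: img_commens.
Qed.

Section Main.
Variable G : Group.
Implicit Types (x y z g w u v e : G) (A E H K L M N S U V W : gset G).
Notation R := (derived G).
Variables (c r : nat).
Hypothesis per : periodic G.
Hypothesis inf : infinite_rank G fullset.
Hypothesis hyp : infinite_rank_cn G.
Hypothesis hc : forall x, lcs G R c x -> x = gone.
Hypothesis hr : rank_le G R r.

Let nR : normal G R := derived_normal G.
Let sR : subgroup G R := normal_sub _ _ nR.
Let nilR : nilpotent G R := ex_intro _ c hc.
Let lf : locally_finite G := locally_finite_of_nilpotent_derived G per nilR.
Let nP tau : normal G (part G R tau) := part_normal G R tau nR nilR.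
Let sP tau : subgroup G (part G R tau) := normal_sub _ _ (nP tau).

Lemma cn_prd_cofinite X B b : subnormal G X -> 0 < b -> (forall p, nprime p -> B p -> Nat.divide p b) ->
  cn G (prd G X (part G R (compl B))).
Proof.
move=> snX b0 Bb. have sX := subnormal_sub _ _ snX.
set K := part G R (compl B).
have [Q [f [fM [fS fK]]]] := quotient_exists G K (nP _).
have perQ := img_periodic G Q f fM fS per.
have lfQ := img_locally_finite G Q f fM fS lf.
have dQ := img_derived G Q f fM fS.
have [C [nC [nilC fC]]] : exists C, normal Q C /\ nilpotent Q C /\ finite_index_in Q C fullset.
{ apply: (nilpotent_finite_index Q b c) => //.
  - move=> y. rewrite -dQ -img_lcs // => [[x [/hc -> <-]]]. exact: hom_1.
  - rewrite -dQ. apply: img_finite_rank => //. by exists r.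
  - move=> y. rewrite -dQ => [[x [Rx <-]]].
    have [i [j [e [[_ [n [tn en]]] Kj]]]] := part_split G R B x per sR Rx.
    have [k nk] := tnum_dvd_pow B b n tn Bb. exists k.
    rewrite e fM. have -> : f (gpow G x j) = gone by apply/fK.
    rewrite mul1r -hom_pow // (gpow_divide _ _ _ _ nk en). exact: hom_1. }
have infQ : infinite_rank Q fullset.
  move=> [s hs]. apply: inf. exists (r + s). apply: (rank_le_extension G Q f) => //; last by rewrite img_full.
  by apply: rank_le_mono hr => x [/fK []].
have infC := infinite_rank_finite_index Q C lfQ nC fC infQ.
have hypQ := img_infinite_rank_cn G Q f fM fS hyp.
have cQ := cn_of_infinite_nilpotent Q C (img G Q f X) lfQ perQ hypQ nC nilC infC (img_subnormal G Q f fM fS X snX).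
have := pre_cn G Q f fM fS _ (img_sub G Q f fM X sX) cQ.
congr (cn _ _). apply: gset_eq => x; split.
  move=> [y [Xy /(hom_eq _ _ _ fM) /fK k]]. exists y, (y^-1 ** x); split=> //; split=> //. by rewrite mulVK.
move=> [y [k [Xy [Kk ->]]]]. exists y; split=> //. rewrite fM. have -> : f k = gone by apply/fK. by rewrite mul1r.
Qed.

(** Climb the subnormal chain of [X]. For [u] in the next term, [[u, y]] lies one term lower, so it
    commutes with [y] modulo [I]; then [[u, y]^m] is congruent to [[u, y^m] = 1], with [m] prime to
    [p]. *)
Lemma coprime_commutator_in X I p y : subnormal G X -> normal G I ->
  subset G (inter G X (part G R (eq p))) I -> X y -> tel G (compl (eq p)) y ->
  forall u, part G R (eq p) u -> I [~ u, y].
Proof.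
move=> snX nI XI Xy ty. have sX := subnormal_sub _ _ snX. have sI := normal_sub _ _ nI.
case: snX => n [s [s0 [sn hs]]].
have Xs : forall i, i <= n -> subset G X (s i).
  elim=> [|i IH] le; first by rewrite s0. move=> x /(IH ltac:(lia)). by have [_ [_ [h _]]] := hs i le; apply: h.
have [Q [f [fM [fS fK]]]] := quotient_exists G I nI.
suff H : forall i, i <= n -> forall u, part G R (eq p) u -> s i u -> I [~ u, y].
  move=> u Pu; apply: (H n) => //. by rewrite sn.
elim=> [|i IH] le u Pu su; first by apply: normal_comml => //; apply: XI; rewrite -s0.
have [si [si' [_ nrm]]] := hs i le.
have sc : s i [~ u, y].
  have -> : [~ u, y] = (u^-1 ** (y^-1 ** u)) ** y by grp.
  have sy := Xs i ltac:(lia) y Xy. smul => //. apply: nrm => //. by sinv.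
have Pc : part G R (eq p) [~ u, y] by exact: normal_comml.
have Icy := IH ltac:(lia) _ Pc sc.
case: ty => m [tm ym].
have Icm : I ([~ u, y] ^+ m).
  apply/fK. rewrite hom_pow // hom_comm // -comm_powr.
    by rewrite -hom_comm //; apply/hom_commute => //; apply/fK.
  by rewrite -hom_pow // ym hom_1 // comm_1.
case: Pc => _ tc.
have [k ->] := tel_root G _ _ _ m (disjoint_sym _ _ (disjoint_compl (eq p))) tc tm. by spow.
Qed.

(* For a [p']-element [y] of [X], coprime action puts [[R_p, y]] inside the normal subgroup [I = N /\ R_p] of [X].
   Writing [y ^ g = y u v] with [u] in [R_p] and [v] in [R_p'], the elements [y] and [u] commute modulo [I R_p'];
   comparing orders, [u] lies in [I]. *)
Lemma normal_prd_compl X p H N : nprime p -> subnormal G X -> subgroup G H -> normal G N ->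
  subset G X H -> (forall x, tel G (eq p) x -> (H x <-> N x)) ->
  subset G (inter G H (part G R (eq p))) X ->
  normal G (prd G X (part G R (compl (eq p)))).
Proof.
move=> pp snX sH nN XH HN HX. have sX := subnormal_sub _ _ snX. have sN := normal_sub _ _ nN.
set K := part G R (compl (eq p)). set P := part G R (eq p).
have nK : normal G K := nP _. have sK := normal_sub _ _ nK.
have sY : subgroup G (prd G X K) by apply: prd_n_sub.
have XY := prd_l G X K sK. have KY := prd_r G X K sX.
pose I := inter G N P.
have nI : normal G I by apply: normal_inter => //; exact: nP.
have sI := normal_sub _ _ nI.
have IX : subset G I X.
  move=> x [Nx Px]; apply: HX; split=> //. apply/HN => //. by case: Px.
have XI : subset G (inter G X P) I.
  move=> x [Xx Px]; split=> //. apply/HN; [by case: Px | exact: XH].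
have pelt : forall x g, X x -> tel G (eq p) x -> prd G X K [~ x, g].
  move=> x g Xx tx.
  have Nx : N x by apply/HN => //; exact: XH.
  have Hxg : H (g^-1 ** (x ** g)) by apply/HN; [exact: tel_conj | exact: normal_conj].
  have Hc : H [~ x, g].
    have -> : [~ x, g] = x^-1 ** (g^-1 ** (x ** g)) by grp. apply: (sub_div _ H) => //. exact: XH.
  have [i [j [e [Pi Kj]]]] := part_split G R (eq p) _ per sR (derived_comm G x g).
  rewrite e. apply: (sub_mul _ _ _ _ sY); last exact: KY.
  apply: XY. apply: HX; split=> //. by apply: (sub_pow _ H).
have p'elt : forall y g, X y -> tel G (compl (eq p)) y -> prd G X K [~ y, g].
  move=> y g Xy ty.
  have [i [j [e [Pi Kj]]]] := part_split G R (eq p) _ per sR (derived_comm G y g).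
  move: e Pi Kj; set u := [~ y, g] ^+ i; set v := [~ y, g] ^+ j => e Pu Kv.
  rewrite e. apply: (sub_mul _ _ _ _ sY); last exact: KY. apply: XY. apply: IX.
  have nIK : normal G (prd G I K).
    apply: normal_of; first exact: prd_n_sub. move=> _ h [a [b [Ia [Kb ->]]]].
    exists (h^-1 ** (a ** h)), (h^-1 ** (b ** h)); split; first exact: normal_conj.
    split; [exact: normal_conj | grp].
  have [Q [f [fM [fS fK]]]] := quotient_exists G _ nIK.
  have IIK := prd_l G I K sK. have KIK := prd_r G I K sI.
  have cuy : commute (f u) (f y).
    apply/hom_commute => //. apply/fK. apply: IIK. exact: (coprime_commutator_in X I p).
  have fv : f v = gone by apply/fK; apply: KIK.
  case: ty => n [tn yn].
  have un : f u ^+ n = gone.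
    have E : f (g^-1 ** (y ** g)) = f y ** f u by rewrite conj_comm e !fM fv mul1r.
    have : f (g^-1 ** (y ** g)) ^+ n = gone.
      rewrite -hom_pow // gpow_conj yn. have -> : g^-1 ** (gone ** g) = gone by grp. exact: hom_1.
    rewrite E gpow_mulM //. by rewrite -hom_pow // yn hom_1 // gmul_1l.
  have : prd G I K (u ^+ n) by apply/fK; rewrite hom_pow.
  case=> s [t [Is [Kt est]]].
  have Pt : P t.
    have -> : t = s^-1 ** u ^+ n by rewrite est mulKV.
    apply: (sub_div _ P) => //; [exact: sP | by case: Is | apply: (sub_pow _ P) => //; exact: sP].
  have t1 : t = gone by apply: (tel_disjoint G _ _ _ (disjoint_compl (eq p))); [case: Pt | case: Kt].
  case: (Pu) => _ tu.
  have [k ->] := tel_root G _ _ u n (disjoint_sym _ _ (disjoint_compl (eq p))) tu tn.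
  apply: (sub_pow _ I) => //. by rewrite est t1 mul1r.
have elt : forall x g, X x -> prd G X K [~ x, g].
  move=> x g Xx. have [n [n0 xn]] := per x. have [i [j [e [ti tj]]]] := tel_split G (eq p) x n n0 xn.
  have Xi : X (x ^+ i) by spow. have Xj : X (x ^+ j) by spow.
  rewrite e.
  have -> : [~ x ^+ i ** x ^+ j, g] = (x ^+ j)^-1 ** ([~ x ^+ i, g] ** x ^+ j) ** [~ x ^+ j, g] by grp.
  apply: (sub_mul _ _ _ _ sY); last exact: p'elt.
  apply: (sub_div _ _ _ _ sY); first exact: XY. apply: (sub_mul _ _ _ _ sY); [exact: pelt | exact: XY].
apply: normal_of_comm => // _ g [x [k [Xx [Kk ->]]]].
have -> : [~ x ** k, g] = k^-1 ** ([~ x, g] ** k) ** [~ k, g] by grp.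
apply: (sub_mul _ _ _ _ sY); last by apply: KY; exact: normal_comml.
apply: (sub_div _ _ _ _ sY); first exact: KY. apply: (sub_mul _ _ _ _ sY); [exact: elt | exact: KY].
Qed.

(** Some [x^j] with [0 < j < p] lies in [N], and it generates the [p]-element [x]. *)
Lemma p_element_of_fi H N (l : list G) p x : subgroup G H -> subgroup G N ->
  (forall h, H h -> exists y, In y l /\ inter G H N (y^-1 ** h)) -> nprime p -> length l < p ->
  tel G (eq p) x -> H x -> N x.
Proof.
move=> sH sN cov pp lp [n [tn xn]] Hx.
have [j [jl [_ Nj]]] := fi_pow G (inter G H N) H l x (sub_inter _ _ _ sH sN) sH Hx cov.
have tj : tnum (compl (eq p)) j.
  split; first lia. move=> q qp qj e. have := Nat.divide_pos_le q j ltac:(lia) qj. lia.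
have [k ->] := coprime_root _ x j n (tnum_coprime _ _ _ _ (disjoint_sym _ _ (disjoint_compl (eq p))) tj tn) ltac:(lia) xn.
by spow.
Qed.

Lemma bad_primes_finite X : subnormal G X ->
  ~ infinite_primes (fun p => ~ normal G (prd G X (part G R (compl (eq p))))).
Proof.
move=> snX iB. have sX := subnormal_sub _ _ snX.
have big : forall n, exists q, big_section G q n.
  move=> n. by apply: large_elementary_sections => //; exists r.
have [tau [it [tB infA]]] := commuting_part_exists G c r hc hr per _ iB big.
set A := commuting_part G tau in infA.
have nA : normal G A by apply: (commuting_part_normal G c).
have [N [nN [[l1 [_ h1]] [l2 [_ h2]]]]] : cn G (prd G X A).
  apply: hyp; first exact: prd_subnormal. apply: infinite_rank_mono infA. exact: prd_r.
(* A prime above both index bounds, so that [X A] and [N] have the same [p]-elements. *)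
have [p [pl [pp tp]]] := it (S (length l1 + length l2)).
have sN := normal_sub _ _ nN. have sA := normal_sub _ _ nA.
have sH : subgroup G (prd G X A) by apply: prd_n_sub.
apply: (tB p tp). apply: (normal_prd_compl X p (prd G X A) N) => //.
- exact: prd_l.
- move=> x tx; split.
    apply: (p_element_of_fi _ _ l1 p) => //. lia.
  apply: (p_element_of_fi _ _ l2 p) => //; last lia. by rewrite interC.
(* In [w = x a] the factor [a] commutes with [w], so [x^n = w^n] for the exponent [n] of [a]; as [n]
   is prime to [p], [w] is a power of [x^n]. *)
- move=> w [[x [a [Xx [Aa ew]]]] [Rw tw]].
  case: Aa => [[n [tn an]] ca].
  have caw : commute a w by apply: (ca p (conj pp tp)).
  have xn : x ^+ n = w ^+ n.
    have -> : x = w ** a^-1 by rewrite ew; grp.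
    rewrite gpow_mulM; first by apply: commute_inv; exact: commute_sym.
    by rewrite gpow_inv an inv1 mul1r.
  have [k ->] := tel_root G (compl tau) (eq p) w n ltac:(by move=> q _ h e; apply: h; rewrite -e) tw tn.
  spow => //. rewrite -xn. by spow.
Qed.

(** If [z = x k] with [k] in [R_p'], then [z] and [x] have the same [p]-component, which is
    therefore in [X]. Remove it and induct on the order of [z]. *)
Lemma coprime_part_in X B z : subgroup G X -> R z -> tel G (compl B) z ->
  (forall p, nprime p -> ~ B p -> prd G X (part G R (compl (eq p))) z) -> X z.
Proof.
move=> sX Rz [n [tn zn]]. elim/lt_wf_ind: n z Rz tn zn => n IH z Rz tn zn hz.
have n0 : 0 < n by case: tn.
case: (Nat.eq_dec n 1) => n1; first by move: zn; rewrite n1 gpow1 => ->; sone.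
have [p [pp pn]] := prime_divisor n ltac:(lia).
have nB : ~ B p by apply: (proj2 tn p pp pn).
set P := part G R (eq p). set K := part G R (compl (eq p)).
have [i [j [e [Pi Kj]]]] := part_split G R (eq p) z per sR Rz.
have [x [k [Xx [Kk ez]]]] := hz p pp nB.
have Rx : R x by apply: (sub_mull _ R x k) => //; [case: Kk | rewrite -ez].
have [i' [j' [ex [Pi' Kj']]]] := part_split G R (eq p) x per sR Rx.
have sPp : subgroup G P := sP _. have sKp : subgroup G K := sP _.
have E : (x ^+ i')^-1 ** z ^+ i = gone.
  apply: (tel_disjoint G _ _ _ (disjoint_compl (eq p))).
    by case: (sub_div _ _ _ _ sPp Pi' Pi).
  have E2 : (x ^+ i')^-1 ** z ^+ i = (x ^+ j' ** k) ** (z ^+ j)^-1.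
    have solve : forall a b d : G, a = b ** d -> b = a ** d^-1 /\ d = b^-1 ** a by move=> a b d ->; split; grp.
    have [-> _] := solve _ _ _ e. have [_ ->] := solve _ _ _ ex. by rewrite {1}ez !mulA.
  rewrite E2. have : K ((x ^+ j' ** k) ** (z ^+ j)^-1).
    apply: (sub_mul _ K) => //; [exact: (sub_mul _ K) | exact: (sub_inv _ K)].
  by case.
have Xi : X (z ^+ i) by rewrite -(eq_of_div _ _ _ E); spow.
rewrite e. smul => //.
have [_ [a [ta ea]]] := Kj.
have [d1 d2] := Nat.gcd_divide n a.
have le := Nat.divide_pos_le _ _ n0 d1.
apply: (IH (Nat.gcd n a)) => //.
- case: (Nat.eq_dec (Nat.gcd n a) n) => [Eg|]; last lia. exfalso.
  apply: (proj2 ta p pp) => //. rewrite Eg in d2. exact: Nat.divide_trans pn d2.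
- by spow.
- exact: tnum_div tn.
- have [u [v EE]] := Nat.gcd_bezout_pos n a n0.
  have zj : z ^+ j ^+ n = gone by rewrite gpow_mulAC zn gpow_one.
  have := gpow_multiple _ (z ^+ j) n u zj. by rewrite Nat.mul_comm EE gpow_add (Nat.mul_comm v) gpow_multiple // mul1r.
- move=> q qp nq. have := hz q qp nq. apply: sub_pow. exact: prd_n_sub.
Qed.

Lemma normal_prd_bad X B : subgroup G X ->
  (forall p, nprime p -> ~ B p -> normal G (prd G X (part G R (compl (eq p))))) ->
  normal G (prd G X (part G R B)).
Proof.
move=> sX hB. have sY : subgroup G (prd G X (part G R B)) by apply: prd_n_sub.
have XY := prd_l G X (part G R B) (sP _). have RY := prd_r G X (part G R B) sX.
have elt : forall x g, X x -> prd G X (part G R B) [~ x, g].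
  move=> x g Xx. have Rc := derived_comm G x g.
  have [i [j [e [Bi Bj]]]] := part_split G R B _ per sR Rc.
  rewrite e. apply: (sub_mul _ _ _ _ sY); first exact: RY. apply: XY.
  case: Bj => Rj tj. apply: (coprime_part_in X B) => // p pp nB.
  have nY := hB p pp nB. apply: (sub_pow _ _ _ _ (normal_sub _ _ nY)).
  apply: normal_comml => //. exact: (prd_l _ _ _ (sP _) _ Xx).
apply: normal_of_comm => // _ g [x [k [Xx [Kk ->]]]].
have -> : [~ x ** k, g] = k^-1 ** ([~ x, g] ** k) ** [~ k, g] by grp.
apply: (sub_mul _ _ _ _ sY); last by apply: RY; apply: normal_comml => //; exact: nP.
apply: (sub_div _ _ _ _ sY); first exact: RY. apply: (sub_mul _ _ _ _ sY); [exact: elt | exact: RY].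
Qed.

Lemma cn_of_finite_rank_derived X : subnormal G X -> cn G X.
Proof.
move=> snX. have sX := subnormal_sub _ _ snX.
pose B p := nprime p /\ ~ normal G (prd G X (part G R (compl (eq p)))).
have [b hb] : exists b, forall p, B p -> p < b.
  apply: NNPP => no. apply: (bad_primes_finite X snX) => m.
  apply: NNPP => nm. apply: no. exists m => p [pp nY].
  case: (le_lt_dec m p) => // le. exfalso; apply: nm. by exists p.
(* The factorial of [b], used as a positive number divisible by every prime in [B]. *)
pose bb := list_mul (seq 1 b).
have b0 : 0 < bb.
  rewrite /bb; move: 1 (Nat.lt_0_1). elim: b {hb bb} => [|b IH] s s0 /=; first lia.
  have := IH (S s) ltac:(lia). nia.
have c1 : cn G (prd G X (part G R (compl B))).
  apply: (cn_prd_cofinite X B bb) => // p pp Bp. apply: list_mul_dvd. apply/in_seq.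
  have := hb p Bp. case: pp; lia.
have n2 : normal G (prd G X (part G R B)).
  apply: normal_prd_bad => // p pp nB. apply: NNPP => nY. by apply: nB.
apply: (cn_of_prd G X (part G R B) (part G R (compl B)) B (compl B)) => //; try exact: nP; try by move=> x [].
exact: cn_normal.
Qed.
End Main.

Theorem theoremB (G : Group) :
  periodic G ->
  infinite_rank G fullset ->
  nilpotent G (derived G) ->
  (forall H : gset G, subnormal G H -> infinite_rank G H ->
     exists N : gset G, normal G N /\ commensurable G H N) ->
  forall H : gset G, subnormal G H ->
     exists N : gset G, normal G N /\ commensurable G H N.
Proof.
move=> per inf nil hyp H snH.
have lf := locally_finite_of_nilpotent_derived G per nil.
case: (classic (finite_rank G (derived G))) => [[r hr]|infR].
  case: nil => c hc. exact: (cn_of_finite_rank_derived G c r per inf hyp hc hr H snH).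
exact: (cn_of_infinite_nilpotent G (derived G) H lf per hyp (derived_normal G) nil infR snH).
Qed.
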